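(* There exist an absolute constant $C$ and a deterministic algorithm with running time polynomial (indeed $O(|V|^3)$) in the number of vertices $|V| = m_\ell m_s$, which, given any instance $(G, X_I, X_G)$ on an $m_\ell\times m_s$ grid $G$ ($m_\ell \ge m_s$, $m_\ell\ge 3$, $m_s\ge 2$) with all vertices occupied, outputs a valid solution, such that for all sufficiently large $m_\ell$, the average over all instances on $G$ with $X_I \neq X_G$ of the ratio (makespan of the output solution)/(minimum makespan of the instance) is at most $C$.
   Context: The $m_\ell \times m_s$ grid graph has vertex set $\{1,\dots,m_\ell\}\times\{1,\dots,m_s\}$ with edges between vertices at $\ell_1$-distance 1. A configuration is a bijection from robot labels $\{1,\dots,m_\ell m_s\}$ to the vertex set. A solution of $(G,X_I,X_G)$ is a sequence of synchronous steps from $X_I$ to $X_G$ in which each robot stays put or moves to an adjacent vertex, with no two robots at the same vertex afterwards and no two robots traversing the same edge in opposite directions; its makespan is the number of steps, and the minimum makespan is the least makespan over all solutions. *)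

(* Defs.v *)
From mathcomp Require Import all_boot all_order all_algebra.
Set Implicit Arguments. Unset Strict Implicit. Unset Printing Implicit Defensive.

Definition vtx (ml ms : nat) := ('I_ml * 'I_ms)%type.

(* A configuration: map from robot labels 'I_(ml*ms) to vertices.
   It is a configuration (bijection) iff it is injective (equal cardinalities). *)
Definition config (ml ms : nat) := {ffun 'I_(ml * ms) -> vtx ml ms}.

Definition is_config ml ms (X : config ml ms) : bool := injectiveb X.

Definition grid_adj ml ms (u v : vtx ml ms) : bool :=
  ((u.1 == v.1 :> nat) && ((u.2.+1 == v.2 :> nat) || (v.2.+1 == u.2 :> nat)))
  || ((u.2 == v.2 :> nat) && ((u.1.+1 == v.1 :> nat) || (v.1.+1 == u.1 :> nat))).

Definition valid_step ml ms (X Y : config ml ms) : bool :=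
  [&& injectiveb Y,
      [forall r, (Y r == X r) || grid_adj (X r) (Y r)] &
      ~~ [exists r1, exists r2, [&& r1 != r2, Y r1 == X r2 & Y r2 == X r1]]].

(* A solution from XI to XG is the sequence s = [X_1; ...; X_T] of the
   configurations after each step; its makespan is T = size s. *)
Definition is_solution ml ms (XI XG : config ml ms) (s : seq (config ml ms)) : Prop :=
  path (@valid_step ml ms) XI s /\ last XI s = XG.

Definition is_min_makespan ml ms (XI XG : config ml ms) (T : nat) : Prop :=
  (exists s, is_solution XI XG s /\ size s = T) /\
  (forall s, is_solution XI XG s -> T <= size s).

Definition instances ml ms : {set config ml ms * config ml ms} :=
  [set p | [&& is_config p.1, is_config p.2 & p.1 != p.2]].

Inductive instr : Type :=
| ICONST (d k : nat)
| IADD (d a b : nat)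
| ISUB (d a b : nat)      (* M[d] := M[a] - M[b] (truncated) *)
| ILOAD (d a : nat)
| ISTORE (d a : nat)
| IJZ (a l : nat)
| IHALT.

Definition program := seq instr.
Definition state := (nat * (nat -> nat))%type.   (* program counter, memory *)

Definition upd (m : nat -> nat) (a v : nat) : nat -> nat :=
  fun x => if x == a then v else m x.

(* One step; None when halted (IHALT, or pc outside the program). *)
Definition step (P : program) (s : state) : option state :=
  let: (pc, m) := s in
  match nth IHALT P pc with
  | ICONST d k => Some (pc.+1, upd m d k)
  | IADD d a b => Some (pc.+1, upd m d (m a + m b))
  | ISUB d a b => Some (pc.+1, upd m d (m a - m b))
  | ILOAD d a => Some (pc.+1, upd m d (m (m a)))
  | ISTORE d a => Some (pc.+1, upd m (m d) (m a))
  | IJZ a l => Some (if m a == 0 then l else pc.+1, m)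
  | IHALT => None
  end.

Definition halted (P : program) (s : state) : bool :=
  if step P s is None then true else false.

Fixpoint run (P : program) (t : nat) (s : state) : state :=
  match t with
  | 0 => s
  | t'.+1 => if step P s is Some s' then run P t' s' else s
  end.

Definition enc_vtx ml ms (v : vtx ml ms) : nat := v.1 * ms + v.2.

(* Input memory: M[0] = ml, M[1] = ms, M[2+r] = XI(r), M[2+n+r] = XG(r). *)
Definition init_mem ml ms (XI XG : config ml ms) : nat -> nat :=
  fun a =>
    if a == 0 then ml else if a == 1 then ms else
    match (insub (a - 2) : option 'I_(ml * ms)) with
    | Some r => enc_vtx (XI r)
    | None =>
      match (insub (a - 2 - ml * ms) : option 'I_(ml * ms)) with
      | Some r => enc_vtx (XG r)
      | None => 0
      end
    end.

Definition encodes_solution ml ms (m : nat -> nat) (XI : config ml ms)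
    (s : seq (config ml ms)) : Prop :=
  m 0 = size s /\
  forall (k : nat) (r : 'I_(ml * ms)), k <= size s ->
    m (1 + k * (ml * ms) + r) = enc_vtx (nth XI (XI :: s) k r).

Definition final_state (P : program) (c : nat) ml ms (XI XG : config ml ms) : state :=
  run P (c * (ml * ms) ^ 3) (0, init_mem XI XG).

Definition out_makespan (P : program) (c : nat) ml ms (XI XG : config ml ms) : nat :=
  (final_state P c XI XG).2 0.

(* Main.v *)
(** Every instance is routed in [222 * ml] steps. A transposition of two adjacent
    robots in a 3 x 2 block is a product of at most five rotations of cycles of
    the block, each of which is a legal step; disjoint blocks work in parallel.
    Hence a round of comparators on all edges of all rows, or all columns, takes
    constantly many steps, and [ml] rounds sort every line. Three sorting phases
    suffice: colour the robots, seen as edges between their start column and their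
    goal column, with [ml] colours (Koenig, by Kempe chains), move each robot
    within its column to the row given by its colour, then within that row to its
    goal column, then within that column to its goal row.

    Conversely the minimum makespan is at least the row displacement of each
    robot. For two fixed robots the larger displacement [d] of a random instance
    satisfies [E (1 / (d + 1)) = O (1 / ml)], so the average ratio is bounded.

    The machine program is compiled from a small language with bounded loops. All
    directly addressable cells hold input at the beginning and output at the end,
    so the program first moves to addresses beyond [1024 * 8 ^ ml]. *)

Require Import Defs.
From mathcomp Require Import all_boot all_order all_algebra.
From mathcomp Require Import all_fingroup.
From mathcomp Require Import zify.
Set Implicit Arguments. Unset Strict Implicit. Unset Printing Implicit Defensive.

(** * A structured language over the random access machine *)

(** One robot would not do for the average: its row displacement [d] alone gives [E (1 / (d + 1))]
    of order [log ml / ml]. When [d] is the larger displacement of two robots, each position of one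
    leaves only [ms * (2 * d + 1)] positions to the other, and this count cancels [1 / (d + 1)].
    Rows are used because [ml] is the long side, the scale of the makespan. Koenig is applied to the
    bipartite multigraph on [ms] start columns and [ms] goal columns; every column has degree [ml],
    so [ml] colours suffice and a colour can name a row. The blocks of a round come in overlapping
    classes, so its comparators do not follow the odd-even order; the sorting bound has to hold for
    every order. The machine only adds and subtracts, so quotients, remainders and products are
    obtained by counting. No cell of constant address is surely free at the start, which costs two
    input values: they may be erased because the other values of a bijection and one bit determine
    them. *)

Lemma run_add P a b s : run P (a + b) s = run P b (run P a s).
Proof.
elim: a s => [|a IH] s //=.
case E: (step P s) => [s'|]; first exact: IH.
by case: b {IH} => [|b] //=; rewrite E.
Qed.

Definition code_at (P : program) off code :=
  forall i, i < size code -> nth IHALT P (off + i) = nth IHALT code i.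

Lemma code_at_cat P off c1 c2 : code_at P off (c1 ++ c2) ->
  code_at P off c1 /\ code_at P (off + size c1) c2.
Proof.
move=> H; split=> i Hi.
  by rewrite H ?size_cat ?ltn_addr // nth_cat Hi.
by rewrite -addnA H ?size_cat ?ltn_add2l // nth_cat ltnNge leq_addr addKn.
Qed.

(** The count [k] is only an upper bound, so that branches of unequal length fit the single
    worst-case cost of a command. *)
Definition reaches (P : program) k s s' := exists2 t, t <= k & run P t s = s'.

Lemma reaches_refl P k s : reaches P k s s.
Proof. by exists 0. Qed.

Lemma reaches_trans P k1 k2 s1 s2 s3 :
  reaches P k1 s1 s2 -> reaches P k2 s2 s3 -> reaches P (k1 + k2) s1 s3.
Proof.
move=> [t1 H1 R1] [t2 H2 R2]; exists (t1 + t2); first exact: leq_add.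
by rewrite run_add R1.
Qed.

Lemma reaches_le P k1 k2 s1 s2 : k1 <= k2 -> reaches P k1 s1 s2 -> reaches P k2 s1 s2.
Proof. by move=> H [t Ht R]; exists t => //; apply: leq_trans H. Qed.

Lemma reaches_step P k s1 s2 s3 :
  step P s1 = Some s2 -> reaches P k s2 s3 -> reaches P k.+1 s1 s3.
Proof. by move=> H [t Ht R]; exists t.+1 => //=; rewrite H. Qed.

Definition jump_free (i : instr) := match i with IJZ _ _ => false | IHALT => false | _ => true end.

Definition exec_mem (i : instr) (m : nat -> nat) : nat -> nat :=
  match i with
  | ICONST d k => upd m d k
  | IADD d a b => upd m d (m a + m b)
  | ISUB d a b => upd m d (m a - m b)
  | ILOAD d a => upd m d (m (m a))
  | ISTORE d a => upd m (m d) (m a)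
  | _ => m
  end.

Definition exec_block (c : program) m := foldl (fun m i => exec_mem i m) m c.

Lemma reaches_block P off c m : code_at P off c -> all jump_free c ->
  reaches P (size c) (off, m) (off + size c, exec_block c m).
Proof.
elim: c off m => [|i c IH] off m /=; first by rewrite addn0 => *; exact: reaches_refl.
move=> H /andP[Ji Jc]; apply: (reaches_step (s2 := (off.+1, exec_mem i m))).
  by rewrite /step; move: (H 0 isT); rewrite addn0 /= => ->; case: i Ji {H}.
rewrite -addSnnS; apply: IH => // j Hj.
by move: (H j.+1 Hj); rewrite addnS addSn.
Qed.

Lemma reaches_jz P off a l m : nth IHALT P off = IJZ a l ->
  reaches P 1 (off, m) (if m a == 0 then l else off.+1, m).
Proof. by move=> H; apply: reaches_step (reaches_refl _ _ _); rewrite /step H. Qed.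

Inductive expr :=
| EC of nat | EP of nat | EV of nat | EA of nat & expr | ELo of expr
| EAdd of expr & expr | ESub of expr & expr | EIf of expr & expr & expr.

(* Loop bounds are constants or the read-only parameters [par], so that the
   running time does not depend on the store. *)
Inductive bnd := BC of nat | BP of nat.

Inductive cmd :=
| CSkip
| CSet of nat & expr | CPut of nat & expr & expr | CLo of expr & expr
| CSeq of cmd & cmd | CIf of expr & cmd & cmd | CFor of nat & bnd & cmd.

(* [vr]: variables; [ar k j]: entry [j] of the array [k]; [lo a]: the cells
   [RB <= a < S], shared by the input and the output. *)
Record store := Store { vr : nat -> nat; ar : nat -> nat -> nat; lo : nat -> nat }.

(* Cell 0 holds the base address [S], cells 1-4 the parameters, cells
   [8 + x] the variables and cells [TB <= a < RB] temporaries. The 16 arrays are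
   interleaved from [S] on, so none of them needs a bound. *)
Definition RB := 64.
Definition TB := 40.
Definition NV := 32.

Section Sem.
Variables (S : nat) (par : nat -> nat).

Fixpoint eval (st : store) e := match e with
  | EC k => k | EP p => par p | EV x => vr st x
  | EA k e => ar st k (eval st e)
  (* beyond [S] the machine skips the load and leaves the address itself *)
  | ELo e => if RB + eval st e < S then lo st (RB + eval st e) else RB + eval st e
  | EAdd a b => eval st a + eval st b
  | ESub a b => eval st a - eval st b
  | EIf c a b => if eval st c == 0 then eval st b else eval st a
  end.

Definition setv x v st := Store (upd (vr st) x v) (ar st) (lo st).
Definition seta k j v st :=
  Store (vr st) (fun k' => if k' == k then upd (ar st k) j v else ar st k') (lo st).
Definition setlo j v st :=
  if RB + j < S then Store (vr st) (ar st) (upd (lo st) (RB + j) v) else st.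

Definition bval b := match b with BC k => k | BP p => par p end.

(** A loop leaves its counter at the bound, because the compiled loop counts in the variable's own
    cell and exits with that value. *)
Fixpoint ev c st := match c with
  | CSkip => st
  | CSet x e => setv x (eval st e) st
  | CPut k a b => seta k (eval st a) (eval st b) st
  | CLo a b => setlo (eval st a) (eval st b) st
  | CSeq a b => ev b (ev a st)
  | CIf e a b => if eval st e == 0 then ev b st else ev a st
  | CFor x b c => setv x (bval b) (iteri (bval b) (fun i s => ev c (setv x i s)) st)
  end.

Fixpoint expr_cost e := match e with
  | EC _ => 1 | EP _ => 2 | EV _ => 2
  | EA _ e => expr_cost e + 8
  | ELo e => expr_cost e + 5
  | EAdd a b => expr_cost a + expr_cost b + 1
  | ESub a b => expr_cost a + expr_cost b + 1
  | EIf c a b => expr_cost c + expr_cost a + expr_cost b + 3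
  end.

Fixpoint cmd_cost c := match c with
  | CSkip => 0
  | CSet x e => expr_cost e + 2
  | CPut k a b => expr_cost a + expr_cost b + 8
  | CLo a b => expr_cost a + expr_cost b + 5
  | CSeq a b => cmd_cost a + cmd_cost b
  | CIf e a b => expr_cost e + cmd_cost a + cmd_cost b + 3
  | CFor x b c => (bval b) * (cmd_cost c + 8) + 5
  end.

Definition Rel st (m : nat -> nat) := 
  [/\ m 0 = S, forall p, p < 4 -> m (1 + p) = par p,
      forall x, x < NV -> m (8 + x) = vr st x,
      forall k j, k < 16 -> m (S + 16 * j + k) = ar st k j
    & forall a, RB <= a < S -> m a = lo st a].

End Sem.

(** Without a multiplication instruction, four doublings turn an index into an offset; 16 is the
    stride of the interleaved arrays. *)
Definition times16 t := [:: IADD t t t; IADD t t t; IADD t t t; IADD t t t].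

(** Jump targets are absolute, hence the parameter [off]. The result is left in cell [t]; the
    temporaries below [t] keep pending operands of enclosing expressions. Loading 0 into a temporary
    and testing it makes an unconditional jump. *)
Fixpoint compile_expr (t off : nat) e : program := match e with
  | EC k => [:: ICONST t k]
  | EP p => [:: ICONST t 0; IADD t t (1 + p)]
  | EV x => [:: ICONST t 0; IADD t t (8 + x)]
  | EA k e => compile_expr t off e ++
      (times16 t ++ [:: ICONST t.+1 k; IADD t t t.+1; IADD t t 0; ILOAD t t])
  | ELo e => let c := compile_expr t off e in c ++
      ([:: ICONST t.+1 RB; IADD t t t.+1; ISUB t.+1 0 t] ++
      ([:: IJZ t.+1 (off + size c + 5)] ++ [:: ILOAD t t]))
  | EAdd a b => let ca := compile_expr t off a in
      ca ++ (compile_expr t.+1 (off + size ca) b ++ [:: IADD t t t.+1])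
  | ESub a b => let ca := compile_expr t off a in
      ca ++ (compile_expr t.+1 (off + size ca) b ++ [:: ISUB t t t.+1])
  | EIf c a b =>
      let ct := compile_expr t off c in
      let o1 := off + size ct + 1 in
      let ca := compile_expr t o1 a in
      let o2 := o1 + size ca + 2 in
      let cb := compile_expr t o2 b in
      ct ++ ([:: IJZ t o2] ++ (ca ++ ([:: ICONST t.+1 0] ++ ([:: IJZ t.+1 (o2 + size cb)] ++ cb))))
  end.

Definition bload b := match b with BC k => EC k | BP p => EP p end.

Fixpoint compile (off : nat) c : program := match c with
  | CSkip => [::]
  | CSet x e => compile_expr TB off e ++ [:: ICONST (8 + x) 0; IADD (8 + x) (8 + x) TB]
  | CPut k a b => let ca := compile_expr TB off a in
      ca ++ (compile_expr TB.+1 (off + size ca) b ++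
      (times16 TB ++ [:: ICONST TB.+2 k; IADD TB TB TB.+2; IADD TB TB 0; ISTORE TB TB.+1]))
  | CLo a b => let ca := compile_expr TB off a in
      let cb := compile_expr TB.+1 (off + size ca) b in
      ca ++ (cb ++
      ([:: ICONST TB.+2 RB; IADD TB TB TB.+2; ISUB TB.+2 0 TB] ++
      ([:: IJZ TB.+2 (off + size ca + size cb + 5)] ++ [:: ISTORE TB TB.+1])))
  | CSeq a b => let ca := compile off a in ca ++ compile (off + size ca) b
  | CIf e a b =>
      let c := compile_expr TB off e in
      let o1 := off + size c + 1 in
      let ca := compile o1 a in
      let o2 := o1 + size ca + 2 in
      let cb := compile o2 b in
      c ++ ([:: IJZ TB o2] ++ (ca ++ ([:: ICONST TB.+1 0] ++ ([:: IJZ TB.+1 (o2 + size cb)] ++ cb))))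
  | CFor x b c =>
      let o1 := off + 1 in
      let cb := compile_expr TB o1 (bload b) in
      let o2 := o1 + size cb + 2 in
      let ca := compile o2 c in
      [:: ICONST (8 + x) 0] ++ (cb ++ ([:: ISUB TB TB (8 + x)] ++
      ([:: IJZ TB (o2 + size ca + 4)] ++ (ca ++
      ([:: ICONST TB 1; IADD (8 + x) (8 + x) TB; ICONST TB 0] ++ [:: IJZ TB o1])))))
  end.

Fixpoint wf_expr e := match e with
  | EC _ => true | EP p => p < 4 | EV x => x < NV
  | EA k e => (k < 16) && wf_expr e
  | ELo e => wf_expr e
  | EAdd a b => wf_expr a && wf_expr b
  | ESub a b => wf_expr a && wf_expr b
  | EIf c a b => [&& wf_expr c, wf_expr a & wf_expr b]
  end.

Fixpoint depth e := match e with
  | EC _ | EP _ | EV _ => 1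
  | EA _ e => (depth e).+1
  | ELo e => (depth e).+1
  | EAdd a b => maxn (depth a) (depth b).+1
  | ESub a b => maxn (depth a) (depth b).+1
  | EIf c a b => maxn (depth c) (maxn (depth a) (depth b)).+1
  end.

(** Evaluation starts in [TB] or [TB.+1], so depth 20 keeps all temporaries below [RB]. *)
Definition ok_expr e := wf_expr e && (depth e <= 20).

Fixpoint assigns x c := match c with
  | CSet y _ => x == y
  | CSeq a b => assigns x a || assigns x b
  | CIf _ a b => assigns x a || assigns x b
  | CFor y _ c => (x == y) || assigns x c
  | _ => false
  end.

Fixpoint writes k c := match c with
  | CPut k' _ _ => k == k'
  | CSeq a b => writes k a || writes k b
  | CIf _ a b => writes k a || writes k b
  | CFor _ _ c => writes k c
  | _ => false
  end.

(** A loop body may not assign its counter: the semantics fixes the number of rounds in advance,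
    while the machine tests the counter cell. *)
Fixpoint wf_cmd c := match c with
  | CSkip => true
  | CSet x e => (x < NV) && ok_expr e
  | CPut k a b => [&& k < 16, ok_expr a & ok_expr b]
  | CLo a b => ok_expr a && ok_expr b
  | CSeq a b => wf_cmd a && wf_cmd b
  | CIf e a b => [&& ok_expr e, wf_cmd a & wf_cmd b]
  | CFor x b c => [&& x < NV, (if b is BP p then p < 4 else true), ~~ assigns x c & wf_cmd c]
  end.

(** * Frame rules and the loop rule *)

Section Frame.
Variables (S : nat) (par : nat -> nat).
Local Notation ev := (ev S par).

Lemma frame_v x c st : ~~ assigns x c -> vr (ev c st) x = vr st x.
Proof.
elim: c st => //=.
- by move=> y e st /negbTE; rewrite /upd => ->.
- by move=> a b st; rewrite /setlo; case: ifP.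
- by move=> a IHa b IHb st; rewrite negb_or => /andP[Ha Hb]; rewrite IHb // IHa.
- by move=> e a IHa b IHb st; rewrite negb_or => /andP[Ha Hb]; case: ifP => _; auto.
- move=> y b c IH st; rewrite negb_or => /andP[/negbTE Hy Hc]; rewrite /upd Hy.
  by elim: (bval _ b) => //= k IHk; rewrite IH //= /upd Hy.
Qed.

Lemma frame_a k c st : ~~ writes k c -> ar (ev c st) k = ar st k.
Proof.
elim: c st => //=.
- by move=> k' a b st /negbTE ->.
- by move=> a b st; rewrite /setlo; case: ifP.
- by move=> a IHa b IHb st; rewrite negb_or => /andP[Ha Hb]; rewrite IHb // IHa.
- by move=> e a IHa b IHb st; rewrite negb_or => /andP[Ha Hb]; case: ifP => _; auto.
- move=> y b c IH st Hc.
  by elim: (bval _ b) => //= n IHk; rewrite IH //.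
Qed.

Lemma for_ind (Q : nat -> store -> Prop) x b c st :
  Q 0 st -> 
  (forall i s, i < bval par b -> Q i s -> Q i.+1 (ev c (setv x i s))) ->
  exists2 s, Q (bval par b) s & ev (CFor x b c) st = setv x (bval par b) s.
Proof.
move=> H0 HS; exists (iteri (bval par b) (fun i s => ev c (setv x i s)) st) => //.
have: forall k, k <= bval par b -> Q k (iteri k (fun i s => ev c (setv x i s)) st).
  by elim=> [|k IH] // Hk; apply: HS => //; apply: IH; apply: ltnW.
by apply.
Qed.

End Frame.

(** * Correctness of the compiler *)

Ltac upd_lia := unfold TB, RB, NV in *; rewrite /= /upd; repeat (case: eqP => ?; try lia).

Lemma exec_block_cat c1 c2 m : exec_block (c1 ++ c2) m = exec_block c2 (exec_block c1 m).
Proof. by rewrite /exec_block foldl_cat. Qed.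

Lemma exec_times16 t m a :
  exec_block (times16 t) m a = if a == t then 16 * m t else m a.
Proof. by rewrite /exec_block /= /upd !eqxx; case: eqP => // _; lia. Qed.

Lemma exec_times16E t m : exists2 m', exec_block (times16 t) m = m' &
  forall a, m' a = if a == t then 16 * m t else m a.
Proof. by exists (exec_block (times16 t) m) => // a; apply: exec_times16. Qed.

Lemma reaches_conv P k k' s pc pc' m : reaches P k s (pc, m) ->
  k <= k' -> pc = pc' -> reaches P k' s (pc', m).
Proof. by move=> H Hk <-; apply: reaches_le H. Qed.

Lemma code_at_split k P off c : code_at P off c -> k <= size c ->
  code_at P off (take k c) /\ code_at P (off + k) (drop k c).
Proof.
rewrite -{1}(cat_take_drop k c) => /code_at_cat[H1 H2] Hk; split=> //.
by move: H2; rewrite size_takel.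
Qed.

Lemma code_at_nth P off i c : code_at P off (i :: c) -> nth IHALT P off = i.
Proof. by move=> /(_ 0 isT); rewrite addn0. Qed.

(* Temporaries of level [t] live in the cells [t <= a < RB]. *)
Definition agree t (m m' : nat -> nat) := forall a, (a < t) || (RB <= a) -> m' a = m a.

Lemma agree_trans t t' m m' m'' : t <= t' -> agree t m m' -> agree t' m' m'' -> agree t m m''.
Proof. by move=> Ht H1 H2 a Ha; rewrite H2 ?H1 //; lia. Qed.

Section Comp.
Variables (S : nat) (par : nat -> nat) (P : program).
Hypothesis HS : RB <= S.
Local Notation ev := (ev S par).
Local Notation eval := (eval S par).
Local Notation Rel := (Rel S par).

Lemma Rel_agree t st m m' : TB <= t -> agree t m m' -> Rel st m -> Rel st m'.
Proof.
rewrite /TB /agree /RB => Ht H [R0 R1 R2 R3 R4]; split.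
- by rewrite H //; lia.
- by move=> p Hp; rewrite H ?R1 //; lia.
- by rewrite /NV => x Hx; rewrite H ?R2 //; rewrite /NV; lia.
- by move=> k j Hk; rewrite H ?R3 //; move: HS; rewrite /RB; lia.
- by move=> a Ha; rewrite H ?R4 //; rewrite /RB in Ha *; lia.
Qed.

Lemma compile_expr_correct e t off st m :
  code_at P off (compile_expr t off e) -> Rel st m -> TB <= t -> t + depth e < RB -> wf_expr e ->
  exists m', [/\ reaches P (expr_cost e) (off, m) (off + size (compile_expr t off e), m'),
                 m' t = eval st e & agree t m m'].
Proof.
rewrite /RB; elim: e t off m => /=.
- move=> k t off m H R Ht Hd _; exists (exec_block [:: ICONST t k] m); split.
  + exact: (reaches_block m H isT).
  + by upd_lia.
  + by move=> a; rewrite /RB => Ha; upd_lia.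
- move=> p t off m H R Ht Hd Hp; exists (exec_block [:: ICONST t 0; IADD t t (1 + p)] m); split.
  + exact: (reaches_block m H isT).
  + case: R => _ R1 _ _ _; rewrite -R1 // /TB in Ht *; upd_lia.
  + by move=> a; rewrite /RB => Ha; upd_lia.
- move=> p t off m H R Ht Hd Hp; exists (exec_block [:: ICONST t 0; IADD t t (8 + p)] m); split.
  + exact: (reaches_block m H isT).
  + case: R => _ _ R1 _ _; rewrite -R1 //; rewrite /TB /NV in Ht Hp *; upd_lia.
  + by move=> a; rewrite /RB => Ha; upd_lia.
- move=> k e IH t off m H R Ht Hd /andP[Hk He].
  have {H} [H1 H2] := code_at_cat H.
  have [||m1 [S1 V1 A1]] := IH _ _ _ H1 R Ht; try lia.
  have {}R := Rel_agree Ht A1 R.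
  exists (exec_block (times16 t ++ [:: ICONST t.+1 k; IADD t t t.+1; IADD t t 0; ILOAD t t]) m1); split.
  + rewrite size_cat addnA; apply: (reaches_trans S1).
    by apply: reaches_le (reaches_block _ H2 _).
  + rewrite exec_block_cat; have [m2 -> E2] := exec_times16E t m1.
    case: R => R0 _ _ R3 _; rewrite -V1 -R3 //.
    have e1 : (t == t.+1) = false by lia.
    have e2 : (0 == t) = false by move: Ht; rewrite /TB; lia.
    rewrite /= /upd !eqxx e1 e2 /= !E2 eqxx e2 R0.
    have -> : 16 * m1 t + k + S = S + 16 * m1 t + k by lia.
    by rewrite !ifN //; move: HS; rewrite /RB; lia.
  + move=> a; rewrite /RB => Ha; rewrite exec_block_cat; have [m2 -> E2] := exec_times16E t m1.
    rewrite /= /upd !ifN ?E2; try lia.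
    by rewrite ifN ?A1 //; lia.
- move=> e IH t off m H R Ht Hd He.
  have {H} [H1 H2] := code_at_cat H.
  have [||m1 [S1 V1 A1]] := IH _ _ _ H1 R Ht; try lia.
  have {}R := Rel_agree Ht A1 R.
  have {H2} [H2 H3] := code_at_split (k := 3) H2 isT.
  have {H3} [H3 H4] := code_at_split (k := 1) H3 isT.
  (* The truncated difference from [S] is zero exactly when the address is not below [S]; the load
     is then jumped over. *)
  pose m2 := exec_block [:: ICONST t.+1 RB; IADD t t t.+1; ISUB t.+1 0 t] m1.
  have V2 : m2 t = RB + eval st e by rewrite /m2 -V1 /RB /=; upd_lia.
  have V3 : m2 t.+1 = S - (RB + eval st e).
    by case: R => R0 _ _ _ _; rewrite /m2 -V1 -R0 /=; rewrite /RB /TB in Ht *; upd_lia.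
  have A2 : agree t m1 m2 by rewrite /m2 => a; rewrite /RB => Ha; upd_lia.
  have T2 := reaches_block m1 H2 isT.
  have T3 := reaches_jz m2 (code_at_nth H3).
  have T := reaches_trans S1 (reaches_trans T2 T3).
  rewrite V3 in T; rewrite !size_cat /= -/RB.
  case: ifPn T => [/eqP E|E] T.
    exists m2; split.
    + by apply: (reaches_conv T) => /=; lia.
    + by rewrite V2 ifN //; lia.
    + exact: agree_trans A1 A2.
  have T4 := reaches_block m2 H4 isT.
  exists (exec_block [:: ILOAD t t] m2); split.
  + rewrite addn1 in T4; apply: (reaches_conv (reaches_trans T T4)) => /=; lia.
  + have [_ _ _ _ R4] := Rel_agree Ht A2 R.
    have E' : RB + eval st e < S by lia.
    rewrite E' /= /upd eqxx V2 R4 //; rewrite /RB in E' *; lia.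
  + move=> a Ha; rewrite /= /upd ifN ?A2 ?A1 //; move: Ha; rewrite /RB; lia.
- move=> a IHa b IHb t off m H R Ht Hd /andP[Wa Wb].
  have {H} [H1 H2] := code_at_cat H.
  have [||m1 [S1 V1 A1]] := IHa _ _ _ H1 R Ht; try lia.
  have {H2} [H2 H3] := code_at_cat H2.
  have [|||m2 [S2 V2 A2]] := IHb _ _ _ H2 (Rel_agree Ht A1 R); try lia.
  exists (exec_block [:: IADD t t t.+1] m2); split.
  + have T3 := reaches_block m2 H3 isT.
    by rewrite !size_cat !addnA; apply: reaches_trans (reaches_trans S1 S2) T3.
  + by rewrite /= /upd eqxx V2 A2 ?V1 //; lia.
  + by move=> x; rewrite /RB => Hx; rewrite /= /upd ifN ?A2 ?A1 // /RB; lia.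
- move=> a IHa b IHb t off m H R Ht Hd /andP[Wa Wb].
  have {H} [H1 H2] := code_at_cat H.
  have [||m1 [S1 V1 A1]] := IHa _ _ _ H1 R Ht; try lia.
  have {H2} [H2 H3] := code_at_cat H2.
  have [|||m2 [S2 V2 A2]] := IHb _ _ _ H2 (Rel_agree Ht A1 R); try lia.
  exists (exec_block [:: ISUB t t t.+1] m2); split.
  + have T3 := reaches_block m2 H3 isT.
    by rewrite !size_cat !addnA; apply: reaches_trans (reaches_trans S1 S2) T3.
  + by rewrite /= /upd eqxx V2 A2 ?V1 //; lia.
  + by move=> x; rewrite /RB => Hx; rewrite /= /upd ifN ?A2 ?A1 // /RB; lia.
- move=> c IHc a IHa b IHb t off m H R Ht Hd /and3P[Wc Wa Wb].
  have {H} [H1 H] := code_at_cat H.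
  have {H} [H2 H] := code_at_split (k := 1) H isT.
  rewrite /= in H2; rewrite /= drop0 in H.
  have {H} [H3 H] := code_at_cat H.
  have {H} [H4 H] := code_at_split (k := 1) H isT.
  have {H} [H5 H6] := code_at_split (k := 1) H isT.
  rewrite /= ?drop0 ?take0 in H4 H5 H6.
  have [||m1 [S1 V1 A1]] := IHc _ _ _ H1 R Ht; try lia.
  have {}R := Rel_agree Ht A1 R.
  have T1 := reaches_trans S1 (reaches_jz m1 (code_at_nth H2)).
  rewrite V1 in T1.
  move: H3 H4 H5 H6 T1; rewrite !size_cat /= !addnA; set o1 := off + _ + 1.
  set o2 := o1 + _ + 2; set cb := compile_expr t o2 b => H3 H4 H5 H6 T1.
  case: ifPn T1 => [/eqP E|E] T1.
    have [|||m2 [S2 V2 A2]] := IHb _ o2 _ _ R Ht; try lia.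
      by move: H6; rewrite -addnA.
    exists m2; split => //; last exact: agree_trans A1 A2.
    rewrite -/cb in S2.
    by apply: (reaches_conv (reaches_trans T1 S2)); rewrite ?size_cat /=; lia.
  have [||m2 [S2 V2 A2]] := IHa _ _ _ H3 R Ht; try lia.
  have T3 := reaches_block m2 H4 isT.
  set m3 := exec_block _ m2 in T3.
  have E3 : m3 t.+1 = 0 by rewrite /m3; upd_lia.
  have T4 := reaches_jz m3 (code_at_nth H5).
  rewrite E3 eqxx in T4.
  exists m3; split.
  + have Eo1 : (off + size (compile_expr t off c)).+1 = o1 by rewrite /o1 addn1.
    rewrite Eo1 in T1.
    apply: (reaches_conv (reaches_trans T1 (reaches_trans S2 (reaches_trans T3 T4)))); rewrite ?size_cat /=; lia.
  + by rewrite -V2 /m3; upd_lia.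
  + by move=> x; rewrite /RB => Hx; rewrite /m3 /= /upd ifN ?A2 ?A1 // /RB; lia.
Qed.

Lemma compile_correct c off st m :
  code_at P off (compile off c) -> Rel st m -> wf_cmd c ->
  exists2 m', reaches P (cmd_cost par c) (off, m) (off + size (compile off c), m') & Rel (ev c st) m'.
Proof.
elim: c off st m => /=.
- move=> off st m _ R _; exists m => //; rewrite addn0; exact: reaches_refl.
- move=> x e off st m H R /andP[Hx /andP[We De]].
  have {H} [H1 H2] := code_at_cat H.
  have [||m1 [S1 V1 A1]] := compile_expr_correct H1 R (leqnn _); first [exact: leqnSn | done | by rewrite /TB /RB; lia | idtac].
  have R1 := Rel_agree (leqnn _) A1 R.
  exists (exec_block [:: ICONST (8 + x) 0; IADD (8 + x) (8 + x) TB] m1).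
    rewrite size_cat addnA; apply: reaches_trans S1 (reaches_block _ H2 _) => //.
  case: R1 => R0 R1 R2 R3 R4; rewrite /TB /RB /NV in R2 R4 *; split => /=.
  + by rewrite -R0; upd_lia.
  + by move=> p Hp; rewrite -R1 //; upd_lia.
  + rewrite /NV => y Hy; have := R2 _ Hy; rewrite -V1 /TB; upd_lia.
  + by move=> k j Hk; rewrite -R3 //; move: HS; rewrite /RB; upd_lia.
  + by rewrite /RB => a Ha; rewrite -R4 //; upd_lia.
- move=> k a b off st m H R /and3P[Hk /andP[Wa Da] /andP[Wb Db]].
  have {H} [H1 H] := code_at_cat H.
  have {H} [H2 H3] := code_at_cat H.
  have [||m1 [S1 V1 A1]] := compile_expr_correct H1 R (leqnn _); first [exact: leqnSn | done | by rewrite /TB /RB; lia | idtac].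
  have R1 := Rel_agree (leqnn _) A1 R.
  have [|||m2 [S2 V2 A2]] := compile_expr_correct H2 R1; first [exact: leqnSn | done | by rewrite /TB /RB; lia | idtac].
  have {}R1 := Rel_agree (leqnSn _) A2 R1.
  have T3 := reaches_block m2 H3 isT.
  set m3 := exec_block _ _ in T3.
  exists m3.
    apply: (reaches_conv (reaches_trans (reaches_trans S1 S2) T3)); rewrite ?size_cat /=; lia.
  have E40 : m2 40 = eval st a by rewrite A2 ?V1.
  have Em3 x : (x < 40) || (42 < x) -> m3 x = if x == S + 16 * eval st a + k then eval st b else m2 x.
    move=> Hx; have -> : m3 = exec_block (times16 TB ++ [:: ICONST TB.+2 k; IADD TB TB TB.+2; IADD TB TB 0; ISTORE TB TB.+1]) m2 by [].
    rewrite exec_block_cat; have [m4 -> E4] := exec_times16E TB m2.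
    case: (R1) => R0 _ _ _ _.
    rewrite /= /upd /= !E4 /= R0 E40 -V2 /TB addnC addnA; case: eqP => // _.
    by rewrite !ifN //; lia.
  case: R1 => R0 R1 R2 R3 R4; move: HS; rewrite /RB /NV in R2 R4 Em3 * => HS'; split => /=.
  + by rewrite Em3 // ifN //; lia.
  + by move=> p Hp; rewrite Em3 ?ifN ?R1 //; lia.
  + by rewrite /NV => y Hy; rewrite Em3 ?ifN ?R2 //; lia.
  + move=> k' j Hk'; rewrite Em3; last lia.
    case: (k' =P k) => [->|Hkk]; last by rewrite ifN ?R3 //; lia.
    rewrite /upd; case: eqP => [|/eqP] Hj; first by rewrite ifT //; lia.
    by rewrite ifN ?R3 //; lia.
  + by rewrite /RB => x Hx; rewrite Em3 ?ifN ?R4 //; lia.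
- move=> a b off st m H R /andP[/andP[Wa Da] /andP[Wb Db]].
  have {H} [H1 H] := code_at_cat H.
  have {H} [H2 H] := code_at_cat H.
  have {H} [H3 H] := code_at_split (k := 3) H isT.
  have {H} [H4 H5] := code_at_split (k := 1) H isT.
  have [||m1 [S1 V1 A1]] := compile_expr_correct H1 R (leqnn _); first [exact: leqnSn | done | by rewrite /TB /RB; lia | idtac].
  have R1 := Rel_agree (leqnn _) A1 R.
  have [|||m2 [S2 V2 A2]] := compile_expr_correct H2 R1; first [exact: leqnSn | done | by rewrite /TB /RB; lia | idtac].
  have {}R1 := Rel_agree (leqnSn _) A2 R1.
  have T3 := reaches_block m2 H3 isT.
  set m3 := exec_block _ _ in T3.
  have E40 : m2 40 = eval st a by rewrite A2 ?V1.
  have F40 : m3 40 = RB + eval st a by rewrite /m3 /= /upd /= -E40 addnC.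
  have F41 : m3 41 = eval st b by rewrite /m3 /= /upd /= -V2.
  have F42 : m3 42 = S - (RB + eval st a).
    by case: R1 => R0 _ _ _ _; rewrite /m3 /= /upd /= E40 R0 (addnC (eval _ _)).
  have A3 : agree 40 m2 m3.
    by move=> x; rewrite /RB => Hx; rewrite /m3; upd_lia.
  have {}R1 := Rel_agree (leqnn _) A3 R1.
  have T4 := reaches_jz m3 (code_at_nth H4).
  have T := reaches_trans (reaches_trans S1 S2) (reaches_trans T3 T4).
  rewrite F42 in T.
  rewrite /setlo.
  case: ifPn T => [/eqP E|E] T.
    exists m3; last by rewrite ifN //; lia.
    by apply: (reaches_conv T); rewrite ?size_cat /=; lia.
  have T5 := reaches_block m3 H5 isT.
  exists (exec_block [:: ISTORE 40 41] m3).
    rewrite !addn1 in T5.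
    apply: (reaches_conv (reaches_trans T T5)); rewrite ?size_cat /=; lia.
  have E' : RB + eval st a < S by lia.
  rewrite E'; case: R1 => R0 R1 R2 R3 R4; move: HS; rewrite /RB /NV in F40 R2 R4 E' * => HS'; split => /=; rewrite /upd F40 F41.
  + by [].
  + by move=> p Hp; rewrite ifN ?R1 //; lia.
  + by rewrite /NV => y Hy; rewrite ifN ?R2 //; lia.
  + by move=> k' j Hk'; rewrite ifN ?R3 //; lia.
  + by rewrite /RB => x Hx; rewrite R4.
- move=> a IHa b IHb off st m H R /andP[Wa Wb].
  have {H} [H1 H2] := code_at_cat H.
  have [m1 S1 R1] := IHa _ _ _ H1 R Wa.
  have [m2 S2 R2] := IHb _ _ _ H2 R1 Wb.
  exists m2 => //; rewrite size_cat addnA; exact: reaches_trans S1 S2.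
- move=> e a IHa b IHb off st m H R /and3P[/andP[We De] Wa Wb].
  have {H} [H1 H] := code_at_cat H.
  have {H} [H2 H] := code_at_split (k := 1) H isT.
  rewrite /= in H2; rewrite /= drop0 in H.
  have {H} [H3 H] := code_at_cat H.
  have {H} [H4 H] := code_at_split (k := 1) H isT.
  have {H} [H5 H6] := code_at_split (k := 1) H isT.
  rewrite /= ?drop0 ?take0 in H4 H5 H6.
  have [||m1 [S1 V1 A1]] := compile_expr_correct H1 R (leqnn _); first [exact: leqnSn | done | by rewrite /TB /RB; lia | idtac].
  have {}R := Rel_agree (leqnn _) A1 R.
  have T1 := reaches_trans S1 (reaches_jz m1 (code_at_nth H2)).
  rewrite V1 in T1.
  move: H3 H4 H5 H6 T1; rewrite !size_cat /= !addnA; set o1 := off + _ + 1.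
  set o2 := o1 + _ + 2; set cb := compile o2 b => H3 H4 H5 H6 T1.
  have Eo1 : o1 = (off + size (compile_expr TB off e)).+1 by rewrite /o1 addn1.
  case: ifPn T1 => [/eqP E|E] T1.
    have [|m2 S2 R2] := IHb o2 _ _ _ R Wb; first by move: H6; rewrite -addnA.
    exists m2 => //; rewrite -/cb in S2.
    apply: (reaches_conv (reaches_trans T1 S2)); rewrite ?size_cat /=; lia.
  have [m2 S2 R2] := IHa _ _ _ H3 R Wa.
  have T3 := reaches_block m2 H4 isT.
  set m3 := exec_block _ m2 in T3.
  have E3 : m3 41 = 0 by rewrite /m3; upd_lia.
  have T4 := reaches_jz m3 (code_at_nth H5).
  rewrite E3 eqxx in T4.
  exists m3.
    rewrite -Eo1 in T1.
    apply: (reaches_conv (reaches_trans T1 (reaches_trans S2 (reaches_trans T3 T4)))); rewrite ?size_cat /=; lia.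
  apply: (Rel_agree (leqnn TB) _ R2); rewrite /TB => x; rewrite /RB => Hx; rewrite /m3; upd_lia.
- move=> x b c IH off st m H R /and4P[Hx Hb Hm Wc].
  have {H} [H1 H] := code_at_split (k := 1) H isT.
  rewrite /= ?take0 in H1; rewrite /= drop0 in H.
  have {H} [H2 H] := code_at_cat H.
  have {H} [H3 H] := code_at_split (k := 1) H isT.
  have {H} [H4 H] := code_at_split (k := 1) H isT.
  rewrite /= ?take0 in H3 H4; rewrite /= drop0 in H.
  have {H} [H5 H] := code_at_cat H.
  have {H} [H6 H7] := code_at_split (k := 3) H isT.
  have T0 := reaches_block m H1 isT.
  move: H2 H3 H4 H5 H6 H7 T0; rewrite ?size_cat /= ?addnA.
  set o1 := off + 1; set cb := compile_expr TB o1 _; set o2 := o1 + _ + 2; set ca := compile o2 c.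
  set m0 := upd m _ 0 => H2 H3 H4 H5 H6 H7 T0.
  have Eo2 : o1 + size cb + 1 + 1 = o2 by lia.
  rewrite Eo2 in H5 H6 H7 *.
  have Wb : wf_expr (bload b) by case: b Hb {H2 H3 H4 H5 H6 H7 IH o2 cb ca Eo2}.
  have Db : depth (bload b) = 1 by case: b {H2 H3 H4 H5 H6 H7 IH o2 cb ca Eo2 Hb Wb}.
  have Vb s : eval s (bload b) = bval par b by case: b {H2 H3 H4 H5 H6 H7 IH o2 cb ca Eo2 Hb Wb Db}.
  have Cb : expr_cost (bload b) <= 2 by case: b {H2 H3 H4 H5 H6 H7 IH o2 cb ca Eo2 Hb Wb Db Vb}.
  have Rset i s mm : Rel s mm -> Rel (setv x i s) (upd mm (8 + x) i).
    case=> R0 R1 R2 R3 R4; move: HS; rewrite /RB /NV in R2 R4 Hx * => HS'; split => /=.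
    + by rewrite -R0; upd_lia.
    + by move=> p Hp; rewrite -R1 //; upd_lia.
    + by rewrite /NV => y Hy; have := R2 _ Hy; upd_lia.
    + by move=> k j Hk; rewrite -R3 //; upd_lia.
    + by rewrite /RB => a Ha; rewrite -R4 //; upd_lia.
  pose it i := iteri i (fun i s => ev c (setv x i s)) st.
  (* The exit check at [o1] serves both the rounds and the final exit, so it is established for
     every counter value. *)
  have test i mm : Rel (setv x i (it i)) mm -> exists2 mm', 
      reaches P 4 (o1, mm) (if bval par b - i == 0 then o2 + size ca + 4 else o2, mm')
      & Rel (setv x i (it i)) mm'.
    move=> Ri; have [|||m1 [S1 V1 A1]] := compile_expr_correct H2 Ri; rewrite ?Db //.
    have {}Ri := Rel_agree (leqnn _) A1 Ri.
    have T3 := reaches_block m1 H3 isT.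
    set m2 := exec_block _ m1 in T3.
    have T4 := reaches_jz m2 (code_at_nth H4).
    have E2 : m2 TB = bval par b - i.
      case: Ri => _ _ R2 _ _; have := R2 x Hx; rewrite /m2 /= /upd /TB /= V1 Vb eqxx => E.
      have -> : m1 (8 + x) = i by rewrite E.
      by lia.
    rewrite E2 in T4; exists m2.
      have Eo2S : (o1 + size cb + 1).+1 = o2 by lia.
      rewrite Eo2S in T4.
      by apply: reaches_le (reaches_trans S1 (reaches_trans T3 T4)); rewrite /=; lia.
    apply: (Rel_agree (leqnn TB) _ Ri); rewrite /TB => y; rewrite /RB => Hy; rewrite /m2; upd_lia.
  have loop i : i <= bval par b -> exists2 mm, 
      reaches P (1 + i * (cmd_cost par c + 8)) (off, m) (o1, mm) & Rel (setv x i (it i)) mm.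
    elim: i => [|i IHi] Hi.
      exists m0; last exact: Rset.
      exact: T0.
    have [mm Tm Rm] := IHi (ltnW Hi).
    have [m1 T1 R1] := test _ _ Rm.
    rewrite ifN in T1; last lia.
    have [m2 T2 R2] := IH _ _ _ H5 R1 Wc.
    have T3 := reaches_block m2 H6 isT.
    set m3 := exec_block _ m2 in T3.
    have T4 := reaches_jz m3 (code_at_nth H7).
    have E3 : m3 TB = 0 by rewrite /m3; upd_lia.
    rewrite E3 eqxx in T4.
    exists m3.
      apply: reaches_le (reaches_trans Tm (reaches_trans T1 (reaches_trans T2 (reaches_trans T3 T4)))).
      by rewrite /=; lia.
    have Ex : m2 (8 + x) = i.
      by case: R2 => _ _ R2 _ _; rewrite R2 // frame_v //= /upd eqxx.
    have R3 : Rel (setv x i.+1 (it i.+1)) (upd m2 (8 + x) i.+1) by apply: Rset.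
    apply: (Rel_agree (leqnn TB) _ R3); rewrite /TB => y; rewrite /RB => Hy; rewrite /m3.
    move: Hx; rewrite /NV /TB => Hx; upd_lia.
  have [mm Tm Rm] := loop _ (leqnn _).
  have [m1 T1 R1] := test _ _ Rm.
  rewrite subnn eqxx in T1.
  exists m1 => //.
  apply: (reaches_conv (reaches_trans Tm T1)); rewrite ?size_cat /=; lia.
Qed.

End Comp.

(** * Running time, start-up and shut-down code *)

Fixpoint degree c := match c with
  | CSeq a b => maxn (degree a) (degree b)
  | CIf _ a b => maxn (degree a) (degree b)
  | CFor _ (BC _) c => degree c
  | CFor _ (BP _) c => (degree c).+1
  | _ => 0
  end.

(** A parameter bound contributes its factor through [degree]; 13 collects the overhead of 8 per
    round and 5 per loop, both absorbed by one factor [N >= 1]. *)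
Fixpoint coef c := match c with
  | CSkip => 0
  | CSet x e => expr_cost e + 2
  | CPut k a b => expr_cost a + expr_cost b + 8
  | CLo a b => expr_cost a + expr_cost b + 5
  | CSeq a b => coef a + coef b
  | CIf e a b => expr_cost e + coef a + coef b + 3
  | CFor _ (BC k) c => k * (coef c + 8) + 5
  | CFor _ (BP _) c => coef c + 13
  end.

Fixpoint loops_over (p : pred nat) c := match c with
  | CSeq a b => loops_over p a && loops_over p b
  | CIf _ a b => loops_over p a && loops_over p b
  | CFor _ (BC _) c => loops_over p c
  | CFor _ (BP k) c => p k && loops_over p c
  | _ => true
  end.

Lemma cmd_cost_le (p : pred nat) par N c : 0 < N -> (forall k, p k -> par k <= N) ->
  loops_over p c -> cmd_cost par c <= coef c * N ^ degree c.
Proof.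
move=> HN Hp; have X d : 0 < N ^ d by rewrite expn_gt0 HN.
have XM d e : d <= e -> N ^ d <= N ^ e by move=> H; rewrite leq_pexp2l.
elim: c => //=.
- by move=> *; rewrite muln1.
- by move=> *; rewrite muln1.
- by move=> *; rewrite muln1.
- move=> a IHa b IHb /andP[/IHa Ha /IHb Hb]; rewrite mulnDl; apply: leq_add.
    by apply: (leq_trans Ha); rewrite leq_mul2l XM ?orbT // leq_maxl.
  by apply: (leq_trans Hb); rewrite leq_mul2l XM ?orbT // leq_maxr.
- move=> e a IHa b IHb /andP[/IHa Ha /IHb Hb].
  have {}Ha : cmd_cost par a <= coef a * N ^ maxn (degree a) (degree b).
    by apply: (leq_trans Ha); rewrite leq_mul2l XM ?orbT // leq_maxl.
  have {}Hb : cmd_cost par b <= coef b * N ^ maxn (degree a) (degree b).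
    by apply: (leq_trans Hb); rewrite leq_mul2l XM ?orbT // leq_maxr.
  by have := X (maxn (degree a) (degree b)); nia.
- move=> x [k|k] c IH /=.
    by move=> /IH Hc; have := X (degree c); nia.
  move=> /andP[Hk /IH Hc]; rewrite expnS; have := X (degree c); have := Hp _ Hk.
  set A := N ^ degree c in Hc *; set B := coef c in Hc *; move: (cmd_cost par c) (par k) Hc => u v Hu Hv HA.
  apply: (@leq_trans (N * (B * A + 8) + 5)); first by rewrite leq_add2r leq_mul // leq_add2r.
  by nia.
Qed.

(** Cell 0, which holds [ml], is counted down while three doublings multiply cell 2 by 8. Cell 3
    alternates between the decrement 1 and the 0 of an unconditional jump, and ends as [bit]; no
    other cell is touched. *)
Definition sloop off bit : program :=
  [:: ICONST 2 1024; IJZ 0 (off + 9); IADD 2 2 2; IADD 2 2 2; IADD 2 2 2;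
      ICONST 3 1; ISUB 0 0 3; ICONST 3 0; IJZ 3 (off + 1); ICONST 3 bit].

(** Offset [16 * i + 1] from the base is entry [i] of array 1, the later [IN]. Cell 0 has been
    counted down by now and serves as pointer. *)
Definition saves : program :=
  flatten [seq [:: ICONST 0 (16 * i + 1); IADD 0 0 2; ISTORE 0 i] | i <- iota 4 60].

Definition regs : program :=
  [:: ICONST 0 0; IADD 0 0 2; ICONST 4 0; IADD 4 4 3; ICONST 2 0; IADD 2 2 1;
      ICONST 1 0; ICONST 3 0; ICONST 5 1024; ICONST 6 1].

(** [sloop] has used up [ml]; it is recovered as the number of multiplications by 8 that lead from
    1024 to the base address, and the same rounds accumulate [ml * ms] in cell 3. *)
Definition nloop off : program :=
  [:: ISUB 7 0 5; IJZ 7 (off + 9); IADD 5 5 5; IADD 5 5 5; IADD 5 5 5;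
      IADD 1 1 6; IADD 3 3 2; ICONST 7 0; IJZ 7 off].

(* Every cell with a constant address may hold input. The cells [2] and [3] are
   erased to compute a free address [1024 * 8 ^ ml]; which of the two was
   smaller is remembered by running one of two copies of the loop. *)
Definition boot : program :=
  [:: ISUB 2 2 3; IJZ 2 14] ++ (sloop 2 2 ++ ([:: ICONST 0 0; IJZ 0 24] ++
  (sloop 14 1 ++ (saves ++ (regs ++ nloop (24 + size saves + 10)))))).

(* The low cells of the output are fetched last, each through itself as pointer. *)
Definition fin : program :=
  flatten [seq [:: ICONST i (16 * i); IADD i i 0; ILOAD i i] | i <- iota 1 63] ++ [:: ILOAD 0 0].

Section Boot.
Variable P : program.

Lemma sloop_correct off bit m : code_at P off (sloop off bit) ->
  exists2 m', reaches P (m 0 * 8 + 3) (off, m) (off + 10, m') &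
   forall a, m' a = if a == 0 then 0 else if a == 2 then 1024 * 8 ^ m 0
                    else if a == 3 then bit else m a.
Proof.
rewrite /sloop; move: (1024) => B0.
move=> H; have {H} [H0 H] := code_at_split (k := 1) H isT.
have {H} [H1 H] := code_at_split (k := 1) H isT.
have {H} [H2 H] := code_at_split (k := 6) H isT.
have {H} [H3 H4] := code_at_split (k := 1) H isT.
have loop i : i <= m 0 -> exists2 m', reaches P (i * 8 + 1) (off, m) (off + 1, m') &
   forall a, a != 3 -> m' a = if a == 0 then m 0 - i else if a == 2 then B0 * 8 ^ i else m a.
  elim: i => [|i IH] Hi.
    exists (upd m 2 B0); first exact: (reaches_block m H0 isT).
    by move=> a Ha; rewrite /upd subn0 muln1; case: (a =P 0) => [->|].
  have [m1 T1 E1] := IH (ltnW Hi).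
  have T2 := reaches_jz m1 (code_at_nth H1).
  rewrite E1 //= ifN in T2; last lia.
  have T3 := reaches_block m1 H2 isT.
  set m2 := exec_block _ _ in T3.
  have T4 := reaches_jz m2 (code_at_nth H3).
  have E2 : m2 3 = 0 by [].
  rewrite E2 eqxx in T4; rewrite -(addn1 (off + 1)) in T2.
  exists m2.
    apply: reaches_le (reaches_trans T1 (reaches_trans T2 (reaches_trans T3 T4))); rewrite /=; lia.
  move=> a Ha; rewrite /m2 /= /upd /= (negbTE Ha).
  case: (a =P 0) => [|A0]; first by rewrite E1 //=; lia.
  case: (a =P 2) => [_|A2]; last by rewrite E1 //; case: eqP => //; case: eqP.
  by rewrite E1 //= expnS; lia.
have [m1 T1 E1] := loop _ (leqnn _).
have T2 := reaches_jz m1 (code_at_nth H1).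
rewrite E1 //= subnn eqxx in T2.
have E9 : off + 1 + 1 + 6 + 1 = off + 9 by lia.
rewrite E9 in H4.
have T3 := reaches_block m1 H4 isT.
exists (upd m1 3 bit).
  by apply: (reaches_conv (reaches_trans T1 (reaches_trans T2 T3))); rewrite /=; lia.
move=> a; rewrite /upd; case: (a =P 3) => [->//|/eqP A3].
by rewrite E1 //= subnn.
Qed.

(** All targets lie beyond [m 2 >= 64], so no cell still to be saved is overwritten; the only other
    change is the pointer in cell 0. *)
Lemma saves_correct i k off m : 
  code_at P off (flatten [seq [:: ICONST 0 (16 * i + 1); IADD 0 0 2; ISTORE 0 i] | i <- iota i k]) ->
  0 < i -> i + k <= 64 -> 64 <= m 2 ->
  exists m', [/\ reaches P (k * 3) (off, m) (off + k * 3, m'),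
   forall a : nat, a != 0 -> (forall j, i <= j < i + k -> a != m 2 + 16 * j + 1) -> m' a = m a
   & forall j, i <= j < i + k -> m' (m 2 + 16 * j + 1) = m j].
Proof.
elim: k i off m => [|k IH] i off m.
  move=> _ _ _ _; exists m; split=> //; first by rewrite addn0; apply: reaches_refl.
  by move=> j; lia.
move=> /= H Hi Hk H2.
have {H} [H0 H] := code_at_split (k := 3) H isT.
rewrite /= ?drop0 ?take0 in H H0.
have T0 := reaches_block m H0 isT.
set m1 := exec_block _ _ in T0.
have E1 a : a != 0 -> m1 a = if a == m 2 + 16 * i + 1 then m i else m a.
  move=> Ha; rewrite /m1 /= /upd /= (negbTE Ha).
  have -> : 16 * i + 1 + m 2 = m 2 + 16 * i + 1 by lia.
  case: eqP => // _; rewrite !ifN //; lia.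
have E12 : m1 2 = m 2 by rewrite E1 //; case: eqP => //; lia.
have [|||m2 [T E F]] := IH i.+1 (off + 3) m1 H; try lia.
exists m2; split.
- by apply: (reaches_conv (reaches_trans T0 T)); rewrite /=; lia.
- move=> a A0 Ha; rewrite E //; last by move=> j Hj; rewrite E12 Ha //; lia.
  by rewrite E1 // ifN // Ha //; lia.
- move=> j Hj; case: (j =P i) => [->|Hji].
    rewrite E; first by rewrite E1 ?eqxx //; lia.
      lia.
    by move=> j' Hj'; rewrite E12; lia.
  by rewrite -E12 F ?E1 ?ifN //; lia.
Qed.

Lemma nloop_correct off m k : code_at P off (nloop off) ->
  m 0 = 1024 * 8 ^ k -> m 1 = 0 -> m 3 = 0 -> m 5 = 1024 -> m 6 = 1 ->
  exists m', [/\ reaches P (k * 9 + 2) (off, m) (off + 9, m'), m' 1 = k, m' 3 = k * m 2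
     & forall a : nat, (a \notin [:: 1; 3; 5; 7]) -> m' a = m a].
Proof.
rewrite /nloop; move: (1024) (isT : 0 < 1024) => B0 HB0 H M0 M1 M3 M5 M6.
have {H} [H0 H] := code_at_split (k := 1) H isT.
have {H} [H1 H] := code_at_split (k := 1) H isT.
have {H} [H2 H3] := code_at_split (k := 6) H isT.
have loop i : i <= k -> exists m', [/\ reaches P (i * 9) (off, m) (off, m'), m' 1 = i, m' 3 = i * m 2,
    m' 5 = B0 * 8 ^ i & forall a : nat, (a \notin [:: 1; 3; 5; 7]) -> m' a = m a].
  elim: i => [|i IH] Hi.
    by exists m; split => //; rewrite ?muln1 //; apply: reaches_refl.
  have [m1 [T1 E1 E3 E5 E]] := IH (ltnW Hi).
  have T2 := reaches_block m1 H0 isT.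
  set m2 := exec_block _ _ in T2.
  have T3 := reaches_jz m2 (code_at_nth H1).
  have E2 : m2 7 = B0 * 8 ^ k - B0 * 8 ^ i by rewrite /m2 /= /upd /= E5 E // M0.
  have L : 8 ^ i < 8 ^ k by rewrite ltn_exp2l.
  rewrite E2 ifN in T3; last by rewrite subn_eq0 -ltnNge ltn_mul2l HB0.
  have T4 := reaches_block m2 H2 isT.
  set m3 := exec_block _ _ in T4.
  have T5 := reaches_jz m3 (code_at_nth H3).
  have E7 : m3 7 = 0 by [].
  rewrite E7 eqxx in T5; rewrite -(addn1 (off + 1)) in T3.
  exists m3; split.
  + apply: reaches_le (reaches_trans T1 (reaches_trans T2 (reaches_trans T3 (reaches_trans T4 T5)))); rewrite /=; lia.
  + by rewrite /m3 /m2 /= /upd /= E1 E // M6 addn1.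
  + by rewrite /m3 /m2 /= /upd /= E3 E // mulSnr.
  + by rewrite /m3 /m2 /= /upd /= E5 expnS; lia.
  + move=> a Ha; rewrite -E // /m3 /m2 /= /upd /=; move: Ha; rewrite !inE !negb_or => /and4P[A1 A3 A5 A7].
    by rewrite (negbTE A1) (negbTE A3) (negbTE A5) (negbTE A7).
have [m1 [T1 E1 E3 E5 E]] := loop _ (leqnn _).
have T2 := reaches_block m1 H0 isT.
set m2 := exec_block _ _ in T2.
have T3 := reaches_jz m2 (code_at_nth H1).
have E2 : m2 7 = 0 by rewrite /m2 /= /upd /= E5 E // M0 subnn.
rewrite E2 eqxx in T3.
exists m2; split.
+ by apply: (reaches_conv (reaches_trans T1 (reaches_trans T2 T3))); rewrite /=; lia.
+ by rewrite /m2 /= /upd /= E1.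
+ by rewrite /m2 /= /upd /= E3.
+ move=> a Ha; rewrite -E // /m2 /= /upd; move: Ha; rewrite !inE !negb_or => /and4P[A1 A3 A5 A7].
  by rewrite (negbTE A7).
Qed.

Lemma boot_correct (ml ms : nat) (m : nat -> nat) : code_at P 0 boot -> m 0 = ml -> m 1 = ms -> m 2 != m 3 ->
  let S := 1024 * 8 ^ ml in
  exists m', [/\ reaches P (ml * 17 + 210) (0, m) (size boot, m'), m' 0 = S,
     [/\ m' 1 = ml, m' 2 = ms, m' 3 = ml * ms & m' 4 = (m 3 < m 2).+1],
     forall j, 4 <= j < 64 -> m' (S + 16 * j + 1) = m j
     & forall a, 64 <= a -> (forall j, 4 <= j < 64 -> a != S + 16 * j + 1) -> m' a = m a].
Proof.
move=> H M0 M1 M23 S; rewrite /boot in H.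
have HS : 64 <= S.
  by rewrite /S; apply: (@leq_trans (1024 * 1)); rewrite // leq_mul2l expn_gt0 orbT.
have {H} [H0 H] := code_at_cat H.
have {H} [H1 H] := code_at_cat H.
have {H} [H2 H] := code_at_cat H.
have {H} [H3 H] := code_at_cat H.
have {H} [H4 H] := code_at_cat H.
have {H} [H5 H6] := code_at_cat H.
have {H0} [H00 H01] := code_at_split (k := 1) H0 isT.
have {H2} [H20 H21] := code_at_split (k := 1) H2 isT.
have T0 := reaches_block m H00 isT.
set m1 := exec_block _ _ in T0.
have E1 a : m1 a = if a == 2 then m 2 - m 3 else m a by [].
have T1 := reaches_jz m1 (code_at_nth H01).
have T2 : exists2 m', reaches P (ml * 8 + 7) (0, m) (24, m') & 
   forall a, m' a = if a == 0 then 0 else if a == 2 then S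
                    else if a == 3 then (m 3 < m 2).+1 else m a.
  have T01 := reaches_trans T0 T1.
  case: ifPn T01 => E T01.
    have [m2 T2 E2] := sloop_correct m1 H3.
    exists m2.
      rewrite E1 M0 /= in T2.
      by apply: reaches_le (reaches_trans T01 T2); rewrite /=; lia.
    move=> a; rewrite E2 !E1 M0 /= -/S; have -> : (m 3 < m 2) = false by move: E; rewrite E1 /=; lia.
    by case: eqP => // _; case: eqP => // _.
  have [m2 T2 E2] := sloop_correct m1 H1.
  have T3 := reaches_block m2 H20 isT.
  set m3 := exec_block _ _ in T3.
  have T4 := reaches_jz m3 (code_at_nth H21).
  have E3 : m3 0 = 0 by [].
  rewrite E3 eqxx in T4.
  exists m3.
    rewrite E1 M0 /= in T2.
    by apply: reaches_le (reaches_trans T01 (reaches_trans T2 (reaches_trans T3 T4))); rewrite /=; lia.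
  have -> : (m 3 < m 2) by move: E; rewrite E1 /=; lia.
  move=> a; rewrite /m3 /= /upd E2 !E1 M0 /=; case: eqP => // _; rewrite -/S.
  by case: eqP.
case: T2 => m2 T2 E2.
have [|m3 [T3 E3 F3]] := saves_correct (m := m2) H4 isT isT; first by rewrite E2.
have T4 := reaches_block m3 H5 isT.
set m4 := exec_block _ _ in T4.
have E32 : m3 2 = S.
  rewrite E3 // ?E2 //= => j Hj; rewrite ?E2 /=; lia.
have E3s a : 0 < a < 64 -> m3 a = m2 a.
  by move=> Ha; rewrite E3 //; [lia | move=> j Hj; rewrite E2 /=; lia].
have [||||||m5 [T5 E51 E53 E5]] := @nloop_correct (24 + size saves + 10) m4 ml.
- exact: H6.
- by rewrite /m4 /= /upd /= E32.
- by [].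
- by [].
- by [].
- by [].
exists m5; split.
- have Esz : size boot = 24 + size saves + 10 + 9 by [].
  apply: (reaches_conv (reaches_trans T2 (reaches_trans T3 (reaches_trans T4 T5)))); last by rewrite Esz.
  by rewrite /=; lia.
- by rewrite E5 // /m4 /= /upd /= E32.
- split; first exact: E51.
  + by rewrite E5 // /m4 /= /upd /= E3s // E2.
  + by rewrite E53 /m4 /= /upd /= E3s // E2 /= M1.
  + by rewrite E5 // /m4 /= /upd /= E3s // E2.
- move=> j Hj; rewrite E5; last by rewrite !inE; lia.
  have -> : m4 (S + 16 * j + 1) = m3 (S + 16 * j + 1).
    by rewrite /m4 /= /upd /= !ifN //; lia.
  have := F3 j; rewrite E2 /= => -> //.
  by rewrite E2 !ifN //; lia.
- move=> a Ha Hj; rewrite E5; last by rewrite !inE; lia.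
  have -> : m4 a = m3 a by rewrite /m4 /= /upd /= !ifN //; lia.
  rewrite E3 ?E2; last by rewrite /= => j Hj'; apply: Hj.
    by rewrite !ifN //; lia.
  by lia.
Qed.

Lemma fin_loop_correct i k off m : 
  code_at P off (flatten [seq [:: ICONST i (16 * i); IADD i i 0; ILOAD i i] | i <- iota i k]) ->
  0 < i -> i + k <= 64 -> 64 <= m 0 ->
  exists m', [/\ reaches P (k * 3) (off, m) (off + k * 3, m'),
   forall a, ~~ (i <= a < i + k) -> m' a = m a
   & forall a, i <= a < i + k -> m' a = m (m 0 + 16 * a)].
Proof.
elim: k i off m => [|k IH] i off m.
  move=> _ _ _ _; exists m; split=> //; first by rewrite addn0; apply: reaches_refl.
  by move=> j; lia.
move=> /= H Hi Hk H2.
have {H} [H0 H] := code_at_split (k := 3) H isT.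
rewrite /= ?drop0 ?take0 in H H0.
have T0 := reaches_block m H0 isT.
set m1 := exec_block _ _ in T0.
have E1 a : m1 a = if a == i then m (m 0 + 16 * i) else m a.
  rewrite /m1 /= /upd /= !eqxx; case: eqP => //= _.
  have e0 : (0 == i) = false by lia.
  rewrite e0 (addnC (16 * i)) !ifN //; lia.
have E10 : m1 0 = m 0 by rewrite E1; case: eqP => //; lia.
have [|||m2 [T E F]] := IH i.+1 (off + 3) m1 H; try lia.
exists m2; split.
- by apply: (reaches_conv (reaches_trans T0 T)); rewrite /=; lia.
- by move=> a Ha; rewrite E ?E1 ?ifN //; lia.
- move=> a Ha; case: (a =P i) => [->|Hai].
    by rewrite E ?E1 ?eqxx //; lia.
  rewrite F ?E10 ?E1 ?ifN //; lia.
Qed.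

Lemma fin_correct off m : code_at P off fin -> 64 <= m 0 ->
  exists2 m', reaches P 190 (off, m) (off + size fin, m') &
    forall a, m' a = if a < 64 then m (m 0 + 16 * a) else m a.
Proof.
move=> H H0; have {H} [H1 H2] := code_at_cat H.
have [m1 [T1 E1 F1]] := fin_loop_correct (m := m) H1 isT isT H0.
have T2 := reaches_block m1 H2 isT.
exists (exec_block [:: ILOAD 0 0] m1).
  have -> : size fin = 63 * 3 + 1 by [].
  rewrite addnA; exact: reaches_trans T1 T2.
move=> a; rewrite /= /upd; case: (a =P 0) => [->|A0].
  by rewrite muln0 addn0 E1 // E1 //; lia.
case: ifPn => Ha; first by rewrite F1 //; lia.
by rewrite E1 //; lia.
Qed.

End Boot.

Definition assemble c : program := boot ++ (compile (size boot) c ++ fin).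

Definition params ml ms bit p := nth 0 [:: ml; ms; ml * ms; bit] p.

(** Memory from [S] on is zero at the start, so every array is empty except array 1, which has
    received the input cells 4 to 63; the input from cell 64 on stays readable through [lo]. *)
Lemma assemble_correct c (ml ms : nat) (m : nat -> nat) :
  wf_cmd c -> m 0 = ml -> m 1 = ms -> m 2 != m 3 ->
  let S := 1024 * 8 ^ ml in
  let par := params ml ms (m 3 < m 2).+1 in
  (forall a, S <= a -> m a = 0) ->
  exists st, exists2 m',
    [/\ forall j, 4 <= j < 64 -> ar st 1 j = m j,
        forall k j, k < 16 -> k != 1 -> ar st k j = 0
      & forall a, 64 <= a < S -> lo st a = m a] &
    [/\ reaches (assemble c) (ml * 17 + 210 + (cmd_cost par c + 190)) (0, m) (size (assemble c), m'),
        forall a, a < 64 -> m' a = ar (ev S par c st) 0 a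
      & forall a, 64 <= a < S -> m' a = lo (ev S par c st) a].
Proof.
move=> Wc M0 M1 M23 S par HZ.
have HS : 64 <= S.
  by rewrite /S; apply: (@leq_trans (1024 * 1)); rewrite // leq_mul2l expn_gt0 orbT.
have CA : code_at (assemble c) 0 (assemble c) by [].
have [C1 C] := code_at_cat CA.
have [C2 C3] := code_at_cat C.
rewrite add0n in C2 C3.
have [m1 [T1 E0 [E1 E2 E3 E4] Ein Eo]] := boot_correct C1 M0 M1 M23.
rewrite -/S in E0 Ein Eo.
pose st := Store (fun x => m1 (8 + x)) (fun k j => m1 (S + 16 * j + k)) m1.
have R : Rel S par st m1.
  split=> //.
  by move=> [|[|[|[|p]]]] //= _; rewrite ?E1 ?E2 ?E3 ?E4.
have [m2 T2 R2] := compile_correct HS C2 R Wc.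
have R0 : m2 0 = S by case: R2.
have [|m3 T3 E5] := fin_correct (m := m2) C3; first by rewrite R0.
exists st, m3.
  split.
  - by move=> j Hj; rewrite /= Ein.
  - by move=> k j Hk Hk1; rewrite /= Eo ?HZ //; [lia | lia | move=> j' Hj'; lia].
  - by move=> a Ha; rewrite /= Eo //; [lia | move=> j' Hj'; lia].
split.
- have -> : size (assemble c) = size boot + size (compile (size boot) c) + size fin.
    by rewrite /assemble !size_cat addnA.
  by apply: (reaches_conv (reaches_trans T1 (reaches_trans T2 T3))); lia.
- case: R2 => _ _ _ R3 _ a Ha; rewrite E5 Ha R0 -R3 //; first by rewrite addn0.
- case: R2 => _ _ _ _ R4 a Ha; rewrite E5 ifN ?R4 //; lia.
Qed.

(** * Sorting a line with adjacent comparators *)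

(** Threshold form of the 0-1 principle: a comparator commutes with replacing every key by the truth
    value of [th <= k i], so each threshold can be followed separately. *)
Definition cntge th (k : nat -> nat) x := \sum_(i < x) (th <= k i).

Lemma cntgeS th k x : cntge th k x.+1 = cntge th k x + (th <= k x).
Proof. by rewrite /cntge big_ord_recr. Qed.

Lemma cntge0 th k : cntge th k 0 = 0.
Proof. by rewrite /cntge big_ord0. Qed.

Lemma cntge_le th k x : cntge th k x <= x.
Proof. by elim: x => [|x IH]; rewrite ?cntge0 // cntgeS; case: (th <= _); lia. Qed.

Lemma cntge_mono th k x y : x <= y -> cntge th k x <= cntge th k y <= cntge th k x + (y - x).
Proof.
move=> /subnKC <-; elim: (y - x) => [|d /andP[IH1 IH2]]; first by rewrite addn0; lia.
by rewrite addnS cntgeS; case: (th <= _) => /=; lia.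
Qed.

Definition inj_on n (f : nat -> nat) := forall x y, x < n -> y < n -> f x = f y -> x = y.

Lemma eq_cntge th k k' x : (forall i, i < x -> k i = k' i) -> cntge th k x = cntge th k' x.
Proof. by move=> H; apply: eq_bigr => i _; rewrite H. Qed.

Lemma cntge_perm L k th : inj_on L k -> (forall i, i < L -> k i < L) ->
  cntge th k L = L - th.
Proof.
move=> Hi Hk.
transitivity (cntge th id L).
  case: L Hi Hk => [|L] Hi Hk; first by rewrite !cntge0.
  pose f (i : 'I_L.+1) : 'I_L.+1 := inord (k i).
  have fE i : f i = k i :> nat by rewrite /f inordK // Hk.
  have fI : injective f.
    by move=> i j E; apply: ord_inj; apply: Hi => //; rewrite -!fE E.
  rewrite /cntge [RHS](reindex_inj fI); apply: eq_bigr => i _.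
  by rewrite fE.
elim: L {Hi Hk} => [|L IH]; first by rewrite cntge0.
by rewrite cntgeS IH; case: leqP; lia.
Qed.

Lemma inj_on_surj n f : inj_on n f -> (forall x, x < n -> f x < n) ->
  forall y, y < n -> exists2 x, x < n & f x = y.
Proof.
case: n => // n Hi Hf y Hy.
pose g (i : 'I_n.+1) : 'I_n.+1 := inord (f i).
have gE i : g i = f i :> nat by rewrite /g inordK // Hf.
have gI : injective g by move=> i j E; apply: ord_inj; apply: Hi => //; rewrite -!gE E.
have [h _ Hh] := injF_bij gI.
by exists (h (Ordinal Hy)) => //; rewrite -gE Hh.
Qed.

(** [act i] places a comparator on the cells [i] and [i.+1]; the second condition keeps the
    comparators of one step disjoint. *)
Definition line_step L (act : nat -> bool) (k k' : nat -> nat) :=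
  [/\ forall i, act i -> i.+1 < L, forall i, act i -> ~~ act i.+1
    & forall i, i < L -> k' i = if act i then minn (k i) (k i.+1)
        else if (0 < i) && act i.-1 then maxn (k i.-1) (k i) else k i].

(** A comparator permutes the keys of its two cells, so a prefix count can change only at a cut
    through an active comparator, where the left cell now holds the smaller key. *)
Lemma cntge_line_step L act k k' th x : line_step L act k k' -> x <= L ->
  cntge th k' x = if (0 < x) && act x.-1
    then cntge th k x.-1 + (th <= minn (k x.-1) (k x)) else cntge th k x.
Proof.
case=> HL HA Hk; elim: x => [|x IH] Hx; first by rewrite !cntge0.
rewrite cntgeS IH; last exact: ltnW.
rewrite Hk //= cntgeS.
case Ax: (act x).
  case: ifP => // /andP[x0 Ax1].
  by have := HA _ Ax1; rewrite prednK // Ax.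
case: ifP => // /andP[x0 Ax1].
have -> : cntge th k x = cntge th k x.-1 + (th <= k x.-1) by rewrite -{1}(prednK x0) cntgeS.
by case: (leqP th (k x.-1)); case: (leqP th (k x)); case: leqP; case: leqP; lia.
Qed.

(* [N] counts the keys [>= th] among the first [x] cells after [t] rounds on a
   line of length [L]. A comparator replaces [N x] by
   [max (N x.-1) (N x.+1 - 1)], hence the bound improves with each round,
   whatever the order of the comparators in it. *)
Definition bound L t th x N := [|| N == 0, N + th <= x | 2 * N + t + th <= x + L].

(** [D] collects the edges compared so far in the current round: a cut inside such an edge already
    has the bound of the next round. *)
Definition sorting L t (D : nat -> Prop) k :=
  forall th, cntge th k L = L - th /\ forall x, x <= L ->
    bound L t th x (cntge th k x) /\
    (0 < x -> D x.-1 -> bound L t.+1 th x (cntge th k x)).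

Lemma sorting_start L k : inj_on L k -> (forall i, i < L -> k i < L) ->
  sorting L 0 (fun _ => False) k.
Proof.
move=> Hi Hk th; have E := cntge_perm th Hi Hk; split=> // x Hx; split=> //.
have := cntge_mono th k Hx; have := cntge_le th k x; rewrite E /bound.
by move: (cntge th k x) => N; lia.
Qed.

Lemma sorting_step L t D act k k' : line_step L act k k' -> sorting L t D k ->
  sorting L t (fun i => D i \/ act i) k'.
Proof.
move=> Hl Hs th; have [E Hs'] := Hs th; case: (Hl) => HL _ _; split.
  by rewrite (cntge_line_step th Hl) //; case: ifP => // /andP[L0 /HL]; rewrite prednK ?ltnn.
move=> x Hx; rewrite (cntge_line_step th Hl) //.
have [B1 B2] := Hs' _ Hx.
case Hact: ((0 < x) && act x.-1); last first.
  split=> // x0 [] // A; first exact: B2.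
  by rewrite x0 A in Hact.
case/andP: Hact => x0 Ax; have xL := HL _ Ax; rewrite prednK // in xL.
have [] := Hs' x.-1; first lia.
have [] := Hs' x.+1 => // B3 _ B4 _.
set N := _ + _.
have EN : cntge th k x.+1 = cntge th k x.-1 + (th <= k x.-1) + (th <= k x).
  by rewrite cntgeS -{1}(prednK x0) cntgeS.
(* Coming from the left neighbour the cut gains one; coming from the right it loses one, but the
   doubled count loses two. Either way one round is gained. *)
have {E Hs Hs' B1 B2} : bound L t.+1 th x N.
  rewrite /N; move: EN B3 B4; rewrite /bound.
  move: (cntge th k x.+1) (cntge th k x.-1) => N1 N2.
  by case: (leqP th (k x.-1)); case: (leqP th (k x)); case: leqP => /=; lia.
by rewrite /bound => HN; split=> // ; lia.
Qed.

Lemma sorting_round L t D k : (forall i, i.+1 < L -> D i) -> sorting L t D k ->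
  sorting L t.+1 (fun _ => False) k.
Proof.
move=> HD Hs th; have [E Hs'] := Hs th; split=> // x Hx; split=> //.
have [B1 B2] := Hs' _ Hx.
(* No edge runs through the two end cuts; there the counts are 0 and [L - th]. *)
case: (posnP x) => [->|x0]; first by rewrite cntge0.
case: (ltngtP x L) Hx => // Hx _; first by apply: B2 => //; apply: HD; lia.
by rewrite Hx E /bound; lia.
Qed.

(** A key larger than its place [i], taken as threshold, would violate the bound at the cut [i.+1].
    So no key exceeds its place; then the keys [>= i], which number [L - i], must fill all places
    from [i] on. *)
Lemma sorting_done L t D k : L <= t -> sorting L t D k -> forall i, i < L -> k i = i.
Proof.
move=> HLt Hs; have le_k i : i < L -> k i <= i.
  move=> Hi; rewrite leqNgt; apply/negP => Hlt.
  have [_ /(_ i.+1 Hi) []] := Hs (k i).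
  by rewrite cntgeS leqnn /bound; lia.
move=> i Hi; apply/eqP; rewrite eqn_leq le_k //=.
have [E _] := Hs i.
have Z : cntge i k i = 0.
  apply: big1 => j _; have := le_k j; have := ltn_ord j.
  by case: leqP => //; lia.
have := @cntge_mono i k i.+1 L Hi; rewrite cntgeS Z E.
by case: leqP => //; lia.
Qed.

(** * Rotations of 3 x 2 blocks *)

(* A 3 x 2 block of the class [(r, s)] is anchored at a row [= r mod 3] and a
   column [= s mod 2]; its cells are numbered [2 * row + column]. A move is the
   table of the images of the six cells. *)
Definition local_row r i := if r - i %% 3 == 0 then i %% 3 - r else i %% 3 + 3 - r.
Definition local_col s j := if s - j %% 2 == 0 then j %% 2 - s else j %% 2 + 2 - s.

(** Written in the order of time: [s] moves first. *)
Definition table_comp (s t : seq nat) := [seq nth 0 t c | c <- s].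
Definition table_inv (s : seq nat) := [seq index c s | c <- iota 0 6].
Definition transp p q := [seq (if c == p then q else if c == q then p else c) | c <- iota 0 6].

Definition cell_adj c d :=
  ((c %/ 2 == d %/ 2) && (((c %% 2).+1 == d %% 2) || ((d %% 2).+1 == c %% 2)))
  || ((c %% 2 == d %% 2) && (((c %/ 2).+1 == d %/ 2) || ((d %/ 2).+1 == c %/ 2))).

(** The last condition forbids 2-cycles, that is, robots exchanging along an edge. A transposition
    of adjacent cells is therefore never a single move and has to be composed of rotations. *)
Definition legal_table (s : seq nat) :=
  [&& size s == 6, all (fun c => c < 6) s, table_comp s (table_inv s) == iota 0 6,
      all (fun c => c < 6) (table_inv s),
      all (fun c => (nth 0 s c == c) || cell_adj c (nth 0 s c)) (iota 0 6)
    & all (fun c => (nth 0 s (nth 0 s c) == c) ==> (nth 0 s c == c)) (iota 0 6)].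

Lemma nth_transp p q c : c < 6 -> nth 0 (transp p q) c = if c == p then q else if c == q then p else c.
Proof. by move=> Hc; rewrite (nth_map 0) ?size_iota // nth_iota. Qed.

(** * Block moves as maps of the grid *)

Section Grid.
Variables ml ms : nat.
Hypotheses (Hml : 3 <= ml) (Hms : 2 <= ms).
Local Notation n := (ml * ms).

Definition cell_off c := (c %/ 2) * ms + c %% 2.

Definition in_block r s i j :=
  [&& local_row r i <= i, i - local_row r i + 2 < ml, local_col s j <= j & j - local_col s j + 1 < ms].
Definition block_anchor r s v := v - (local_row r (v %/ ms) * ms + local_col s (v %% ms)).
Definition code r s i j := 2 * local_row r i + local_col s j.

Definition block_move r s (F : nat -> bool) t v :=
  if in_block r s (v %/ ms) (v %% ms) && F (block_anchor r s v)
  then block_anchor r s v + cell_off (nth 0 t (code r s (v %/ ms) (v %% ms))) else v.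

Definition anchor r s A0 B0 := [&& A0 %% 3 == r, B0 %% 2 == s, A0 + 2 < ml & B0 + 1 < ms].

Lemma divE i j : j < ms -> (i * ms + j) %/ ms = i.
Proof. by move=> Hj; rewrite divnMDl ?divn_small ?addn0 //; lia. Qed.
Lemma modE i j : j < ms -> (i * ms + j) %% ms = j.
Proof. by move=> Hj; rewrite modnMDl modn_small. Qed.
Lemma vtx_lt i j : i < ml -> j < ms -> i * ms + j < n.
Proof. by nia. Qed.
Lemma vtx_row v : v < n -> v %/ ms < ml.
Proof. by move=> H; rewrite ltn_divLR //; lia. Qed.
Lemma vtx_col v : v %% ms < ms.
Proof. by rewrite ltn_mod; lia. Qed.

Lemma cell_off_inj : injective cell_off.
Proof.
move=> c d E; have H x : x %% 2 < ms by lia.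
have := congr1 (fun x => x %/ ms) E; have := congr1 (fun x => x %% ms) E.
by rewrite /cell_off !divE ?modE //; lia.
Qed.

Lemma cellE A0 B0 c : A0 * ms + B0 + cell_off c = (A0 + c %/ 2) * ms + (B0 + c %% 2).
Proof. by rewrite /cell_off mulnDl; lia. Qed.

Lemma cell_lt r s A0 B0 c : anchor r s A0 B0 -> c < 6 -> A0 * ms + B0 + cell_off c < n.
Proof. by case/and4P=> _ _ H1 H2 Hc; rewrite cellE; apply: vtx_lt; lia. Qed.

Lemma cell_loc r s A0 B0 c : anchor r s A0 B0 -> c < 6 ->
  [/\ in_block r s (A0 + c %/ 2) (B0 + c %% 2), code r s (A0 + c %/ 2) (B0 + c %% 2) = c
   & block_anchor r s (A0 * ms + B0 + cell_off c) = A0 * ms + B0].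
Proof.
case/and4P=> Hr Hs HA HB Hc.
have Ea : local_row r (A0 + c %/ 2) = c %/ 2 by rewrite /local_row; case: eqP; lia.
have Eb : local_col s (B0 + c %% 2) = c %% 2 by rewrite /local_col; case: eqP; lia.
have HBc : B0 + c %% 2 < ms by lia.
split.
- by rewrite /in_block Ea Eb; lia.
- by rewrite /code Ea Eb; lia.
- by rewrite /block_anchor cellE divE // modE // Ea Eb mulnDl; lia.
Qed.

Lemma block_view r s i j : r < 3 -> s < 2 -> in_block r s i j ->
  exists A0 B0 c, [/\ anchor r s A0 B0, c < 6, i = A0 + c %/ 2 & j = B0 + c %% 2].
Proof.
move=> Hr Hs /and4P[H1 H2 H3 H4].
exists (i - local_row r i), (j - local_col s j), (code r s i j); rewrite /anchor /code.
by move: H1 H2 H3 H4; rewrite /local_row /local_col; case: eqP; case: eqP => ? ? ? ? ? ?; split; [apply/and4P; split|..]; lia.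
Qed.

Lemma block_move_cell r s F t A0 B0 c : anchor r s A0 B0 -> c < 6 ->
  block_move r s F t (A0 * ms + B0 + cell_off c) =
  A0 * ms + B0 + cell_off (if F (A0 * ms + B0) then nth 0 t c else c).
Proof.
move=> HA Hc; have [H1 H2 H3] := cell_loc HA Hc.
have E := cellE A0 B0 c; case/and4P: HA => _ _ HA HB.
by rewrite /block_move H3 E divE ?modE ?H1 ?H2 -?E /=; try lia; case: ifP.
Qed.

Lemma block_move_out r s F t v : ~~ in_block r s (v %/ ms) (v %% ms) -> block_move r s F t v = v.
Proof. by rewrite /block_move => /negbTE ->. Qed.

Section Class.
Variables (r s : nat) (F : nat -> bool).
Hypotheses (Hr : r < 3) (Hs : s < 2).
Local Notation block_move := (block_move r s F).

Lemma block_moveP v : (exists A0 B0 c, [/\ anchor r s A0 B0, c < 6 & v = A0 * ms + B0 + cell_off c])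
  \/ (forall t, block_move t v = v).
Proof.
case: (boolP (in_block r s (v %/ ms) (v %% ms))) => H; [left | right => t; exact: block_move_out].
have [A0 [B0 [c [H1 H2 H3 H4]]]] := block_view Hr Hs H.
by exists A0, B0, c; split=> //; rewrite cellE -H3 -H4 -divn_eq.
Qed.

(** A move keeps every vertex in its block, and the selection [F] looks only at the anchor; so the
    second move acts on the same blocks as the first. *)
Lemma block_move_comp t u v : size t = 6 -> all (fun c => c < 6) t ->
  block_move u (block_move t v) = block_move (table_comp t u) v.
Proof.
move=> Ht Ha; case: (block_moveP v) => [[A0 [B0 [c [HA Hc ->]]]]|H]; last by rewrite !H.
have Htc : nth 0 t c < 6 by move/all_nthP: Ha; apply; rewrite Ht.
rewrite !block_move_cell //; last by case: ifP.
by congr (_ + cell_off _); case: (F _) => //; rewrite /table_comp (nth_map 0) ?Ht.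
Qed.

Lemma block_move_id v : block_move (iota 0 6) v = v.
Proof.
case: (block_moveP v) => [[A0 [B0 [c [HA Hc ->]]]]|]; last exact.
by rewrite block_move_cell // nth_iota //; case: ifP.
Qed.

Definition adjv u v :=
  ((u %/ ms == v %/ ms) && (((u %% ms).+1 == v %% ms) || ((v %% ms).+1 == u %% ms)))
  || ((u %% ms == v %% ms) && (((u %/ ms).+1 == v %/ ms) || ((v %/ ms).+1 == u %/ ms))).

Definition legal (f : nat -> nat) :=
  [/\ forall v, v < n -> f v < n, inj_on n f,
      forall v, v < n -> (f v == v) || adjv v (f v)
    & forall v, v < n -> f (f v) = v -> f v = v].

Lemma block_move_lt t v : all (fun c => c < 6) t -> size t = 6 -> v < n -> block_move t v < n.
Proof.
move=> Ha Ht Hv; case: (block_moveP v) => [[A0 [B0 [c [HA Hc Ev]]]]|->] //.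
rewrite Ev block_move_cell //; apply: (cell_lt HA); case: ifP => // _.
by move/all_nthP: Ha; apply; rewrite Ht.
Qed.

Lemma block_move_legal t : legal_table t -> legal (block_move t).
Proof.
case/and5P=> /eqP Ht Ha /eqP Hi Hai /andP[Hadj Hno].
have Hadj' c : c < 6 -> (nth 0 t c == c) || cell_adj c (nth 0 t c).
  by move=> Hc; apply: (allP Hadj); rewrite mem_iota.
have Hno' c : c < 6 -> nth 0 t (nth 0 t c) = c -> nth 0 t c = c.
  by move=> Hc /eqP E; apply/eqP; move: (allP Hno c); rewrite mem_iota Hc E /=; apply.
have Htc c : c < 6 -> nth 0 t c < 6 by move=> Hc; move/all_nthP: Ha; apply; rewrite Ht.
split.
- by move=> v; apply: block_move_lt.
- move=> x y _ _ E; have := congr1 (block_move (table_inv t)) E.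
  by rewrite !block_move_comp // Hi !block_move_id.
- move=> v Hv; case: (block_moveP v) => [[A0 [B0 [c [HA Hc Ev]]]]|->]; last by rewrite eqxx.
  rewrite Ev block_move_cell //; case: ifP => _; last by rewrite eqxx.
  case/orP: (Hadj' _ Hc) => [/eqP ->|Hl]; first by rewrite eqxx.
  apply/orP; right; rewrite /adjv !cellE; case/and4P: HA => _ _ HA HB.
  have := Htc _ Hc; move: (nth 0 t c) Hl => d Hl Hd.
  rewrite !divE ?modE; try lia.
  by move: Hl; rewrite /cell_adj; lia.
- move=> v Hv; case: (block_moveP v) => [[A0 [B0 [c [HA Hc Ev]]]]|->] //.
  rewrite Ev !block_move_cell //; last by case: ifP => // _; apply: Htc.
  case EF: (F _) => // /addnI E; congr (_ + cell_off _); apply: Hno' => //.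
  exact: cell_off_inj.
Qed.

End Class.

(** * Comparators as transpositions inside blocks *)

Section Sort.
Variables (r s p q : nat) (kv : nat -> nat).
Hypotheses (Hr : r < 3) (Hs : s < 2).

(** By truncated subtraction, the condition for the key at cell [p] to exceed the key at cell
    [q]. *)
Definition flag A := kv (A + cell_off p) - kv (A + cell_off q) != 0.
Definition compare_swap v := block_move r s flag (transp p q) v.

(** Both applications read their flags from the same field [kv], so they act on the same blocks. As
    the swap is its own inverse, the key found at a vertex afterwards is the old key at the image of
    that vertex. *)
Lemma compare_swapK v : p < 6 -> q < 6 -> compare_swap (compare_swap v) = v.
Proof.
move=> Hp Hq; case: (block_moveP flag Hr Hs v) => [[A0 [B0 [c [HA Hc Ev]]]]|H]; last by rewrite /compare_swap !H.
have Hn : nth 0 (transp p q) c < 6 by rewrite nth_transp //; repeat case: eqP.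
rewrite Ev /compare_swap block_move_cell //; case Ef: (flag _); rewrite block_move_cell // Ef // nth_transp // nth_transp //.
by congr (_ + cell_off _); case: (c =P p) => [->|]; repeat case: eqP => //; lia.
Qed.

Lemma compare_swap_row v : p %/ 2 = q %/ 2 -> p < 6 -> q < 6 -> compare_swap v %/ ms = v %/ ms.
Proof.
move=> Epq Hp Hq; case: (block_moveP flag Hr Hs v) => [[A0 [B0 [c [HA Hc Ev]]]]|H]; last by rewrite /compare_swap H.
rewrite Ev /compare_swap block_move_cell //; case: ifP => // _; rewrite nth_transp // !cellE.
case/and4P: HA => _ _ HA HB.
by repeat case: eqP => ?; subst; rewrite !divE; try lia.
Qed.

Lemma compare_swap_col v : p %% 2 = q %% 2 -> p < 6 -> q < 6 -> compare_swap v %% ms = v %% ms.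
Proof.
move=> Epq Hp Hq; case: (block_moveP flag Hr Hs v) => [[A0 [B0 [c [HA Hc Ev]]]]|H]; last by rewrite /compare_swap H.
rewrite Ev /compare_swap block_move_cell //; case: ifP => // _; rewrite nth_transp // !cellE.
case/and4P: HA => _ _ HA HB.
by repeat case: eqP => ?; subst; rewrite !modE; try lia.
Qed.

Definition act i j := in_block r s i j && (code r s i j == p).

Lemma act_block i j : act i j -> 
  exists A0 B0, [/\ anchor r s A0 B0, i = A0 + p %/ 2, j = B0 + p %% 2 & p < 6].
Proof.
case/andP=> Hi /eqP Hc; have [A0 [B0 [c [HA Hc6 Ei Ej]]]] := block_view Hr Hs Hi.
have [_ Ec _] := cell_loc HA Hc6; rewrite -Ei -Ej Hc in Ec; subst c.
by exists A0, B0; split.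
Qed.

Lemma block_act A0 B0 c : anchor r s A0 B0 -> c < 6 ->
  act (A0 + c %/ 2) (B0 + c %% 2) = (c == p).
Proof. by move=> HA Hc; rewrite /act; have [-> -> _] := cell_loc HA Hc. Qed.

Lemma line_step_col j : q = p + 2 -> q < 6 -> j < ms ->
  line_step ml (act^~ j) (fun i => kv (i * ms + j)) (fun i => kv (compare_swap (i * ms + j))).
Proof.
move=> Eq Hq Hj; split.
- by move=> i /act_block[A0 [B0 [/and4P[_ _ HA HB] -> _ _]]]; lia.
- move=> i /act_block[A0 [B0 [HA -> -> Hp]]].
  have -> : (A0 + p %/ 2).+1 = A0 + q %/ 2 by lia.
  have -> : B0 + p %% 2 = B0 + q %% 2 by lia.
  by rewrite block_act //; lia.
- move=> i Hi; case: ifPn => [/act_block[A0 [B0 [HA -> -> Hp]]]|nact].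
    have E1 : (A0 + p %/ 2) * ms + (B0 + p %% 2) = A0 * ms + B0 + cell_off p by rewrite cellE.
    have E2 : (A0 + p %/ 2).+1 * ms + (B0 + p %% 2) = A0 * ms + B0 + cell_off q.
      by rewrite cellE; congr (_ * _ + _); lia.
    rewrite E1 E2 /compare_swap block_move_cell // nth_transp // eqxx /flag.
    by case: eqP => /=; lia.
  case: ifP => [/andP[i0 /act_block[A0 [B0 [HA Ei -> Hp]]]]|nact'].
    have E1 : i.-1 * ms + (B0 + p %% 2) = A0 * ms + B0 + cell_off p by rewrite cellE Ei.
    have E2 : i * ms + (B0 + p %% 2) = A0 * ms + B0 + cell_off q.
      by rewrite cellE; congr (_ * _ + _); lia.
    rewrite E1 E2 /compare_swap block_move_cell // nth_transp // eqxx /flag.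
    have -> : (q == p) = false by lia.
    by case: eqP => /=; lia.
  rewrite /compare_swap; case: (block_moveP flag Hr Hs (i * ms + j)) => [[A0 [B0 [c [HA Hc Ev]]]]|H]; last by rewrite H.
  have Ei : i = A0 + c %/ 2 by rewrite -(divE i Hj) Ev cellE divE //; case/and4P: HA; lia.
  have Ej : j = B0 + c %% 2 by rewrite -(modE i Hj) Ev cellE modE //; case/and4P: HA; lia.
  rewrite Ev block_move_cell // nth_transp //.
  have -> : (c == p) = false by move: nact; rewrite Ei Ej block_act // => /negbTE.
  case: (c =P q) => [Ecq|]; last by case: ifP.
  move: nact'; rewrite Ei Ej.
  have -> : (A0 + c %/ 2).-1 = A0 + p %/ 2 by lia.
  have -> : B0 + c %% 2 = B0 + p %% 2 by lia.
  by rewrite block_act ?eqxx //; lia.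
Qed.

Lemma line_step_row i : q = p + 1 -> q < 6 -> p %% 2 = 0 -> i < ml ->
  line_step ms (act i) (fun j => kv (i * ms + j)) (fun j => kv (compare_swap (i * ms + j))).
Proof.
move=> Eq Hq Hp2 Hi; split.
- by move=> j /act_block[A0 [B0 [/and4P[_ _ HA HB] _ -> _]]]; lia.
- move=> j /act_block[A0 [B0 [HA -> -> Hp]]].
  have -> : (B0 + p %% 2).+1 = B0 + q %% 2 by lia.
  have -> : A0 + p %/ 2 = A0 + q %/ 2 by lia.
  by rewrite block_act //; lia.
- move=> j Hj; case: ifPn => [/act_block[A0 [B0 [HA -> -> Hp]]]|nact].
    have E1 : (A0 + p %/ 2) * ms + (B0 + p %% 2) = A0 * ms + B0 + cell_off p by rewrite cellE.
    have E2 : (A0 + p %/ 2) * ms + (B0 + p %% 2).+1 = A0 * ms + B0 + cell_off q.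
      by rewrite cellE; congr (_ * _ + _); lia.
    rewrite E1 E2 /compare_swap block_move_cell // nth_transp // eqxx /flag.
    by case: eqP => /=; lia.
  case: ifP => [/andP[j0 /act_block[A0 [B0 [HA -> Ej Hp]]]]|nact'].
    have E1 : (A0 + p %/ 2) * ms + j.-1 = A0 * ms + B0 + cell_off p by rewrite cellE Ej.
    have E2 : (A0 + p %/ 2) * ms + j = A0 * ms + B0 + cell_off q.
      by rewrite cellE; congr (_ * _ + _); lia.
    rewrite E1 E2 /compare_swap block_move_cell // nth_transp // eqxx /flag.
    have -> : (q == p) = false by lia.
    by case: eqP => /=; lia.
  rewrite /compare_swap; case: (block_moveP flag Hr Hs (i * ms + j)) => [[A0 [B0 [c [HA Hc Ev]]]]|H]; last by rewrite H.
  have Ei : i = A0 + c %/ 2 by rewrite -(divE i Hj) Ev cellE divE //; case/and4P: HA; lia.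
  have Ej : j = B0 + c %% 2 by rewrite -(modE i Hj) Ev cellE modE //; case/and4P: HA; lia.
  rewrite Ev block_move_cell // nth_transp //.
  have -> : (c == p) = false by move: nact; rewrite Ei Ej block_act // => /negbTE.
  case: (c =P q) => [Ecq|]; last by case: ifP.
  move: nact'; rewrite Ei Ej.
  have -> : (B0 + c %% 2).-1 = B0 + p %% 2 by lia.
  have -> : A0 + c %/ 2 = A0 + p %/ 2 by lia.
  by rewrite block_act ?eqxx //; lia.
Qed.

End Sort.

Lemma cover_col i j : i.+1 < ml -> j < ms ->
  exists r s p, [/\ r < 3, s < 2, p < 4 & act r s p i j].
Proof.
move=> Hi Hj.
(* The block starts at [(i, j)], shifted back by one row or one column where it would leave the
   grid; [a] and [b] record the shifts. *)
pose a := (ml <= i + 2 : nat); pose b := (ms <= j + 1 : nat).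
exists ((i - a) %% 3), ((j - b) %% 2), (2 * a + b).
have HA : anchor ((i - a) %% 3) ((j - b) %% 2) (i - a) (j - b) by rewrite /anchor !eqxx /a /b; lia.
have Hp : 2 * a + b < 4 by rewrite /a /b; lia.
split=> //; try lia.
have : act ((i - a) %% 3) ((j - b) %% 2) (2 * a + b) (i - a + (2 * a + b) %/ 2) (j - b + (2 * a + b) %% 2).
  by rewrite block_act ?eqxx //; lia.
have -> : i - a + (2 * a + b) %/ 2 = i by rewrite /a /b; lia.
by have -> : j - b + (2 * a + b) %% 2 = j by rewrite /a /b; lia.
Qed.

Lemma cover_row i j : i < ml -> j.+1 < ms ->
  exists r s a, [/\ r < 3, s < 2, a < 3 & act r s (2 * a) i j].
Proof.
move=> Hi Hj.
(* The two columns of the edge always fit; near the last row the block is shifted back by [a <= 2]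
   rows. *)
pose a := i - (ml - 3).
exists ((i - a) %% 3), (j %% 2), a.
have HA : anchor ((i - a) %% 3) (j %% 2) (i - a) j by rewrite /anchor !eqxx /a; lia.
have Ha : a < 3 by rewrite /a; lia.
split=> //; try lia.
have : act ((i - a) %% 3) (j %% 2) (2 * a) (i - a + (2 * a) %/ 2) (j + (2 * a) %% 2).
  by rewrite block_act ?eqxx //; lia.
have -> : i - a + (2 * a) %/ 2 = i by rewrite /a; lia.
by have -> : j + (2 * a) %% 2 = j by rewrite /a; lia.
Qed.

End Grid.

(** * Edge colouring of bipartite multigraphs *)

Section Kempe.
Variable ml : nat.
Implicit Types (Z U W clr : nat -> nat) (tb cu cw : nat -> nat -> nat).

(* [tb z c = e.+1] when [e] is the edge of colour [c] at the vertex [z], and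
   [tb z c = 0] when the colour is free there. *)
Definition table m Z tb clr := forall z c e, c < ml ->
  (tb z c = e.+1 <-> [/\ e < m, Z e = z & clr e = c]).

Definition upd2 tb z c v z' c' := if (z' == z) && (c' == c) then v else tb z' c'.

(** Properness of the colouring is encoded in the table being single-valued. *)
Lemma table_uniq m Z tb clr e f : table m Z tb clr -> clr e < ml ->
  e < m -> f < m -> Z e = Z f -> clr e = clr f -> e = f.
Proof.
move=> H Hc He Hf EZ Ec.
have E1 : tb (Z e) (clr e) = e.+1 by apply/H.
have E2 : tb (Z e) (clr e) = f.+1 by apply/H.
by move: E1; rewrite E2 => -[].
Qed.

Lemma table_free m Z tb clr z c e : table m Z tb clr -> c < ml -> tb z c = 0 ->
  e < m -> Z e = z -> clr e <> c.
Proof.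
move=> H Hc E He EZ Ec.
have : tb z c = e.+1 by apply/H.
by rewrite E.
Qed.

Lemma table_ext m Z tb tb' clr : (forall z c, c < ml -> tb' z c = tb z c) ->
  table m Z tb clr -> table m Z tb' clr.
Proof. by move=> E H z c e Hc; rewrite E //; apply: H. Qed.

Lemma table_add i Z tb clr a : table i Z tb clr -> tb (Z i) a = 0 -> a < ml ->
  table i.+1 Z (upd2 tb (Z i) a i.+1) (upd clr i a).
Proof.
move=> H Hf Ha z c e Hc; rewrite /upd2 /upd.
case: ifPn => [/andP[/eqP -> /eqP ->]|Hn]; split.
- by move=> -[<-]; rewrite ltnS leqnn eqxx.
- case: (e =P i) => [->|Ne] // [He Ez Ec].
  have He' : e < i by lia.
  by case: (table_free H Ha Hf He' Ez Ec).
- move=> /H [] // He Ez Ec; rewrite ltn_eqF // ltnS ltnW //.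
- case: (e =P i) => [->|Ne] // [He Ez Ec].
    by rewrite Ez Ec !eqxx in Hn.
  by apply/H => //; split => //; lia.
Qed.

(** * Alternating chains in the colours [a] and [b] *)

Section Chain.
Variables (m : nat) (U W : nat -> nat) (a b : nat).
Hypotheses (Ha : a < ml) (Hb : b < ml) (Hab : a <> b).

(* The chain has recoloured the edge [g] from [b] to [a], and the table [cw] is
   not yet updated at the end [cur] of [g]. The chain never returns to the
   vertices [V] and [Y] it has visited on the two sides. *)
Definition chain cu cw clr cur g (V Y : seq nat) :=
  [/\ table m U cu clr,
      forall z c e, c < ml -> ~ (z = cur /\ (c = a \/ c = b)) ->
        (cw z c = e.+1 <-> [/\ e < m, W e = z & clr e = c]),
      [/\ cw cur b = g.+1, g < m, W g = cur, clr g = a &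
          forall e, e < m -> W e = cur -> clr e <> b],
      forall e, cw cur a = e.+1 <-> [/\ e < m, W e = cur, clr e = a & e <> g]
    & [/\ forall e, e < m -> clr e < ml, cur \notin V,
        forall w, w \in V -> exists e, [/\ e < m, W e = w, clr e = b & U e \in Y]
      & forall h, h < m -> U h \in Y -> clr h = a -> W h \in V \/ W h = cur /\ h = g]].

Lemma chain_ext cu cu' cw cw' clr cur g V Y :
  (forall z c, c < ml -> cu' z c = cu z c) -> (forall z c, c < ml -> cw' z c = cw z c) ->
  chain cu cw clr cur g V Y -> chain cu' cw' clr cur g V Y.
Proof.
move=> Eu Ew [L1 L2 L3 L4 L5]; split; rewrite ?Ew //.
  exact: table_ext L1.
by move=> z c e Hc; rewrite Ew //; apply: L2.
Qed.

Definition coloured cu cw clr :=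
  [/\ table m U cu clr, table m W cw clr & forall e, e < m -> clr e < ml].

Section Step.
Variables (cu cw : nat -> nat -> nat) (clr : nat -> nat) (cur g : nat) (V Y : seq nat).
Hypothesis HI : chain cu cw clr cur g V Y.

(** Since [cw cur b] is the stale entry of [g], this exchanges the entries of the two colours at
    [cur]; [cu1] below does the same at the start column of [e]. *)
Definition cw1 := upd2 (upd2 cw cur a g.+1) cur b (cw cur a).

Lemma chain_stop_w : cw cur a = 0 -> coloured cu cw1 clr.
Proof.
case: HI => L1 L2 [L3 Lg Lw Lc Lb] L4 [R _ _ _] E0; split=> // z c e Hc; rewrite /cw1 /upd2.
case: (z =P cur) => [->|Nz] /=; last by apply: L2 => // -[].
case: (c =P b) => [->|Nb] /=.
  rewrite E0; split=> // -[He Ew Eb]; by case: (Lb _ He Ew).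
case: (c =P a) => [->|Na] /=; last by apply: L2 => // -[_ []].
split=> [[<-]|[He Ew Ec]] //.
case: (e =P g) => [->|Ne] //; have : cw cur a = e.+1 by apply/L4.
by rewrite E0.
Qed.

Section Edge.
Variable e : nat.
Hypothesis Ee : cw cur a = e.+1.
Let y := U e.
Definition cu1 := upd2 (upd2 cu y b e.+1) y a (cu y b).
Definition clr1 := upd clr e b.

Lemma edge_e : [/\ e < m, W e = cur, clr e = a & e <> g].
Proof. by case: HI => _ _ _ L4 _; apply/L4. Qed.

Lemma cw1_ok z c f : c < ml -> (cw1 z c = f.+1 <-> [/\ f < m, W f = z & clr1 f = c]).
Proof.
move=> Hc; have [e1 e2 e3 e4] := edge_e.
case: HI => L1 L2 [L3 Lg Lw Lc Lb] L4 [R _ _ _]; rewrite /cw1 /upd2 /clr1 /upd Ee.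
case: (z =P cur) => [->|Nz] /=; last first.
  rewrite L2 //; last by case.
  case: (f =P e) => [->|//]; split=> -[_ Ew _]; by case: Nz; rewrite -Ew.
case: (c =P b) => [->|Nb] /=.
  split=> [[<-]|]; first by rewrite eqxx.
  case: (f =P e) => [->//|_] [Hf Ew Eb]; by case: (Lb _ Hf Ew).
case: (c =P a) => [->|Na] /=.
  case: (f =P e) => [->|Nf].
    by split=> [[]|[_ _ /esym]] // Eg; case: e4.
  split=> [[<-]//|[Hf Ew Ec]]; case: (f =P g) => [->//|Nfg].
  have : cw cur a = f.+1 by apply/L4.
  by rewrite Ee => -[] /esym.
rewrite L2 //; last by case=> _ [].
by case: (f =P e) => [->|//]; rewrite e3; split=> -[_ _] /esym.
Qed.

Lemma chain_stop_u : cu y b = 0 -> coloured cu1 cw1 clr1.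
Proof.
move=> E0; have [e1 e2 e3 e4] := edge_e.
case: HI => L1 _ _ _ [R _ _ _]; split.
- move=> z c f Hc; rewrite /cu1 /upd2 /clr1 /upd E0.
  case: (z =P y) => [->|Nz] /=; last first.
    rewrite L1 //; case: (f =P e) => [->|//]; split=> -[_ Eu _]; by case: Nz; rewrite -Eu.
  case: (c =P a) => [->|Na] /=.
    case: (f =P e) => [->|Nf]; split=> // -[Hf Eu Ec]; first by case: Hab.
    by case: Nf; apply: (table_uniq L1); rewrite ?R ?Ec.
  case: (c =P b) => [->|Nb] /=.
    split=> [[<-]|]; first by rewrite eqxx.
    case: (f =P e) => [->//|_] [Hf Eu Ec]; by case: (table_free L1 Hb E0 Hf Eu).
  rewrite L1 //; case: (f =P e) => [->|//]; rewrite e3; split=> -[_ _] /esym //.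
- exact: cw1_ok.
- by move=> f Hf; rewrite /clr1 /upd; case: eqP => // _; apply: R.
Qed.

(** The edge [e] passes from [a] to [b], collides with [h] at its start column, and [h] passes from
    [b] to [a]. Freshness of the two new vertices keeps the invariant and later bounds the length of
    the chain. *)
Lemma chain_next h : cu y b = h.+1 ->
  chain cu1 cw1 (upd clr1 h a) (W h) h (cur :: V) (y :: Y).
Proof.
move=> Eh; have [e1 e2 e3 e4] := edge_e; have C1 := cw1_ok.
case: HI => L1 L2 [L3 Lg Lw Lc Lb] L4 [R M0 M1 M2].
have [h1 h2 h3] : [/\ h < m, U h = y & clr h = b] by apply/L1.
have Neh : e <> h by move=> E; case: Hab; rewrite -e3 -h3 E.
(* An [a]-edge at a visited start column ends in [V] or is [g], and [e] does neither. *)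
have Yn : y \notin Y.
  apply/negP => Hy; case: (M2 e e1 Hy e3); first by rewrite e2 (negbTE M0).
  by case.
have Ncur : W h <> cur by move=> E; case: (Lb _ h1 E).
(* A visited end column has a [b]-edge starting in [Y]; by uniqueness it would be [h], which starts
   at the fresh [y]. *)
have Vn : W h \notin V.
  apply/negP => /M1[f [f1 f2 f3 f4]].
  have : f = h.
    have A1 : cw (W h) b = f.+1 by apply/L2 => //; case.
    have A2 : cw (W h) b = h.+1 by apply/L2 => //; case.
    by move: A1; rewrite A2 => -[].
  by move=> E; move: f4; rewrite E h2 (negbTE Yn).
set clr2 := upd clr1 h a.
have c2 f : clr2 f = if f == h then a else if f == e then b else clr f by [].
have Wcw1 z c : z <> cur -> cw1 z c = cw z c.
  by move=> Nz; rewrite /cw1 /upd2; case: (z =P cur).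
split.
- move=> z c f Hc; rewrite /cu1 /upd2 c2.
  case: (z =P y) => [->|Nz] /=; last first.
    rewrite L1 //; case: (f =P h) => [->|_]; last case: (f =P e) => [->|//];
    split=> -[_ Eu _]; case: Nz; by rewrite -Eu.
  case: (c =P a) => [->|Na] /=.
    rewrite Eh; split=> [[<-]|]; first by rewrite eqxx.
    case: (f =P h) => [->//|_]; case: (f =P e) => [_ [_ _ /esym]//|Nf] [Hf Eu Ec].
    by case: Nf; apply: (table_uniq L1); rewrite ?R ?Ec.
  case: (c =P b) => [->|Nb] /=.
    split=> [[<-]|]; first by rewrite eqxx; case: (e =P h).
    case: (f =P h) => [_ [_ _]//|Nf]; case: (f =P e) => [->//|_] [Hf Eu Ec].
    by case: Nf; apply: (table_uniq L1); rewrite ?R ?Ec ?h2.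
  rewrite L1 //; case: (f =P h) => [->|_]; last case: (f =P e) => [->|//].
    by rewrite h3; split=> -[_ _] /esym.
  by rewrite e3; split=> -[_ _] /esym.
- move=> z c f Hc Hn; rewrite C1 // c2 /clr1 /upd; case: (f =P h) => [->|//].
  case: (h =P e) => [/esym//|_]; rewrite h3; split=> -[_ Ew Ec]; case: Hn; split=> //.
    by right.
  by left.
- split=> //.
  + by rewrite Wcw1 //; apply/L2 => //; case.
  + by rewrite c2 eqxx.
  + move=> f Hf Ew; rewrite c2; case: (f =P h) => // Nf.
    case: (f =P e) => [Ef|_]; first by case: Ncur; rewrite -Ew Ef.
    move=> Ec; case: Nf.
    have A1 : cw (W h) b = f.+1 by apply/L2 => //; case.
    have A2 : cw (W h) b = h.+1 by apply/L2 => //; case.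
    by move: A1; rewrite A2 => -[].
- move=> f; rewrite Wcw1 // L2 //; last by case.
  rewrite c2; case: (f =P h) => [->|Nf].
    by rewrite h3; split=> [[_ _ /esym]|[]].
  case: (f =P e) => [->|_]; first by rewrite e2; split=> -[_ /esym].
  by split=> [[]|[]].
- split.
  + by move=> f Hf; rewrite c2; case: eqP => // _; case: eqP => // _; apply: R.
  + by rewrite inE negb_or Vn andbT; apply/eqP.
  + move=> w; rewrite inE => /orP[/eqP ->|].
      exists e; split=> //; last by rewrite inE eqxx.
      by rewrite c2 eqxx; case: (e =P h).
    move=> /M1[f [f1 f2 f3 f4]].
    exists f; split=> //; last by rewrite inE f4 orbT.
    rewrite c2; case: (f =P h) => [Ef|_]; last by case: eqP.
    by move: f4; rewrite Ef h2 (negbTE Yn).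
  + move=> f Hf; rewrite inE c2 => /orP[/eqP Ey|HY].
      case: (f =P h) => [->|Nf]; first by right.
      case: (f =P e) => [_ /esym//|Nfe Ec].
      by case: Nfe; apply: (table_uniq L1); rewrite ?R ?Ec.
    case: (f =P h) => [Ef|_]; first by move: HY; rewrite Ef h2 (negbTE Yn).
    case: (f =P e) => [Ef|_]; first by move: HY; rewrite Ef (negbTE Yn).
    move=> Ec; left; rewrite inE; case: (M2 f Hf HY Ec) => [->|[-> _]]; rewrite ?eqxx ?orbT //.
Qed.

End Edge.
End Step.
End Chain.

(** The new edge gets the colour [a] that is free at its start column. At its end column it is
    entered under the free colour [b], as if it had just been recoloured from [b] to [a], so that
    the insertion looks like any later step of the chain. *)
Lemma chain_start i U W cu cw clr a b :
  table i U cu clr -> table i W cw clr -> (forall e, e < i -> clr e < ml) ->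
  a < ml -> b < ml -> cu (U i) a = 0 -> cw (W i) b = 0 -> cw (W i) a <> 0 ->
  a <> b /\
  chain i.+1 U W a b (upd2 cu (U i) a i.+1) (upd2 cw (W i) b i.+1) (upd clr i a)
     (W i) i [::] [::].
Proof.
move=> HU HW R Ha Hb Fa Fb Na.
have Hab : a <> b by move=> E; rewrite E in Na.
split=> //; split.
- exact: table_add.
- move=> z c e Hc Hn; rewrite /upd2 /upd.
  case: ifP => [/andP[/eqP Ez /eqP Ec]|_]; first by case: Hn; split=> //; right.
  rewrite HW //; case: (e =P i) => [->|Ne].
    rewrite ltnn; split=> -[] // _ Ew Ea; case: Hn; split=> //; by left.
  by split=> -[He Ew Ec]; split=> //; lia.
- rewrite /upd2 /upd !eqxx; split=> // e He Ew; case: eqP => // Ne.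
  apply: (table_free HW Hb Fb) => //; lia.
- move=> e; rewrite /upd2 /upd eqxx /=; case: (a =P b) => // _.
  rewrite HW //; case: (e =P i) => [->|Ne]; first by rewrite ltnn; split=> -[].
  by split=> [[He Ew Ec]|[He Ew Ec _]]; split=> //; lia.
- split=> // e He; rewrite /upd; case: eqP => // Ne; apply: R; lia.
Qed.

(** A column has [ml] vertices. If all [ml] colours were taken at it, the earlier robots carrying
    them would occupy all its rows, including the one of robot [i]. *)
Lemma free_colour ms (X : nat -> nat) i (Z := fun x => X x %% ms) tb clr :
  0 < ms -> table i Z tb clr -> inj_on (ml * ms) X -> (forall x, x < ml * ms -> X x < ml * ms) ->
  i < ml * ms -> exists2 c, c < ml & tb (Z i) c = 0.
Proof.
move=> Hms HT XI XL Hi.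
case: (boolP [exists c : 'I_ml, tb (Z i) c == 0]) => [/existsP[c /eqP Hc]|]; first by exists c.
rewrite negb_exists => /forallP Hn; exfalso.
pose e c := (tb (Z i) c).-1.
have He c : c < ml -> [/\ e c < i, Z (e c) = Z i & clr (e c) = c].
  move=> Hc; apply/HT => //; have := Hn (Ordinal Hc); rewrite /e /=.
  by case: (tb _ _).
have HL c : c < ml -> e c < ml * ms by move=> /He[]; lia.
have row x : x < ml * ms -> X x %/ ms < ml by move=> Hx; rewrite ltn_divLR // XL.
have eqX x x' : x < ml * ms -> x' < ml * ms -> Z x = Z x' -> X x %/ ms = X x' %/ ms -> x = x'.
  by move=> Hx Hx' E1 E2; apply: XI => //; rewrite (divn_eq (X x) ms) (divn_eq (X x') ms) E2 -/(Z x) E1.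
have [||c Hc Ec] := @inj_on_surj ml (fun c => X (e c) %/ ms) _ _ (X i %/ ms) (row _ Hi).
- move=> c d Hc Hd Ecd; have [_ z1 k1] := He _ Hc; have [_ z2 k2] := He _ Hd.
  by rewrite -k1 -k2; congr clr; apply: eqX; rewrite ?HL // z1 z2.
- by move=> c Hc; apply/row/HL.
have [lt_ei ez _] := He _ Hc.
have E : e c = i by apply: eqX; rewrite ?HL.
by rewrite E ltnn in lt_ei.
Qed.

End Kempe.

(** * The routing program *)

Local Notation OUT := 0 (only parsing).
Local Notation IN := 1 (only parsing).
Local Notation POS := 2 (only parsing).
Local Notation KEY := 3 (only parsing).
Local Notation KV := 4 (only parsing).
Local Notation FLAG := 5 (only parsing).
Local Notation ROW := 6 (only parsing).
Local Notation COL := 7 (only parsing).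
Local Notation M3 := 8 (only parsing).
Local Notation M2 := 9 (only parsing).
Local Notation UB := 10 (only parsing).
Local Notation CU := 11 (only parsing).
Local Notation CW := 12 (only parsing).
Local Notation CLR := 13 (only parsing).
Local Notation MARK := 14 (only parsing).

Local Notation vx := 0 (only parsing).
Local Notation vv := 1 (only parsing).
Local Notation vcnt := 2 (only parsing).
Local Notation vt := 3 (only parsing).
Local Notation vu := 4 (only parsing).
Local Notation vw := 5 (only parsing).
Local Notation va := 6 (only parsing).
Local Notation vb := 7 (only parsing).
Local Notation vcur := 8 (only parsing).
Local Notation valive := 9 (only parsing).
Local Notation ve := 10 (only parsing).
Local Notation vg := 11 (only parsing).
Local Notation vc := 12 (only parsing).
Local Notation vy := 13 (only parsing).

Local Notation xE := (EV vx).

Fixpoint tabE (l : seq expr) e := match l with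
  | [::] => EC 0 | y :: l => EIf e (tabE l (ESub e (EC 1))) y end.

Definition leE a b := EIf (ESub a b) (EC 0) (EC 1).
(** Any nonzero value counts as true, so the second operand itself can be returned. *)
Definition andE a b := EIf a b (EC 0).

(** The residue of [k - r] modulo [m], for [r] and [k] below [m], without a division. *)
Definition wrapE r m k := EIf (ESub (EC r) k) (ESub (EAdd k (EC m)) (EC r)) (ESub k (EC r)).
Definition cur_rowE := EA ROW (EV vv).
Definition cur_colE := EA COL (EV vv).
Definition laE r := wrapE r 3 (EA M3 cur_rowE).
Definition lbE s := wrapE s 2 (EA M2 cur_colE).
Definition ancE r s :=
  ESub (EV vv) (EAdd (tabE [:: EC 0; EP 1; EAdd (EP 1) (EP 1)] (laE r)) (lbE s)).
Definition inbE r s :=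
  andE (leE (laE r) cur_rowE) (andE (ESub (EP 0) (EAdd (ESub cur_rowE (laE r)) (EC 2)))
  (andE (leE (lbE s) cur_colE) (ESub (EP 1) (EAdd (ESub cur_colE (lbE s)) (EC 1))))).
Definition offE c := iter (c %/ 2) (EAdd (EP 1)) (EC (c %% 2)).
Definition moveE r s t :=
  EIf (andE (inbE r s) (EA FLAG (ancE r s)))
      (EAdd (ancE r s) (tabE (map offE t) (EAdd (EAdd (laE r) (laE r)) (lbE s))))
      (EV vv).

Definition emit := CSeq (CPut OUT (EV vcnt) (EA POS xE)) (CSet vcnt (EAdd (EV vcnt) (EC 1))).

Definition moveC r s t :=
  CFor vx (BP 2) (CSeq (CSet vv (EA POS xE)) (CSeq (CPut POS xE (moveE r s t)) emit)).

(** Keys are kept by robot, but comparators need them by vertex. *)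
Definition scatterC := CFor vx (BP 2) (CPut KV (EA POS xE) (EA KEY xE)).
Definition flagC p q := CFor vx (BP 2)
  (CPut FLAG xE (ESub (EA KV (EAdd xE (offE p))) (EA KV (EAdd xE (offE q))))).

(* One-step rotations of the upper square, the lower square and the whole ring
   of a block, in both directions; [kinds] lists shortest words in them whose
   product is the transposition of two adjacent cells. *)
Definition mvU := [:: 1; 3; 0; 2; 4; 5].
Definition mvu := [:: 2; 0; 3; 1; 4; 5].
Definition mvL := [:: 0; 1; 3; 5; 2; 4].
Definition mvl := [:: 0; 1; 4; 2; 5; 3].
Definition mvR := [:: 1; 3; 0; 5; 2; 4].
Definition mvr := [:: 2; 0; 4; 1; 5; 3].

Definition kind := (nat * nat * seq (seq nat))%type.

Definition kinds (vertical : bool) : seq kind := if vertical then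
  [:: (0, 2, [:: mvu; mvl; mvR]); (1, 3, [:: mvU; mvL; mvr]);
      (2, 4, [:: mvL; mvU; mvr]); (3, 5, [:: mvl; mvu; mvR])]
  else
  [:: (0, 1, [:: mvU; mvU; mvL; mvr; mvu]); (2, 3, [:: mvU; mvr; mvL]);
      (4, 5, [:: mvL; mvU; mvr; mvu; mvR])].

Definition macroC (k : kind) r s :=
  CSeq scatterC (CSeq (flagC k.1.1 k.1.2) (foldr (fun t c => CSeq (moveC r s t) c) CSkip k.2)).

(** Blocks of one class are disjoint and move together; the six classes come one after the other,
    since only together do they contain every edge of the grid. *)
Definition classes vertical : seq (kind * nat * nat) :=
  [seq (kr, s) | kr <- [seq (k, r) | k <- kinds vertical, r <- iota 0 3], s <- iota 0 2].

Definition roundC vertical :=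
  foldr (fun c d => CSeq (macroC c.1.1 c.1.2 c.2) d) CSkip (classes vertical).

Definition phaseC vertical := CFor vt (BP 0) (roundC vertical).

Definition round_len vertical := sumn [seq size c.1.1.2 | c <- classes vertical].
(** The words of [kinds] have total length 12 for vertical and 13 for horizontal edges. Over six
    classes a round takes 72 or 78 steps, and two vertical phases and one horizontal phase give 2 *
    72 + 78 = 222 per round. *)
Definition rate := 2 * round_len true + round_len false.

Definition startE := EA IN (EAdd (EC 2) xE).
Definition goalE := EA IN (EAdd (EC 2) (EAdd (EP 2) xE)).

Definition keyC e := CFor vx (BP 2) (CPut KEY xE e).

Definition routeC :=
  CSeq (CSet vcnt (EC 1))
  (CSeq (CFor vx (BP 2) (CSeq (CPut POS xE startE) emit))
  (CSeq (keyC (EA CLR xE)) (CSeq (phaseC true)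
  (CSeq (keyC (EA COL goalE)) (CSeq (phaseC false)
  (CSeq (keyC (EA ROW goalE)) (phaseC true))))))).

(** The input ends at cell [2 * ml * ms + 1], and the cells 4 to 63 were saved by [boot]; so
    [2 * ml * ms] cells from 64 on contain the rest. *)
Definition inputC :=
  CSeq (CFor vx (BP 2) (CPut IN (EAdd (EC 64) xE) (ELo xE)))
       (CFor vx (BP 2) (CPut IN (EAdd (EC 64) (EAdd (EP 2) xE)) (ELo (EAdd (EP 2) xE)))).

(* The erased [XI 0] and [XI 1] are the two vertices not taken by other robots. *)
Definition recoverC :=
  CSeq (CFor vx (BP 2) (CIf (ESub xE (EC 1)) (CPut MARK startE (EC 1)) CSkip))
  (CSeq (CFor vx (BP 2) (CIf (EA MARK xE) CSkip (CSeq (CSet va (EV vb)) (CSet vb xE))))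
  (CIf (ESub (EP 3) (EC 1))
    (CSeq (CPut IN (EC 2) (EV vb)) (CPut IN (EC 3) (EV va)))
    (CSeq (CPut IN (EC 2) (EV va)) (CPut IN (EC 3) (EV vb))))).

Definition succx := EAdd xE (EC 1).
(** All tables are filled by counting. [UB] holds the multiples of [ml], the row offsets of the
    flattened colour tables. *)
Definition tablesC :=
  CFor vx (BP 2)
  (CSeq (CIf (ESub (EP 1) (EAdd (EA COL xE) (EC 1)))
     (CSeq (CPut COL succx (EAdd (EA COL xE) (EC 1))) (CPut ROW succx (EA ROW xE)))
     (CSeq (CPut COL succx (EC 0)) (CPut ROW succx (EAdd (EA ROW xE) (EC 1)))))
  (CSeq (CPut M3 succx (EIf (ESub (EC 2) (EA M3 xE)) (EAdd (EA M3 xE) (EC 1)) (EC 0)))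
  (CSeq (CPut M2 succx (EIf (EA M2 xE) (EC 0) (EC 1)))
        (CPut UB succx (EAdd (EA UB xE) (EP 0)))))).

Definition at_ z c := EAdd (EA UB (EV z)) (EV c).
(** Loops have no early exit, so the last free colour is the one kept. *)
Definition freeC tb z res :=
  CFor vc (BP 0) (CIf (EA tb (at_ z vc)) CSkip (CSet res (EV vc))).

Definition decE y := ESub (EV y) (EC 1).

Definition chainC :=
  CSeq (CSet ve (EA CW (at_ vcur va)))
  (CSeq (CPut CW (at_ vcur va) (EA CW (at_ vcur vb)))
  (CSeq (CPut CW (at_ vcur vb) (EV ve))
  (CIf (EV ve)
    (CSeq (CPut CLR (decE ve) (EV vb))
    (CSeq (CSet vy (EA COL (EA IN (EAdd (EC 2) (decE ve)))))
    (CSeq (CSet vg (EA CU (at_ vy vb)))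
    (CSeq (CPut CU (at_ vy vb) (EV ve))
    (CSeq (CPut CU (at_ vy va) (EV vg))
    (CIf (EV vg)
      (CSeq (CPut CLR (decE vg) (EV va))
            (CSet vcur (EA COL (EA IN (EAdd (EC 2) (EAdd (EP 2) (decE vg)))))))
      (CSet valive (EC 0))))))))
    (CSet valive (EC 0))))).

(** [ms] rounds of the chain suffice, as it never returns to an end column. *)
Definition insertC :=
  CSeq (CSet vu (EA COL startE)) (CSeq (CSet vw (EA COL goalE))
  (CSeq (freeC CU vu va) (CSeq (freeC CW vw vb)
  (CSeq (CPut CLR xE (EV va)) (CSeq (CPut CU (at_ vu va) succx)
  (CIf (EA CW (at_ vw va))
    (CSeq (CPut CW (at_ vw vb) succx)
    (CSeq (CSet vcur (EV vw)) (CSeq (CSet valive (EC 1))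
      (CFor vc (BP 1) (CIf (EV valive) chainC CSkip)))))
    (CPut CW (at_ vw va) succx))))))).

Definition colourC := CFor vx (BP 2) insertC.

(** The makespan is computed by repeated addition. The copy covers [ml * rate.+1 * (ml * ms)] cells,
    a product of available loop bounds that is at least the [(ml * rate).+1 * (ml * ms)] cells of
    the trace. Cells below 64 are registers during the run and are left to [fin]. *)
Definition outputC :=
  CSeq (CPut OUT (EC 0) (EC 0)) (CSeq (CFor vx (BP 0) (CPut OUT (EC 0) (EAdd (EA OUT (EC 0)) (EC rate))))
  (CSeq (CSet vv (EC 0))
  (CFor vt (BP 0) (CFor vc (BC rate.+1) (CFor vx (BP 2)
    (CSeq (CLo (EV vv) (EA OUT (EAdd (EC 64) (EV vv)))) (CSet vv (EAdd (EV vv) (EC 1))))))))).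

Definition mainC :=
  CSeq inputC (CSeq recoverC (CSeq tablesC (CSeq colourC (CSeq routeC outputC)))).

Lemma rateE : rate = 222. Proof. by vm_compute. Qed.

Lemma mainC_wf : [&& wf_cmd mainC, degree mainC <= 3 & loops_over (fun p => p < 3) mainC].
Proof. by vm_compute. Qed.

Definition kind_ok vertical (k : kind) :=
  let: (p, q, w) := k in
  [&& p < q, q < 6, q == (if vertical then p + 2 else p + 1),
      vertical || (p %% 2 == 0), all legal_table w & foldl table_comp (iota 0 6) w == transp p q].

Lemma kinds_ok vertical : all (kind_ok vertical) (kinds vertical).
Proof. by case: vertical; vm_compute. Qed.

(** * Executing block moves *)

Lemma eval_tabE S par st l e :
  eval S par st (tabE l e) = nth 0 (map (eval S par st) l) (eval S par st e).
Proof.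
elim: l e => [|y l IH] e /=; first by rewrite nth_nil.
case: eqP => [->//|/eqP]; rewrite IH /=.
by case: (eval S par st e) => //= k _; rewrite subn1.
Qed.

(** With [for_ind] an invariant would have to carry along everything that the body leaves alone;
    here the syntactic frame conditions supply it in every round. *)
Lemma for_frame S par (Q : nat -> store -> Prop) x b c st :
  Q 0 st -> 
  (forall i s, i < bval par b -> (forall k, ~~ writes k c -> ar s k = ar st k) ->
     (forall y, ~~ assigns y (CFor x b c) -> vr s y = vr st y) ->
     Q i s -> Q i.+1 (ev S par c (setv x i s))) ->
  exists2 s, Q (bval par b) s & ev S par (CFor x b c) st = setv x (bval par b) s.
Proof.
move=> Q0 QS.
have [||s [_ _ Hs] E] := @for_ind S par (fun i s => [/\ forall k, ~~ writes k c -> ar s k = ar st k,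
   forall y, ~~ assigns y (CFor x b c) -> vr s y = vr st y & Q i s]) x b c st; last by exists s.
- by split.
- move=> i s Hi [H1 H2 H3]; split; last exact: QS.
    by move=> k Hk; rewrite frame_a // H1.
  by move=> y /= Hy; rewrite frame_v /= /upd; move: (Hy); rewrite negb_or => /andP[/negbTE e1 e2] //; rewrite e1 H2.
Qed.

Section Moves.
Variables ml ms S bit : nat.
Hypotheses (Hml : 3 <= ml) (Hms : 2 <= ms).
Local Notation n := (ml * ms).
Local Notation par := (params ml ms bit).
Local Notation ev := (ev S par).
Local Notation eval := (eval S par).
Local Notation cell_off := (cell_off ms).

Lemma eval_offE st c : eval st (offE c) = cell_off c.
Proof.
rewrite /offE /cell_off; elim: (c %/ 2) => [|k IH] //=.
by rewrite IH /params /= mulSn addnA.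
Qed.

Definition tables st := forall v, v <= n ->
  [/\ ar st ROW v = v %/ ms, ar st COL v = v %% ms, ar st M3 v = v %% 3,
      ar st M2 v = v %% 2 & ar st UB v = v * ml].

Lemma n_gt : 6 <= n. Proof. by nia. Qed.
Lemma ml_le_n : ml <= n. Proof. by nia. Qed.
Lemma ms_le_n : ms <= n. Proof. by nia. Qed.

Section Move.
Variables (st : store) (v r s : nat).
Hypotheses (Ht : tables st) (Ev : vr st vv = v) (Hv : v < n).

Lemma eval_cur_rowE : eval st cur_rowE = v %/ ms.
Proof. by rewrite /= Ev; have [] := Ht (ltnW Hv). Qed.
Lemma eval_cur_colE : eval st cur_colE = v %% ms.
Proof. by rewrite /= Ev; have [] := Ht (ltnW Hv). Qed.
Lemma eval_laE : eval st (laE r) = local_row r (v %/ ms).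
Proof.
have Hr : v %/ ms <= n by have := vtx_row Hml Hms Hv; have := ml_le_n; lia.
have E : eval st (EA M3 cur_rowE) = (v %/ ms) %% 3.
  by rewrite -[LHS]/(ar st M3 (eval st cur_rowE)) eval_cur_rowE; have [] := Ht Hr.
rewrite -[LHS]/(if r - eval st (EA M3 cur_rowE) == 0 then eval st (EA M3 cur_rowE) - r
   else eval st (EA M3 cur_rowE) + 3 - r).
by rewrite E.
Qed.
Lemma eval_lbE : eval st (lbE s) = local_col s (v %% ms).
Proof.
have Hr : v %% ms <= n by have := vtx_col Hml Hms v; have := ms_le_n; lia.
have E : eval st (EA M2 cur_colE) = (v %% ms) %% 2.
  by rewrite -[LHS]/(ar st M2 (eval st cur_colE)) eval_cur_colE; have [] := Ht Hr.
rewrite -[LHS]/(if s - eval st (EA M2 cur_colE) == 0 then eval st (EA M2 cur_colE) - s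
   else eval st (EA M2 cur_colE) + 2 - s).
by rewrite E.
Qed.
Hypotheses (Hr : r < 3) (Hs : s < 2).

Lemma la_lt i : local_row r i < 3.
Proof. by rewrite /local_row; case: eqP; lia. Qed.

Lemma eval_ancE : eval st (ancE r s) = block_anchor ms r s v.
Proof.
rewrite -[LHS]/(vr st vv - (eval st (tabE [:: EC 0; EP 1; EAdd (EP 1) (EP 1)] (laE r)) + eval st (lbE s))).
rewrite Ev eval_lbE eval_tabE eval_laE; congr (_ - (_ + _)) => /=.
by have := la_lt (v %/ ms); case: (local_row _ _) => [|[|[|k]]] //= _; rewrite /params /=; lia.
Qed.

Lemma eval_inbE : (eval st (inbE r s) != 0) = in_block ml ms r s (v %/ ms) (v %% ms).
Proof.
rewrite /in_block -eval_laE -eval_lbE -eval_cur_rowE -eval_cur_colE /inbE /andE /leE.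
rewrite -[eval _ (EIf _ _ _)]/(if (if eval st (laE r) - eval st cur_rowE == 0 then 1 else 0) == 0 then 0 else
  if ml - (eval st cur_rowE - eval st (laE r) + 2) == 0 then 0 else
  if (if eval st (lbE s) - eval st cur_colE == 0 then 1 else 0) == 0 then 0 else
   ms - (eval st cur_colE - eval st (lbE s) + 1)).
move: (eval st (laE r)) (eval st cur_rowE) (eval st (lbE s)) (eval st cur_colE) => p1 p2 p3 p4.
case: (p1 - p2 =P 0) => E1 /=; last lia.
case: (ml - _ =P 0) => E2 /=; first lia.
case: (p3 - p4 =P 0) => E3 /=; lia.
Qed.

Lemma eval_moveE t : size t = 6 -> 
  eval st (moveE r s t) = block_move ml ms r s (fun A => ar st FLAG A != 0) t v.
Proof.
move=> Ht6; rewrite /block_move -eval_inbE -eval_ancE /moveE /andE.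
rewrite -[LHS]/(if (if eval st (inbE r s) == 0 then 0 else ar st FLAG (eval st (ancE r s))) == 0
  then vr st vv else eval st (ancE r s) + eval st (tabE (map offE t) (EAdd (EAdd (laE r) (laE r)) (lbE s)))).
case: (eval st (inbE r s) =P 0) => _ /=; first exact: Ev.
case: (ar _ _ _ =P 0) => _ /=; first exact: Ev.
congr (_ + _).
rewrite eval_tabE -[X in nth _ _ X]/(eval st (laE r) + eval st (laE r) + eval st (lbE s)).
rewrite eval_laE eval_lbE addnn -mul2n -map_comp.
have Hc : code r s (v %/ ms) (v %% ms) < 6.
  by rewrite /code; have := la_lt (v %/ ms); rewrite /local_col; case: eqP; lia.
by rewrite -/(code r s (v %/ ms) (v %% ms)) (nth_map 0) ?Ht6 //= eval_offE.
Qed.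

End Move.

Lemma eq_block_move r s F F' t v : v < n -> (forall A, A < n -> F A = F' A) ->
  block_move ml ms r s F t v = block_move ml ms r s F' t v.
Proof. by move=> Hv HF; rewrite /block_move HF //; rewrite /block_anchor; lia. Qed.

Variable X0 : nat -> nat.

(** [tr k x] is the vertex of robot [x] after [k] steps. The offset 1 reserves cell 0 for the
    makespan, and [vcnt] points to the next free output entry. *)
Definition traced st T (X : nat -> nat) :=
  [/\ exists tr : nat -> nat -> nat,
      [/\ forall x, x < n -> tr 0 x = X0 x, forall x, x < n -> tr T x = X x,
          forall k, k < T -> exists2 f, legal ml ms f & forall x, x < n -> tr k.+1 x = f (tr k x)
        & forall k x, k <= T -> x < n -> ar st OUT (1 + k * n + x) = tr k x],
      vr st vcnt = 1 + T.+1 * n & forall x, x < n -> ar st POS x = X x].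

Definition placed (X : nat -> nat) := inj_on n X /\ forall x, x < n -> X x < n.

Lemma placed_comp X f : placed X -> legal ml ms f -> placed (fun x => f (X x)).
Proof.
move=> [H1 H2] [F1 F2 _ _]; split; last by move=> x Hx; rewrite F1 // H2.
by move=> x y Hx Hy /F2 E; apply: H1 => //; apply: E; apply: H2.
Qed.

Lemma moveC_correct r s t st T X : r < 3 -> s < 2 -> legal_table t -> tables st -> placed X ->
  traced st T X ->
  traced (ev (moveC r s t) st) T.+1 (fun x => block_move ml ms r s (fun A => ar st FLAG A != 0) t (X x)).
Proof.
move=> Hr Hs Ht Htab HX [[tr [tr0 trT trS trO]] Hcnt Hpos].
pose F A := ar st FLAG A != 0; rewrite -/F; set f := block_move ml ms r s F t.
have Hf : legal ml ms f by apply: block_move_legal.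
have Ht6 : size t = 6 by case/andP: Ht => /eqP.
pose Q i s0 := [/\ vr s0 vcnt = 1 + T.+1 * n + i,
   forall x, x < n -> ar s0 POS x = if x < i then f (X x) else X x,
   forall q, q < 1 + T.+1 * n -> ar s0 OUT q = ar st OUT q
   & forall x, x < i -> ar s0 OUT (1 + T.+1 * n + x) = f (X x)].
rewrite /moveC; set body := CSeq _ _.
have [||s0 [Q1 Q2 Q3 Q4] ->] := @for_frame S par Q vx (BP 2) body st.
- by split; rewrite ?addn0.
- move=> i s0 Hi Fa _ [Q1 Q2 Q3 Q4]; rewrite -[bval _ _]/n in Hi.
  have Hpi : ar s0 POS i = X i by rewrite Q2 // ltnn.
  pose s1 := setv vv (X i) (setv vx i s0).
  have Em : eval s1 (moveE r s t) = f (X i).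
    rewrite (@eval_moveE s1 (X i)) //.
    + by apply: eq_block_move => [|A HA]; [exact: HX.2|rewrite /F /= Fa].
    + by move=> u Hu; rewrite /s1 /= !Fa //; apply: Htab.
    + exact: HX.2.
  have -> : ev body (setv vx i s0) = ev emit (seta POS i (f (X i)) s1).
    rewrite -Em -[LHS]/(ev emit (seta POS i (eval (setv vv (ar s0 POS i) (setv vx i s0)) (moveE r s t)) 
      (setv vv (ar s0 POS i) (setv vx i s0)))) Hpi //.
  split.
  + by rewrite /= /upd /= Q1; lia.
  + move=> x Hx; rewrite /= /upd; case: (x =P i) => [->|Nx]; first by rewrite ltnSn.
    by rewrite Q2 // ltnS; case: ltngtP Nx.
  + move=> q Hq; rewrite /= /upd /= Q1 ifN ?Q3 //; lia.
  + move=> x Hx; rewrite /= /upd /= Q1 eqxx; case: (x =P i) => [->|Nx]; first by rewrite eqxx.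
    rewrite ifN ?Q4 //; lia.
rewrite -[bval _ _]/n in Q1 Q2 Q3 Q4 *; split.
- exists (fun k x => if k == T.+1 then f (X x) else tr k x); split.
  + by move=> x Hx; rewrite /= tr0.
  + by move=> x Hx; rewrite eqxx.
  + move=> k; rewrite ltnS leq_eqVlt => /orP[/eqP ->|Hk].
      by exists f => // x Hx; rewrite eqxx ifN ?trT //; lia.
    have [g G1 G2] := trS _ Hk; exists g => // x Hx.
    by rewrite !ifN ?G2 //; lia.
  + move=> k x Hk Hx /=; case: eqP => [->|Nk]; first exact: Q4.
    rewrite Q3 ?trO //; first by lia.
    have : k.+1 * n <= T.+1 * n by rewrite leq_mul2r; lia.
    by rewrite mulSn; lia.
- by rewrite /= /upd /= Q1 [in RHS]mulSn; lia.
- by move=> x Hx; rewrite /= Q2 // Hx.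
Qed.

End Moves.

(** * Sorting all rows or all columns *)

Section Phases.
Variables ml ms S bit : nat.
Hypotheses (Hml : 3 <= ml) (Hms : 2 <= ms) (Hlm : ms <= ml).
Local Notation n := (ml * ms).
Local Notation par := (params ml ms bit).
Local Notation ev := (ev S par).
Local Notation cell_off := (cell_off ms).
Local Notation tables := (tables ml ms).
Local Notation placed := (placed ml ms).
Variable X0 : nat -> nat.
Local Notation traced := (traced ml ms X0).

Definition keeps (l : seq nat) c := all (fun k => ~~ writes k c) l.

Lemma tables_ext st st' : (forall k, k \in [:: ROW; COL; M3; M2; UB] -> ar st' k = ar st k) ->
  tables st -> tables st'.
Proof. by move=> E H v Hv; rewrite !E //; apply: H. Qed.

Lemma tables_frame c st : keeps [:: ROW; COL; M3; M2; UB] c -> tables st -> tables (ev c st).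
Proof. by move=> /allP H; apply: tables_ext => k /H Hk; rewrite frame_a. Qed.

Lemma traced_ext st st' T X X' : ar st' OUT = ar st OUT -> ar st' POS = ar st POS ->
  vr st' vcnt = vr st vcnt -> (forall x, x < n -> X x = X' x) ->
  traced st T X -> traced st' T X'.
Proof.
move=> E1 E2 E3 EX [[tr [H1 H2 H3 H4]] H5 H6]; split; rewrite ?E3 //.
  by exists tr; split => // [x Hx|k x]; [rewrite -EX // H2 | rewrite E1; apply: H4].
by move=> x Hx; rewrite E2 H6 // EX.
Qed.

Lemma traced_frame c st T X : keeps [:: OUT; POS] c -> ~~ assigns vcnt c ->
  traced st T X -> traced (ev c st) T X.
Proof.
move=> /and3P[H1 H2 _] H3; apply: traced_ext => //; by rewrite ?frame_a ?frame_v.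
Qed.

Lemma scatterC_correct st X : (forall x, x < n -> ar st POS x = X x) -> placed X ->
  forall x, x < n -> ar (ev scatterC st) KV (X x) = ar st KEY x.
Proof.
move=> HP [HI HX]; rewrite /scatterC; set body := CPut _ _ _.
have [||s0 Q ->] := @for_frame S par (fun i s => forall x, x < i -> ar s KV (X x) = ar st KEY x) vx (BP 2) body st.
- by [].
- move=> i s Hi Fa _ IH x Hx; rewrite -[bval _ _]/n in Hi.
  rewrite /= /upd /= (Fa POS) // (Fa KEY) // HP //; case: eqP => [|Nx].
    by move=> /HI -> //; lia.
  by apply: IH; have : x <> i by [move=> E; apply: Nx; rewrite E]; lia.
- by move=> x Hx; rewrite /= Q.
Qed.

Lemma flagC_correct p q st v : v < n ->
  ar (ev (flagC p q) st) FLAG v = ar st KV (v + cell_off p) - ar st KV (v + cell_off q).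
Proof.
move=> Hv; rewrite /flagC; set body := CPut _ _ _.
have [||s0 Q ->] := @for_frame S par (fun i s => forall x, x < i -> ar s FLAG x = 
   ar st KV (x + cell_off p) - ar st KV (x + cell_off q)) vx (BP 2) body st.
- by [].
- move=> i s Hi Fa _ IH x Hx; rewrite /= !eval_offE /upd /= (Fa KV) //; case: (x =P i) => [->//|Nx].
  by apply: IH; lia.
- by rewrite /= Q.
Qed.

Definition movesC r s (w : seq (seq nat)) := foldr (fun t c => CSeq (moveC r s t) c) CSkip w.

Lemma table_comp_ok t u : size u = 6 -> all (fun c => c < 6) u -> legal_table t ->
  size (table_comp u t) = 6 /\ all (fun c => c < 6) (table_comp u t).
Proof.
move=> Hu Ha /and3P[/eqP Ht Hat _]; split; first by rewrite size_map.
rewrite all_map; apply/allP => c Hc /=; move/all_nthP: Hat; apply.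
by rewrite Ht; apply: (allP Ha).
Qed.

(** The flags are computed once, before the word. The accumulator [u] expresses every intermediate
    configuration by one table applied to the configuration at the start, so in the end only the
    product of the word matters. *)
Lemma movesC_correct r s w u st T X F : r < 3 -> s < 2 -> all legal_table w ->
  size u = 6 -> all (fun c => c < 6) u ->
  tables st -> placed X -> (forall A, A < n -> F A = (ar st FLAG A != 0)) ->
  placed (fun x => block_move ml ms r s F u (X x)) ->
  traced st T (fun x => block_move ml ms r s F u (X x)) ->
  [/\ tables (ev (movesC r s w) st),
     placed (fun x => block_move ml ms r s F (foldl table_comp u w) (X x)) &
     traced (ev (movesC r s w) st) (T + size w) (fun x => block_move ml ms r s F (foldl table_comp u w) (X x))].
Proof.
move=> Hr Hs; elim: w u st T => [|t w IH] u st T; first by rewrite addn0.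
move=> /andP[Ht Hw] Hu Hau Htab HX HF HP HT.
rewrite -[ev _ _]/(ev (movesC r s w) (ev (moveC r s t) st)) -[foldl _ _ _]/(foldl table_comp (table_comp u t) w).
rewrite -[size _]/(size w).+1.
have Ep x : block_move ml ms r s F t (block_move ml ms r s F u (X x)) = block_move ml ms r s F (table_comp u t) (X x).
  by rewrite block_move_comp.
have HT' := moveC_correct S bit Hml Hms Hr Hs Ht Htab HP HT.
have [H1 H2] := table_comp_ok Hu Hau Ht.
have EF v : v < n -> block_move ml ms r s F t v = block_move ml ms r s (fun A => ar st FLAG A != 0) t v.
  by move=> Hv; apply: eq_block_move.
rewrite addnS -addSn; apply: IH => //.
- exact: tables_frame.
- by move=> A HA; rewrite HF // frame_a.
- have [E1 E2] := placed_comp HP (block_move_legal Hml Hms F Hr Hs Ht).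
  split; first by move=> x y Hx Hy; rewrite -!Ep; apply: E1.
  by move=> x Hx; rewrite -Ep; apply: E2.
- apply: traced_ext HT' => // x Hx.
  by rewrite -EF ?Ep //; apply: HP.2.
Qed.

Lemma macroC_correct d p q w r s st T X : kind_ok d (p, q, w) -> r < 3 -> s < 2 ->
  tables st -> placed X -> traced st T X ->
  exists2 kv : nat -> nat, (forall x, x < n -> kv (X x) = ar st KEY x) &
   [/\ tables (ev (macroC (p, q, w) r s) st),
      placed (fun x => compare_swap ml ms r s p q kv (X x)) &
      traced (ev (macroC (p, q, w) r s) st) (T + size w) (fun x => compare_swap ml ms r s p q kv (X x))].
Proof.
move=> /and5P[_ _ _ _ /andP[Hw /eqP Esw]] Hr Hs Htab HX HT.
pose s1 := ev scatterC st; pose s2 := ev (flagC p q) s1.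
have HK : forall x, x < n -> ar s1 KV (X x) = ar st KEY x.
  by apply: scatterC_correct => //; case: HT.
exists (ar s1 KV) => //.
pose F := flag ms p q (ar s1 KV).
have HF A : A < n -> F A = (ar s2 FLAG A != 0) by move=> HA; rewrite /s2 flagC_correct.
have Ht1 : tables s1 by apply: tables_frame.
have Ht2 : tables s2 by apply: tables_frame.
have T2 : traced s2 T X by apply: traced_frame => //; apply: traced_frame.
have := @movesC_correct r s w (iota 0 6) s2 T X F Hr Hs Hw erefl isT Ht2 HX HF.
rewrite Esw; apply.
- by split; [move=> x y Hx Hy; rewrite !block_move_id //; apply: HX.1 | move=> x Hx; rewrite block_move_id //; apply: HX.2].
- by apply: traced_ext T2 => // x Hx; rewrite block_move_id.
Qed.

(** With [d] true the lines are the columns, otherwise the rows; [l] numbers the line and [i] the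
    place on it. *)
Definition pt (d : bool) l i := if d then i * ms + l else l * ms + i.
Definition lcoord (d : bool) v := if d then v %% ms else v %/ ms.
Definition pcoord (d : bool) v := if d then v %/ ms else v %% ms.
Definition llen (d : bool) := if d then ml else ms.
Definition lnum (d : bool) := if d then ms else ml.
Definition actd (d : bool) r s p l i := if d then act ml ms r s p i l else act ml ms r s p l i.

Lemma pt_lt d l i : l < lnum d -> i < llen d -> pt d l i < n.
Proof. by case: d => /= Hl Hi; apply: vtx_lt. Qed.

Lemma pt_coord d v : v = pt d (lcoord d v) (pcoord d v).
Proof. by case: d => /=; rewrite -divn_eq. Qed.

Lemma lcoord_pt d l i : l < lnum d -> i < llen d -> lcoord d (pt d l i) = l.
Proof. by case: d => /= Hl Hi; rewrite ?(divE Hml Hms) ?modE. Qed.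

Lemma pcoord_pt d l i : l < lnum d -> i < llen d -> pcoord d (pt d l i) = i.
Proof. by case: d => /= Hl Hi; rewrite ?(divE Hml Hms) ?modE. Qed.

Lemma lcoord_lt d v : v < n -> lcoord d v < lnum d.
Proof. by case: d => Hv /=; [apply: vtx_col Hml Hms _ | apply: vtx_row]. Qed.

Lemma pcoord_lt d v : v < n -> pcoord d v < llen d.
Proof. by case: d => Hv /=; [apply: vtx_row | apply: vtx_col Hml Hms _]. Qed.

Lemma eq_sorting L t D k k' : (forall i, i < L -> k i = k' i) -> sorting L t D k -> sorting L t D k'.
Proof.
move=> E H th; have [H1 H2] := H th.
have Ec x : x <= L -> cntge th k' x = cntge th k x.
  by move=> Hx; apply: eq_cntge => i Hi; rewrite E //; lia.
by split=> [|x Hx]; rewrite Ec //; apply: H2.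
Qed.

Lemma sub_sorting L t (D D' : nat -> Prop) k : (forall i, D' i -> D i) ->
  sorting L t D k -> sorting L t D' k.
Proof.
move=> HD H th; have [H1 H2] := H th; split=> // x Hx; have [B1 B2] := H2 _ Hx.
by split=> // x0 /HD; apply: B2.
Qed.

Section Phase.
Variables (d : bool) (key Xs : nat -> nat).

(** No robot leaves its line, and [kv] is the key field by vertex, whose restriction to each line is
    subject to the abstract sorting bound. *)
Definition phase_inv st T t (D : nat -> nat -> Prop) :=
  [/\ tables st, ar st KEY = key & exists2 X,
   [/\ placed X, traced st T X & forall x, x < n -> lcoord d (X x) = lcoord d (Xs x)] &
   exists2 kv : nat -> nat, forall x, x < n -> kv (X x) = key x &
     forall l, l < lnum d -> sorting (llen d) t (D l) (fun i => kv (pt d l i))].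

Lemma macroC_phase p q w r s st T t D : kind_ok d (p, q, w) -> r < 3 -> s < 2 ->
  phase_inv st T t D ->
  phase_inv (ev (macroC (p, q, w) r s) st) (T + size w) t (fun l i => D l i \/ actd d r s p l i).
Proof.
move=> Hk Hr Hs [Htab HK [X [HX HT HL] [kv Hkv Hsort]]].
have [kv' Hkv' [Ht' HX' HT']] := macroC_correct Hk Hr Hs Htab HX HT.
(* Every vertex is occupied, so two fields with the same keys at the robots agree everywhere. *)
have Ekv v : v < n -> kv v = kv' v.
  by move=> Hv; have [x Hx <-] := inj_on_surj HX.1 HX.2 Hv; rewrite Hkv // Hkv' // HK.
have [Hpq Hq Eq He] : [/\ p < q, q < 6, q = (if d then p + 2 else p + 1) & d || (p %% 2 == 0)].
  by case/and5P: Hk => H1 H2 /eqP H3 H4 _.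
have Hp : p < 6 by lia.
split=> //.
- by rewrite frame_a //= ; elim: (w).
- exists (fun x => compare_swap ml ms r s p q kv' (X x)).
    split=> // x Hx; rewrite -HL //; case: d Eq He => /= Eq He.
      by rewrite compare_swap_col //; lia.
    by rewrite compare_swap_row //; lia.
  exists (fun v => kv' (compare_swap ml ms r s p q kv' v)).
    by move=> x Hx; rewrite compare_swapK // Hkv' // HK.
  move=> l Hl; apply: (sorting_step (k := fun i => kv' (pt d l i))).
    by case: d Eq He Hl => /= Eq He Hl; [apply: line_step_col | apply: line_step_row => //; apply/eqP].
  apply: eq_sorting (Hsort _ Hl) => i Hi; apply: Ekv.
  exact: pt_lt.
Qed.

Lemma classesC_phase (cs : seq (kind * nat * nat)) st T t D :
  all (fun c => [&& kind_ok d c.1.1, c.1.2 < 3 & c.2 < 2]) cs ->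
  phase_inv st T t D ->
  phase_inv (ev (foldr (fun c e => CSeq (macroC c.1.1 c.1.2 c.2) e) CSkip cs) st)
    (T + sumn [seq size c.1.1.2 | c <- cs]) t
    (fun l i => D l i \/ exists2 c, c \in cs & actd d c.1.2 c.2 c.1.1.1.1 l i).
Proof.
elim: cs st T D => [|[[[[p q] w] r] s] cs IH] st T D /=.
  move=> _ [H1 H2 [X HX [kv Hkv Hs]]]; rewrite addn0; split=> //.
  exists X => //; exists kv => // l Hl; apply: sub_sorting (Hs l Hl) => i [] // [c].
  by rewrite in_nil.
move=> /andP[/and3P[Hk Hr Hs] Hcs] HI.
have := IH _ _ _ Hcs (macroC_phase Hk Hr Hs HI); rewrite addnA.
move=> [H1 H2 [X HX [kv Hkv Hsort]]]; split=> //.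
exists X => //; exists kv => // l Hl; apply: sub_sorting (Hsort l Hl) => i [HD|[c]].
  by left; left.
rewrite inE => /orP[/eqP ->|Hc] Ha; first by left; right.
by right; exists c.
Qed.

Lemma classes_ok : all (fun c => [&& kind_ok d c.1.1, c.1.2 < 3 & c.2 < 2]) (classes d).
Proof.
apply/allP => c /allpairsP[[kr s] [/allpairsP[[k r] [/= Hk Hr ->]] Hs ->]] /=.
rewrite (allP (kinds_ok d)) //; move: Hr Hs; rewrite /= !inE; lia.
Qed.

Lemma classes_cover l i : l < lnum d -> i.+1 < llen d ->
  exists2 c, c \in classes d & actd d c.1.2 c.2 c.1.1.1.1 l i.
Proof.
have mem k r s : k \in kinds d -> r < 3 -> s < 2 -> (k, r, s) \in classes d.
  by move=> Hk Hr Hs; apply: allpairs_f; [apply: allpairs_f|]; rewrite ?mem_iota.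
move: mem; rewrite /actd; case: d => /= mem Hl Hi.
  have [r [s [p [Hr Hs Hp Ha]]]] := cover_col Hml Hms Hi Hl.
  exists (nth (0, 0, [::]) (kinds true) p, r, s).
    by apply: mem => //; apply: mem_nth.
  by case: p Hp Ha => [|[|[|[|p]]]].
have [r [s [a [Hr Hs Hp Ha]]]] := cover_row Hml Hms Hl Hi.
exists (nth (0, 0, [::]) (kinds false) a, r, s).
  by apply: mem => //; apply: mem_nth.
by case: a Hp Ha => [|[|[|a]]].
Qed.

Lemma roundC_phase st T t :
  phase_inv st T t (fun _ _ => False) ->
  phase_inv (ev (roundC d) st) (T + round_len d) t.+1 (fun _ _ => False).
Proof.
move=> /(classesC_phase classes_ok)[H1 H2 [X HX [kv Hkv Hs]]]; split=> //.
exists X => //; exists kv => // l Hl; apply: sorting_round (Hs l Hl) => i Hi.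
by right; apply: classes_cover.
Qed.

Lemma phase_inv_setv y v st T t D : y != vcnt -> phase_inv st T t D -> phase_inv (setv y v st) T t D.
Proof.
move=> Hy [H1 H2 [X [P1 P2 P3] HX]]; split=> //.
exists X => //; split=> //; apply: traced_ext P2 => //=.
by rewrite /upd eq_sym (negbTE Hy).
Qed.

Lemma phaseC_inv st T : phase_inv st T 0 (fun _ _ => False) ->
  phase_inv (ev (phaseC d) st) (T + ml * round_len d) ml (fun _ _ => False).
Proof.
move=> H0; rewrite /phaseC.
have [||s Hs ->] := @for_ind S par (fun i s => phase_inv s (T + i * round_len d) i (fun _ _ => False)) vt (BP 0) (roundC d) st.
- by rewrite addn0.
- by move=> i s Hi Hs; rewrite mulSnr addnA; apply: roundC_phase; apply: phase_inv_setv.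
- exact: phase_inv_setv.
Qed.

End Phase.

(** A line has as many robots as places, so keys that are distinct on it and below its length form a
    permutation of the places; sorting then brings each robot to the place named by its key. *)
Lemma phaseC_correct d st T X : tables st -> placed X -> traced st T X ->
  (forall x, x < n -> ar st KEY x < llen d) ->
  (forall x y, x < n -> y < n -> lcoord d (X x) = lcoord d (X y) ->
     ar st KEY x = ar st KEY y -> x = y) ->
  exists2 X', forall x, x < n -> lcoord d (X' x) = lcoord d (X x) /\ pcoord d (X' x) = ar st KEY x &
  [/\ tables (ev (phaseC d) st), placed X' & traced (ev (phaseC d) st) (T + ml * round_len d) X'].
Proof.
move=> Htab HX HT Kl Ki.
(* [index] inverts the placement: it finds the robot standing at [v]. *)
pose kv v := ar st KEY (index v [seq X x | x <- iota 0 n]).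
have sz : size [seq X x | x <- iota 0 n] = n by rewrite size_map size_iota.
have Hkv x : x < n -> kv (X x) = ar st KEY x.
  move=> Hx; rewrite /kv; congr ar.
  have -> : X x = nth 0 [seq X x | x <- iota 0 n] x by rewrite (nth_map 0) ?size_iota // nth_iota.
  rewrite index_uniq ?sz // map_inj_in_uniq ?iota_uniq // => a b; rewrite !mem_iota => Ha Hb.
  by apply: HX.1; lia.
have H0 : phase_inv d (ar st KEY) X st T 0 (fun _ _ => False).
  split=> //; exists X => //; exists kv => // l Hl; apply: sorting_start.
    move=> i j Hi Hj.
    have [x Hx Ex] := inj_on_surj HX.1 HX.2 (pt_lt Hl Hi).
    have [y Hy Ey] := inj_on_surj HX.1 HX.2 (pt_lt Hl Hj).
    rewrite -Ex -Ey !Hkv // => /Ki E.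
    by rewrite -(pcoord_pt Hl Hi) -(pcoord_pt Hl Hj) -Ex -Ey E // Ex Ey !lcoord_pt.
  move=> i Hi; have [x Hx Ex] := inj_on_surj HX.1 HX.2 (pt_lt Hl Hi).
  by rewrite -Ex Hkv // Kl.
have [H1 _ [X' [P1 P2 P3] [kv' Hkv' Hs]]] := phaseC_inv H0.
exists X' => // x Hx; split; first exact: P3.
have HXxE := P1.2 _ Hx.
have Hl := lcoord_lt d HXxE; have Hp := pcoord_lt d HXxE.
rewrite -Hkv' //.
have HLm : llen d <= ml by rewrite /llen; case: (d).
by have := sorting_done HLm (Hs _ Hl) Hp; rewrite -pt_coord.
Qed.

End Phases.

(** * The three routing phases *)

Section Routing.
Variables ml ms S bit : nat.
Hypotheses (Hml : 3 <= ml) (Hms : 2 <= ms) (Hlm : ms <= ml).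
Local Notation n := (ml * ms).
Local Notation par := (params ml ms bit).
Local Notation ev := (ev S par).
Local Notation eval := (eval S par).
Local Notation tables := (tables ml ms).
Local Notation placed := (placed ml ms).
Variables XI XG : nat -> nat.
Hypotheses (PI : placed XI) (PG : placed XG).
Local Notation traced := (traced ml ms XI).

Definition input_at st := forall x, x < n ->
  ar st IN (2 + x) = XI x /\ ar st IN (2 + (n + x)) = XG x.

Lemma keyC_correct e st g :
  (forall s x, x < n -> (forall k, k != KEY -> ar s k = ar st k) -> eval (setv vx x s) e = g x) ->
  forall x, x < n -> ar (ev (keyC e) st) KEY x = g x.
Proof.
move=> He; rewrite /keyC; set body := CPut _ _ _.
have [||s0 Q ->] := @for_frame S par (fun i s => forall x, x < i -> ar s KEY x = g x) vx (BP 2) body st.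
- by [].
- move=> i s Hi Fa _ IH x Hx; rewrite -[ev _ _]/(seta KEY i (eval (setv vx i s) e) (setv vx i s)).
  rewrite He //.
  rewrite /= /upd; case: (x =P i) => [->//|Nx].
  by apply: IH; lia.
- by move=> x Hx; rewrite /= Q.
Qed.

Lemma startC_correct st : input_at st ->
  traced (ev (CFor vx (BP 2) (CSeq (CPut POS xE startE) emit)) (ev (CSet vcnt (EC 1)) st)) 0 XI.
Proof.
move=> HI; set body := CSeq _ _.
pose Q i s := [/\ vr s vcnt = 1 + i, forall x, x < i -> ar s POS x = XI x
  & forall x, x < i -> ar s OUT (1 + x) = XI x].
have [||s0 [Q1 Q2 Q3] ->] := @for_frame S par Q vx (BP 2) body (ev (CSet vcnt (EC 1)) st).
- by [].
- move=> i s Hi Fa _ [Q1 Q2 Q3]; rewrite -[bval _ _]/n in Hi.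
  have Es : ar s IN (2 + i) = XI i by rewrite Fa //; case: (HI i Hi).
  split.
  + by rewrite /= /upd /= Q1; lia.
  + move=> x Hx; rewrite /= /upd /= Es; case: (x =P i) => [->//|Nx]; apply: Q2; lia.
  + move=> x Hx; rewrite /= /upd /= Q1 eqxx Es; case: (x =P i) => [->|Nx].
      by rewrite eqxx.
    rewrite ifN ?Q3 //; lia.
rewrite -[bval _ _]/n in Q1 Q2 Q3 *; split.
- exists (fun _ => XI); split=> // k x; case: k => // _ Hx.
  by rewrite mul0n addn0 /= Q3.
- by rewrite /= /upd /= Q1 mul1n.
- by move=> x Hx; rewrite /= Q2.
Qed.

(** Distinct colours within a start column make the first phase a sort. It puts robots of one colour
    into one row, where the goal columns are distinct, which makes the second phase a sort. In the
    third, robots of one goal column have distinct goal rows because [XG] is injective. *)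
Lemma routeC_correct st : tables st -> input_at st ->
  (forall x, x < n -> ar st CLR x < ml) ->
  (forall x y, x < n -> y < n -> ar st CLR x = ar st CLR y ->
     XI x %% ms = XI y %% ms \/ XG x %% ms = XG y %% ms -> x = y) ->
  traced (ev routeC st) (ml * rate) XG.
Proof.
move=> Ht HI Hc Hcol.
rewrite /routeC -[ev _ _]/(ev (phaseC true) (ev (keyC (EA ROW goalE)) (ev (phaseC false)
  (ev (keyC (EA COL goalE)) (ev (phaseC true) (ev (keyC (EA CLR xE))
  (ev (CFor vx (BP 2) (CSeq (CPut POS xE startE) emit)) (ev (CSet vcnt (EC 1)) st)))))))).
set s0 := ev (CFor _ _ _) _.
have T0 : traced s0 0 XI by apply: startC_correct.
have Ht0 : tables s0 by apply: tables_frame.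
have Fin (k : nat) : k \in [:: IN; CLR; COL; ROW] -> ar s0 k = ar st k.
  by move=> Hk; rewrite /s0 frame_a //; move: Hk; rewrite !inE; do !case/orP => [/eqP -> //|]; move/eqP ->.
have goal_ok s : (forall k : nat, k != KEY -> k != FLAG -> k != KV -> k != POS -> k != OUT -> ar s k = ar s0 k) ->
   forall x, x < n -> ar s IN (2 + (n + x)) = XG x.
  by move=> Hs x Hx; rewrite Hs // Fin //; case: (HI x Hx).
have gl x : x < n -> XG x < n by apply: PG.2.
set s1 := ev (keyC _) s0.
have K1 x : x < n -> ar s1 KEY x = ar st CLR x.
  move: x; apply: keyC_correct => s x Hx Hs /=.
  by rewrite /upd /= Hs // Fin.
have T1 : traced s1 0 XI by apply: traced_frame.
have Ht1 : tables s1 by apply: tables_frame.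
have [||X1 E1 [Ht2 P2 T2]] := phaseC_correct (d := true) S bit Hml Hms Hlm Ht1 PI T1.
- by move=> x Hx; rewrite K1 // Hc.
- move=> x y Hx Hy E; rewrite !K1 // => Ec; apply: Hcol => //; by left.
set s2 := ev (phaseC true) s1 in Ht2 T2 *.
set s3 := ev (keyC _) s2.
have A2 (k : nat) : k != KEY -> k != FLAG -> k != KV -> k != POS -> k != OUT -> ar s2 k = ar s0 k.
  move=> H1 H2 H3 H4 H5.
  have X : writes k (phaseC true) = [|| k == KV, k == FLAG, k == POS | k == OUT].
    by rewrite /=; case: (k == KV); case: (k == FLAG); case: (k == POS); case: (k == OUT).
  rewrite /s2 frame_a; last by rewrite X (negbTE H2) (negbTE H3) (negbTE H4) (negbTE H5).
  by rewrite frame_a //.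
have K3 x : x < n -> ar s3 KEY x = XG x %% ms.
  move: x; apply: keyC_correct => s x Hx Hs.
  rewrite -[LHS]/(ar s COL (ar s IN (2 + (n + x)))) goal_ok //.
    by rewrite Hs //; have [_ -> _ _ _] := Ht2 (XG x) (ltnW (gl _ Hx)).
  by move=> k H1 H2 H3 H4 H5; rewrite Hs // A2.
have T3 : traced s3 (0 + ml * round_len true) X1 by apply: traced_frame.
have Ht3 : tables s3 by apply: tables_frame.
have [||X2 E2 [Ht4 P4 T4]] := phaseC_correct (d := false) S bit Hml Hms Hlm Ht3 P2 T3.
- by move=> x Hx; rewrite K3 //; apply: vtx_col Hml Hms _.
- move=> x y Hx Hy; rewrite !K3 //= => E EG.
  have [_ /= Ex] := E1 x Hx; have [_ /= Ey] := E1 y Hy.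
  by apply: Hcol => //; [rewrite -K1 // -K1 // -Ex -Ey | right].
set s4 := ev (phaseC false) s3 in Ht4 T4 *.
set s5 := ev (keyC _) s4.
have A4 (k : nat) : k != KEY -> k != FLAG -> k != KV -> k != POS -> k != OUT -> ar s4 k = ar s0 k.
  move=> H1 H2 H3 H4 H5.
  have X : writes k (phaseC false) = [|| k == KV, k == FLAG, k == POS | k == OUT].
    by rewrite /=; case: (k == KV); case: (k == FLAG); case: (k == POS); case: (k == OUT).
  rewrite /s4 frame_a; last by rewrite X (negbTE H2) (negbTE H3) (negbTE H4) (negbTE H5).
  by rewrite frame_a // A2 //.
have K5 x : x < n -> ar s5 KEY x = XG x %/ ms.
  move: x; apply: keyC_correct => s x Hx Hs.
  rewrite -[LHS]/(ar s ROW (ar s IN (2 + (n + x)))) goal_ok //.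
    by rewrite Hs //; have [-> _ _ _ _] := Ht4 (XG x) (ltnW (gl _ Hx)).
  by move=> k H1 H2 H3 H4 H5; rewrite Hs // A4.
have T5 : traced s5 (0 + ml * round_len true + ml * round_len false) X2 by apply: traced_frame.
have Ht5 : tables s5 by apply: tables_frame.
have C2 x : x < n -> X2 x %% ms = XG x %% ms.
  by move=> Hx; have [_ /= ->] := E2 x Hx; rewrite K3.
have [||X3 E3 [Ht6 P6 T6]] := phaseC_correct (d := true) S bit Hml Hms Hlm Ht5 P4 T5.
- by move=> x Hx; rewrite K5 // vtx_row // gl.
- move=> x y Hx Hy; rewrite /= !C2 // !K5 // => Ec Er; apply: PG.1 => //.
  by rewrite (divn_eq (XG x) ms) (divn_eq (XG y) ms) Ec Er.
have -> : ml * rate = 0 + ml * round_len true + ml * round_len false + ml * round_len true.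
  by rewrite /rate !mulnDr; lia.
apply: traced_ext T6 => // x Hx; have [/= Ec Er] := E3 x Hx.
by rewrite (divn_eq (X3 x) ms) (divn_eq (XG x) ms) Ec Er C2 // K5.
Qed.

End Routing.

(** * Tables of quotients, remainders and multiples *)

Section Tables.
Variables ml ms S bit : nat.
Hypotheses (Hml : 3 <= ml) (Hms : 2 <= ms) (Hlm : ms <= ml).
Local Notation par := (params ml ms bit).
Local Notation ev := (ev S par).
Local Notation tables := (tables ml ms).

Lemma tablesC_correct st : (forall k, k \in [:: ROW; COL; M3; M2; UB] -> ar st k 0 = 0) ->
  tables (ev tablesC st).
Proof.
move=> H0; rewrite /tablesC; set body := CSeq _ _.
pose Q i s := forall v, v <= i -> [/\ ar s ROW v = v %/ ms, ar s COL v = v %% ms, ar s M3 v = v %% 3,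
      ar s M2 v = v %% 2 & ar s UB v = v * ml].
have [||s0 Q0 ->] := @for_frame S par Q vx (BP 2) body st.
- by move=> [|v] // _; rewrite !H0 // div0n !mod0n.
- move=> i s Hi _ _ HQ.
  have [q1 q2 q3 q4 q5] := HQ i (leqnn _).
  set s1 := setv vx i s.
  have step1 : let s2 := ev (CIf (ESub (EP 1) (EAdd (EA COL xE) (EC 1)))
     (CSeq (CPut COL succx (EAdd (EA COL xE) (EC 1))) (CPut ROW succx (EA ROW xE)))
     (CSeq (CPut COL succx (EC 0)) (CPut ROW succx (EAdd (EA ROW xE) (EC 1))))) s1 in
     (forall v, ar s2 ROW v = if v == i.+1 then i.+1 %/ ms else ar s ROW v) /\
     (forall v, ar s2 COL v = if v == i.+1 then i.+1 %% ms else ar s COL v).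
    rewrite /= /params /= /upd /= q2 q1.
    have Ed := divn_eq i ms; have Hm := vtx_col Hml Hms i.
    case: eqP => E /=; rewrite /upd addn1.
      have -> : i.+1 = (i %/ ms).+1 * ms + 0 by lia.
      rewrite (divE Hml Hms) ?modE; try lia.
      by rewrite addn1; split => v; case: eqP.
    have -> : i.+1 = (i %/ ms) * ms + (i %% ms + 1) by lia.
    rewrite (divE Hml Hms) ?modE; try lia.
    by split => v; case: eqP.
  move=> v Hv.
  move: step1; set s2 := ev (CIf _ _ _) s1 => -[E1 E2].
  have F (k : nat) : k \notin [:: ROW; COL] -> ar s2 k = ar s k.
    by rewrite !inE negb_or => /andP[/negbTE k1 /negbTE k2]; rewrite frame_a //= k1 k2.
  have Fx : vr s2 vx = i by rewrite frame_v.
  rewrite -[ev _ _]/(ev (CPut UB succx (EAdd (EA UB xE) (EP 0))) (ev (CPut M2 succx (EIf (EA M2 xE) (EC 0) (EC 1)))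
     (ev (CPut M3 succx (EIf (ESub (EC 2) (EA M3 xE)) (EAdd (EA M3 xE) (EC 1)) (EC 0))) s2))).
  rewrite /= /upd /= Fx E1 E2 !F // q3 q4 q5 /params /= addn1.
  case: (v =P i.+1) => [->|Nv]; last by apply: HQ; lia.
  by split=> //; try (by case: eqP; lia); lia.
- by move=> v Hv; apply: Q0.
Qed.

End Tables.

(** * Executing the edge colouring *)

Section Colouring.
Variables ml ms S bit : nat.
Hypotheses (Hml : 3 <= ml) (Hms : 2 <= ms) (Hlm : ms <= ml).
Local Notation n := (ml * ms).
Local Notation par := (params ml ms bit).
Local Notation ev := (ev S par).
Local Notation eval := (eval S par).
Local Notation tables := (tables ml ms).
Local Notation placed := (placed ml ms).

Definition tab2 (f : nat -> nat) z c := f (z * ml + c).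

Lemma tab2_upd f z c v z' c' : c < ml -> c' < ml ->
  tab2 (upd f (z * ml + c) v) z' c' = upd2 (tab2 f) z c v z' c'.
Proof.
move=> Hc Hc'; rewrite /tab2 /upd2 /upd.
suff -> : (z' * ml + c' == z * ml + c) = (z' == z) && (c' == c) by [].
apply/eqP/andP => [E|[/eqP -> /eqP ->]] //.
have Ez : z' = z by case: (ltngtP z' z) => // Hlt; nia.
by rewrite Ez in E *; split; apply/eqP; lia.
Qed.

Lemma freeC_correct tb z res st zz : z != res -> z != vc -> res != vc ->
  tables st -> vr st z = zz -> zz < ms ->
  (exists2 c, c < ml & tab2 (ar st tb) zz c = 0) ->
  let c := vr (ev (freeC tb z res) st) res in c < ml /\ tab2 (ar st tb) zz c = 0.
Proof.
move=> N1 N2 N3 Ht Ez Hz [c Hc Ec].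
rewrite /freeC; set body := CIf _ _ _.
pose ok v := v < ml /\ tab2 (ar st tb) zz v = 0.
have [||s0 Q ->] := @for_frame S par (fun i s => c < i -> ok (vr s res)) vc (BP 0) body st.
- by [].
- move=> i s Hi Fa Fv IH Hci; rewrite -[bval _ _]/ml in Hi.
  have Hzs : vr s z = zz.
    by rewrite Fv //= negb_or N2.
  have Hu : ar s UB zz = zz * ml.
    rewrite Fa //; have [] := Ht zz => //; have := ms_le_n Hml Hms; lia.
  have Et : ar s tb = ar st tb by apply: Fa.
  rewrite /body /= /upd /= (negbTE N2) Hzs Hu Et -/(tab2 _ zz i).
  case: eqP => [E|N] /=; first by rewrite /upd eqxx.
  rewrite /upd (negbTE N3); apply: IH.
  have : c <> i by move=> E; apply: N; rewrite -E.
  lia.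
- by rewrite /= /upd (negbTE N3); apply: Q.
Qed.

Variables XI XG : nat -> nat.
Hypotheses (PI : placed XI) (PG : placed XG).
Local Notation input_at := (input_at ml ms XI XG).
Let U x := XI x %% ms.
Let W x := XG x %% ms.

Lemma input_ext st st' : ar st' IN = ar st IN -> input_at st -> input_at st'.
Proof. by move=> E H x Hx; rewrite E; apply: H. Qed.

Lemma UB_ok s z : tables s -> z < ms -> ar s UB z = z * ml.
Proof. by move=> Ht Hz; have [] := Ht z => //; have := ms_le_n Hml Hms; lia. Qed.

Lemma COL_ok s v : tables s -> v < n -> ar s COL v = v %% ms.
Proof. by move=> Ht Hv; have [] := Ht v => //; lia. Qed.

(** One run of the code is one step of the abstract chain: it ends at an end column without a
    further [a]-edge, ends at a start column without a [b]-edge, or moves on to the next end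
    column. *)
Lemma chainC_correct m a b s cur g V Y : m <= n -> a < ml -> b < ml -> a <> b ->
  tables s -> input_at s -> vr s va = a -> vr s vb = b -> vr s vcur = cur -> cur < ms ->
  chain ml m U W a b (tab2 (ar s CU)) (tab2 (ar s CW)) (ar s CLR) cur g V Y ->
  let s' := ev chainC s in
  (vr s' valive = 0 /\ coloured ml m U W (tab2 (ar s' CU)) (tab2 (ar s' CW)) (ar s' CLR)) \/
  (vr s' valive = vr s valive /\ vr s' vcur < ms /\ exists h Y', 
    chain ml m U W a b (tab2 (ar s' CU)) (tab2 (ar s' CW)) (ar s' CLR) (vr s' vcur) h (cur :: V) Y').
Proof.
move=> Hm Ha Hb Hab Ht HI Ea Eb Ecur Hcur HC s'.
have Hub := UB_ok Ht Hcur.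
pose E := ar s CW (cur * ml + a).
have Eg : ar s CW (cur * ml + b) = g.+1 by case: (HC) => _ _ [].
pose CW1 := upd (upd (ar s CW) (cur * ml + a) g.+1) (cur * ml + b) E.
have ECW1 z c : c < ml -> tab2 CW1 z c = cw1 a b (tab2 (ar s CW)) cur g z c.
  by move=> Hc; rewrite /CW1 /cw1 tab2_upd // /upd2; case: ifP => // _; rewrite tab2_upd.
case: (posnP E) => [E0|Epos].
  left.
  have -> : s' = setv valive 0 (seta CW (cur * ml + b) E (seta CW (cur * ml + a) g.+1 (setv ve E s))).
    by rewrite /s' /chainC /= /upd /= Ecur Ea Eb Hub -/E E0 Eg.
  split=> //=.
  have [c1 c2 c3] := chain_stop_w HC E0; split=> //.
  exact: table_ext c2.
have [e Ee] : exists e, E = e.+1 by exists E.-1; rewrite prednK.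
have [e1 e2 e3 e4] := edge_e HC Ee.
have en : e < n by lia.
have EU : ar s COL (ar s IN (2 + e)) = U e.
  by have [-> _] := HI e en; rewrite COL_ok //; apply: PI.2.
have HU : U e < ms by apply: vtx_col Hml Hms _.
have Huby := UB_ok Ht HU.
pose G := ar s CU (U e * ml + b).
pose CU1 := upd (upd (ar s CU) (U e * ml + b) e.+1) (U e * ml + a) G.
have ECU1 z c : c < ml -> tab2 CU1 z c = cu1 U a b (tab2 (ar s CU)) e z c.
  by move=> Hc; rewrite /CU1 /cu1 tab2_upd // /upd2; case: ifP => // _; rewrite tab2_upd.
case: (posnP G) => [G0|Gpos].
  left.
  have -> : s' = setv valive 0 (seta CU (U e * ml + a) G (seta CU (U e * ml + b) E (setv vg G (setv vy (U e)
       (seta CLR e b (seta CW (cur * ml + b) E (seta CW (cur * ml + a) g.+1 (setv ve E s)))))))).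
    by rewrite /s' /chainC /= /upd /= Ecur Ea Eb Hub -/E Ee /= subn1 /= EU Huby -/G G0 Eg.
  split=> //=; rewrite Ee.
  have [c1 c2 c3] := chain_stop_u Hb Hab HC Ee G0; split=> //.
  - exact: table_ext c1.
  - by rewrite -Ee; exact: table_ext c2.
have [h Eh] : exists h, G = h.+1 by exists G.-1; rewrite prednK.
have HN := chain_next Ha Hb Hab HC Ee Eh.
have hm : h < m by case: HN => _ _ [].
have hn : h < n by lia.
have EW : ar s COL (ar s IN (2 + (n + h))) = W h.
  by have [_ ->] := HI h hn; rewrite COL_ok //; apply: PG.2.
right.
have -> : s' = setv vcur (W h) (seta CLR h a (seta CU (U e * ml + a) G (seta CU (U e * ml + b) E (setv vg G (setv vy (U e)
       (seta CLR e b (seta CW (cur * ml + b) E (seta CW (cur * ml + a) g.+1 (setv ve E s))))))))).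
  by rewrite /s' /chainC /= /upd /= Ecur Ea Eb Hub -/E Ee /= !subn1 /= EU Huby -/G Eh /= EW Eg.
split=> //=; split; first exact: vtx_col Hml Hms _.
exists h, (U e :: Y); rewrite /upd /= -/upd Ee.
apply: chain_ext HN => //; first by rewrite -Ee.
Qed.

Definition colour_inv i s := [/\ table ml i U (tab2 (ar s CU)) (ar s CLR),
  table ml i W (tab2 (ar s CW)) (ar s CLR) & forall e, e < i -> ar s CLR e < ml].

Lemma insertC_correct i s : i < n -> vr s vx = i -> tables s -> input_at s ->
  colour_inv i s -> colour_inv i.+1 (ev insertC s).
Proof.
move=> Hi Ex Ht HI [HU HW HR].
pose s1 := setv vw (W i) (setv vu (U i) s).
have [s2 D2] : exists s2, s2 = ev (freeC CU vu va) s1 by eexists.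
have [s3 D3] : exists s3, s3 = ev (freeC CW vw vb) s2 by eexists.
have m0 : 0 < ms by lia.
have HUi : U i < ms by apply: vtx_col Hml Hms _.
have HWi : W i < ms by apply: vtx_col Hml Hms _.
have [fa1 fa2] : vr s2 va < ml /\ tab2 (ar s CU) (U i) (vr s2 va) = 0.
  rewrite D2; apply: (@freeC_correct CU vu va s1) => //.
  exact: (free_colour m0 HU PI.1 PI.2 Hi).
have [fb1 fb2] : vr s3 vb < ml /\ tab2 (ar s CW) (W i) (vr s3 vb) = 0.
  have E : ar s2 CW = ar s CW by rewrite D2 frame_a.
  rewrite -E D3; apply: (@freeC_correct CW vw vb s2) => //.
  - by rewrite D2; apply: tables_frame.
  - by rewrite D2 frame_v.
  - rewrite E; exact: (free_colour m0 HW PG.1 PG.2 Hi).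
set a := vr s2 va in fa1 fa2; set b := vr s3 vb in fb1 fb2.
have A3 k : ar s3 k = ar s k by rewrite D3 frame_a // D2 frame_a.
have Va : vr s3 va = a by rewrite D3 frame_v.
have Vx : vr s3 vx = i by rewrite D3 frame_v // D2 frame_v.
have Vu : vr s3 vu = U i by rewrite D3 frame_v // D2 frame_v.
have Vw : vr s3 vw = W i by rewrite D3 frame_v // D2 frame_v.
have [s4 D4] : exists s4, s4 = seta CU (U i * ml + a) i.+1 (seta CLR i a s3) by eexists.
pose c5 := CIf (EA CW (at_ vw va))
    (CSeq (CPut CW (at_ vw vb) succx)
    (CSeq (CSet vcur (EV vw)) (CSeq (CSet valive (EC 1))
      (CFor vc (BP 1) (CIf (EV valive) chainC CSkip)))))
    (CPut CW (at_ vw va) succx).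
have Hub := UB_ok Ht HUi; have Hwb := UB_ok Ht HWi.
have -> : ev insertC s = ev c5 s4.
  have [i1 i2] := HI i Hi.
  have Eu : eval s (EA COL startE) = U i.
    by rewrite -[LHS]/(ar s COL (ar s IN (2 + vr s vx))) Ex i1 COL_ok //; apply: PI.2.
  have Ew : eval (setv vu (U i) s) (EA COL goalE) = W i.
    by rewrite -[LHS]/(ar s COL (ar s IN (2 + (n + vr s vx)))) Ex i2 COL_ok //; apply: PG.2.
  rewrite -[LHS]/(ev c5 (ev (CPut CU (at_ vu va) succx) (ev (CPut CLR xE (EV va)) (ev (freeC CW vw vb) (ev (freeC CU vu va)
     (setv vw (eval (setv vu (eval s (EA COL startE)) s) (EA COL goalE)) (setv vu (eval s (EA COL startE)) s))))))).
  rewrite Eu Ew -/s1 -D2 -D3; congr (ev c5 _).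
  by rewrite D4 /= Va Vx Vu A3 Hub addn1.
have V4 y : vr s4 y = vr s3 y by rewrite D4.
have Aub : ar s4 UB = ar s UB by rewrite D4 /= A3.
have Acu : ar s4 CU = upd (ar s CU) (U i * ml + a) i.+1 by rewrite D4 /= A3.
have Aclr : ar s4 CLR = upd (ar s CLR) i a by rewrite D4 /= A3.
have Acw : ar s4 CW = ar s CW by rewrite D4 /= A3.
have Ht4 : tables s4 by apply: tables_ext Ht => k Hk; rewrite D4 /= !A3; move: Hk; rewrite !inE; do !case/orP => [/eqP -> //|]; move/eqP ->.
have HI4 : input_at s4 by apply: input_ext HI; rewrite D4 /= A3.
have T4 : table ml i.+1 U (tab2 (ar s4 CU)) (ar s4 CLR).
  rewrite Acu Aclr; apply: table_ext (table_add HU fa2 fa1) => z c Hc; exact: tab2_upd.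
have R4 e : e < i.+1 -> ar s4 CLR e < ml.
  by move=> He; rewrite Aclr /upd; case: eqP => // Ne; apply: HR; lia.
have Eat : eval s4 (EA CW (at_ vw va)) = tab2 (ar s CW) (W i) a.
  by rewrite /= !V4 Aub Acw Va Vw Hwb.
rewrite /c5 -[ev _ _]/(if eval s4 (EA CW (at_ vw va)) == 0 then ev (CPut CW (at_ vw va) succx) s4
   else ev (CSeq (CPut CW (at_ vw vb) succx)
    (CSeq (CSet vcur (EV vw)) (CSeq (CSet valive (EC 1))
      (CFor vc (BP 1) (CIf (EV valive) chainC CSkip))))) s4) Eat.
case: eqP => E0.
  have -> : ev (CPut CW (at_ vw va) succx) s4 = seta CW (W i * ml + a) i.+1 s4.
    by rewrite /= !V4 Aub Va Vw Vx Hwb addn1.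
  split=> //; rewrite /= Acw Aclr.
  apply: table_ext (table_add HW E0 fa1) => z c Hc; exact: tab2_upd.
have [Hab HC] := chain_start HU HW HR fa1 fb1 fa2 fb2 E0.
pose s5 := setv valive 1 (setv vcur (W i) (seta CW (W i * ml + b) i.+1 s4)).
have -> : ev (CSeq (CPut CW (at_ vw vb) succx)
    (CSeq (CSet vcur (EV vw)) (CSeq (CSet valive (EC 1))
      (CFor vc (BP 1) (CIf (EV valive) chainC CSkip))))) s4 = ev (CFor vc (BP 1) (CIf (EV valive) chainC CSkip)) s5.
  rewrite -[LHS]/(ev (CFor vc (BP 1) (CIf (EV valive) chainC CSkip)) (setv valive 1 (setv vcur (vr s4 vw) (ev (CPut CW (at_ vw vb) succx) s4)))).
  by rewrite /s5; congr (ev _ (setv _ _ _)); rewrite /= !V4 Aub Vw Vx Hwb addn1.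
(* After [k] rounds the chain has ended or has left [k] distinct end columns behind. *)
pose Q k t := (vr t valive = 0 /\ coloured ml i.+1 U W (tab2 (ar t CU)) (tab2 (ar t CW)) (ar t CLR)) \/
  [/\ vr t valive = 1, vr t vcur < ms & exists g V Y, 
   [/\ chain ml i.+1 U W a b (tab2 (ar t CU)) (tab2 (ar t CW)) (ar t CLR) (vr t vcur) g V Y,
     size V = k, uniq V & all (fun v => v < ms) V]].
have [||t Qt ->] := @for_frame S par Q vc (BP 1) (CIf (EV valive) chainC CSkip) s5.
- right; split=> //=; exists i, [::], [::]; split=> //.
  rewrite Aclr; apply: (chain_ext fa1 fb1 _ _ HC) => z c Hc.
    by rewrite Acu; apply: tab2_upd.
  by rewrite Acw; apply: tab2_upd.
- move=> k t Hk Fa Fv [[Ql Qc]|[Ql Qm [g [V [Y [QC QV QU QA]]]]]].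
    by left; rewrite /= /upd /= Ql.
  have Et : ev (CIf (EV valive) chainC CSkip) (setv vc k t) = ev chainC (setv vc k t).
    by rewrite -[LHS]/(if vr t valive == 0 then setv vc k t else ev chainC (setv vc k t)) Ql.
  rewrite Et.
  have [] // := @chainC_correct i.+1 a b (setv vc k t) (vr t vcur) g V Y.
  + by apply: tables_ext Ht4 => k' Hk'; rewrite /= Fa //; move: Hk'; rewrite !inE; do !case/orP => [/eqP -> //|]; move/eqP ->.
  + by apply: input_ext HI4; rewrite /= Fa.
  + by rewrite /= /upd /= Fv //= /upd /= V4.
  + by rewrite /= /upd /= Fv //= /upd /= V4.
  + by left.
  + move=> [E1 [E2 [h [Y' E3]]]]; right; split=> //; first by rewrite E1.
    exists h, (vr t vcur :: V), Y'; split=> //=; rewrite ?QV ?Qm ?QA ?QU ?andbT //.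
    by case: QC => _ _ _ _ [].
- case: Qt => [[_ [c1 c2 c3]]|[_ Qm [g [V [Y [QC QV QU QA]]]]]]; first by [].
  (* The [ms] visited columns and the current one would be [ms.+1] distinct numbers below [ms]. *)
  exfalso; have un : uniq (vr t vcur :: V) by rewrite /= QU andbT; case: QC => _ _ _ _ [].
  have sub : {subset vr t vcur :: V <= iota 0 ms}.
    by move=> z; rewrite inE mem_iota => /orP[/eqP ->//|/(allP QA)].
  by have := uniq_leq_size un sub; rewrite /= QV size_iota -[bval _ _]/ms ltnn.
Qed.

Lemma colourC_correct st : tables st -> input_at st ->
  (forall k j, k \in [:: CU; CW] -> ar st k j = 0) ->
  (forall x, x < n -> ar (ev colourC st) CLR x < ml) /\
  (forall x y, x < n -> y < n -> ar (ev colourC st) CLR x = ar (ev colourC st) CLR y ->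
     XI x %% ms = XI y %% ms \/ XG x %% ms = XG y %% ms -> x = y).
Proof.
move=> Ht HI H0; rewrite /colourC.
have [||s0 [Q1 Q2 Q3] ->] := @for_frame S par colour_inv vx (BP 2) insertC st.
- by split=> // z c e Hc; rewrite /tab2 H0 //; split=> // -[].
- move=> i s Hi Fa _ HQ; apply: insertC_correct => //.
  + by apply: tables_ext Ht => k' Hk'; rewrite /= Fa //; move: Hk'; rewrite !inE; do !case/orP => [/eqP -> //|]; move/eqP ->.
  + by apply: input_ext HI; rewrite /= Fa.
- split; first exact: Q3.
  move=> x y Hx Hy Ec [E|E].
    by apply: (table_uniq Q1 _ Hx Hy E Ec); apply: Q3.
  by apply: (table_uniq Q2 _ Hx Hy E Ec); apply: Q3.
Qed.

End Colouring.

(** * Input, output and the whole program *)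

Section Program.
Variables ml ms S bit : nat.
Hypotheses (Hml : 3 <= ml) (Hms : 2 <= ms) (Hlm : ms <= ml).
Local Notation n := (ml * ms).
Local Notation par := (params ml ms bit).
Local Notation ev := (ev S par).
Local Notation eval := (eval S par).
Local Notation tables := (tables ml ms).
Local Notation placed := (placed ml ms).

Lemma inputC_correct st (m : nat -> nat) : 64 + 2 * n <= S ->
  (forall j, 4 <= j < 64 -> ar st IN j = m j) -> (forall a, 64 <= a < S -> lo st a = m a) ->
  forall j, 4 <= j < 64 + 2 * n -> ar (ev inputC st) IN j = m j.
Proof.
move=> HS H1 H2.
pose Q N i s := (forall j, 4 <= j < N + i -> ar s IN j = m j) /\ (forall a, 64 <= a < S -> lo s a = m a).
have step N e1 e2 s : Q 64 N s -> N <= n + n ->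
  (forall i s, i < n -> eval (setv vx i s) e1 = 64 + (N + i)) -> (forall i s, i < n -> eval (setv vx i s) e2 = N + i) ->
  N + n <= n + n ->
  Q 64 (N + n) (ev (CFor vx (BP 2) (CPut IN e1 (ELo e2))) s).
  move=> HQ HN E1 E2 HN2.
  have [||s0 [Q1 Q2] ->] := @for_ind S par (fun i => Q 64 (N + i)) vx (BP 2) (CPut IN e1 (ELo e2)) s.
  - by rewrite addn0.
  - move=> i s0 Hi [Q1 Q2]; rewrite -[bval _ _]/n in Hi.
    rewrite -[ev _ _]/(seta IN (eval (setv vx i s0) e1) (if RB + eval (setv vx i s0) e2 < S then lo s0 (RB + eval (setv vx i s0) e2)
       else RB + eval (setv vx i s0) e2) (setv vx i s0)) E1 // E2 // /RB ifT; last lia.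
    split=> //= j Hj; rewrite /upd; case: eqP => [->|Nj]; first by apply: Q2; lia.
    by apply: Q1; lia.
  - by split.
have Q0 : Q 64 0 st by split => // j Hj; apply: H1; lia.
have A1 := step 0 (EAdd (EC 64) xE) xE _ Q0.
have A2 := step n (EAdd (EC 64) (EAdd (EP 2) xE)) (EAdd (EP 2) xE).
have [|||||QE _] := A2 (ev (CFor vx (BP 2) (CPut IN (EAdd (EC 64) xE) (ELo xE))) st).
- by apply: A1 => //; lia.
- by lia.
- by [].
- by [].
- by lia.
by move=> j Hj; apply: QE; lia.
Qed.

Variables XI XG : nat -> nat.
Hypotheses (PI : placed XI) (PG : placed XG).
Local Notation input_at := (input_at ml ms XI XG).

(** The scan runs upwards and shifts [vb] into [va], so it ends with the smaller unmarked vertex in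
    [va] and the larger in [vb]; [bit] is 2 exactly when [XI 0] is the larger. *)
Lemma recoverC_correct st : bit = (XI 1 < XI 0).+1 ->
  (forall x, 1 < x < n -> ar st IN (2 + x) = XI x) ->
  (forall x, x < n -> ar st IN (2 + (n + x)) = XG x) ->
  (forall v, ar st MARK v = 0) ->
  input_at (ev recoverC st).
Proof.
move=> Hbit H1 H2 H0.
have Hn := n_gt Hml Hms.
have I01 : XI 0 <> XI 1 by move=> /PI.1 E; have : 0 = 1 by apply: E; lia.
set c1 := CFor vx (BP 2) (CIf (ESub xE (EC 1)) (CPut MARK startE (EC 1)) CSkip).
set c2 := CFor vx (BP 2) (CIf (EA MARK xE) CSkip (CSeq (CSet va (EV vb)) (CSet vb xE))).
have [s1 D1] : exists s1, s1 = ev c1 st by eexists.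
have [s2 D2] : exists s2, s2 = ev c2 s1 by eexists.
have M1 v : ar s1 MARK v = 0 <-> forall x, 1 < x < n -> XI x <> v.
  pose Q i s := forall v, ar s MARK v = 0 <-> forall x, 1 < x < i -> XI x <> v.
  move: v; rewrite D1 /c1; set body := CIf _ _ _.
  have [||s0 Q0 ->] := @for_frame S par Q vx (BP 2) body st; last by move=> v; exact: Q0.
    by move=> v; rewrite H0; split=> // _ x; lia.
  move=> i s Hi Fa _ HQ v; rewrite -[bval _ _]/n in Hi.
  have Ei : 1 < i -> ar s IN (2 + i) = XI i by move=> Hi1; rewrite Fa // H1 // Hi1.
  rewrite /body /= /upd /=; case: (i - 1 =P 0) => Ei1 /=.
    rewrite HQ; split=> Hx x Hxi; apply: Hx; lia.
  rewrite /upd Ei; last lia.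
  case: (v =P XI i) => [->|Nv].
    by split=> // /(_ i) []; lia.
  rewrite HQ; split=> Hx x Hxi; last by apply: Hx; lia.
  by case: (x =P i) => [->|Nx]; [move/esym | apply: Hx; lia].
have U v : v < n -> ar s1 MARK v = 0 <-> v = XI 0 \/ v = XI 1.
  move=> Hv; rewrite M1; split.
    have [x Hx <-] := inj_on_surj PI.1 PI.2 Hv.
    by case: x Hx => [|[|x]] Hx; [left|right|move=> /(_ x.+2) []; lia].
  move=> Ev x Hx E; have xn : x < n by lia.
  have [y [yn y2 Ey]] : exists y, [/\ y < n, y < 2 & XI y = v].
    by case: Ev => ->; [exists 0|exists 1]; split=> //; lia.
  by have := PI.1 x y xn yn; rewrite E Ey => /(_ erefl); lia.
pose p := minn (XI 0) (XI 1); pose q := maxn (XI 0) (XI 1).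
have qn : q < n by rewrite /q gtn_max !PI.2 //; lia.
have [V1 V2] : vr s2 va = p /\ vr s2 vb = q.
  pose Q i s := (q < i -> vr s va = p /\ vr s vb = q) /\ (p < i -> i <= q -> vr s vb = p).
  have pq : p < q by rewrite /p /q; lia.
  have Ueq v : v < n -> (ar s1 MARK v == 0) = (v == p) || (v == q).
    move=> Hv; have [h1 h2] := U v Hv.
    apply/eqP/orP => [/h1|] H; first by case: H => ->; rewrite /p /q; case: leqP; rewrite ?eqxx ?orbT; lia.
    by apply: h2; case: H => /eqP ->; rewrite /p /q; lia.
  rewrite D2 /c2; set body := CIf _ _ _.
  have [||s0 [Q1 Q2] ->] := @for_frame S par Q vx (BP 2) body s1; last exact: Q1.
    by split.
  move=> i s Hi Fa _ [Q1 Q2]; rewrite -[bval _ _]/n in Hi.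
  rewrite /body /= /upd /= Fa // Ueq //.
  case: ifP => [/orP[] /eqP Ei|/negbT Ei]; rewrite /Q /= /upd /=; split.
  - by move=> Hq; lia.
  - by rewrite Ei.
  - by move=> _; split; [apply: Q2; lia | rewrite Ei].
  - by move=> _ Hq; lia.
  - by move=> Hq; apply: Q1; lia.
  - by move=> Hq Hq'; apply: Q2; lia.
have A2 k : k != MARK -> ar s2 k = ar st k.
  by move=> Hk; rewrite D2 frame_a // D1 frame_a //= orbF.
rewrite /recoverC -/c1 -/c2.
rewrite -[ev _ _]/(ev (CIf (ESub (EP 3) (EC 1))
    (CSeq (CPut IN (EC 2) (EV vb)) (CPut IN (EC 3) (EV va)))
    (CSeq (CPut IN (EC 2) (EV va)) (CPut IN (EC 3) (EV vb)))) (ev c2 (ev c1 st))) -D1 -D2.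
move=> x Hx; rewrite /= /params /= /upd /= V1 V2 Hbit subn1 /=.
have [X Y] : ar s2 IN (2 + (n + x)) = XG x /\ (1 < x -> ar s2 IN (2 + x) = XI x).
  by rewrite A2 //; split; [exact: H2 | move=> x1; apply: H1; lia].
case: ltnP => E /=; rewrite /upd /p /q.
  split; last by rewrite !ifN //; lia.
  case: (x =P 0) => [->|x0]; first by rewrite /=; lia.
  case: (x =P 1) => [->|x1]; first by rewrite /=; lia.
  by rewrite !ifN ?Y //; lia.
split; last by rewrite !ifN //; lia.
case: (x =P 0) => [->|x0]; first by rewrite /=; lia.
case: (x =P 1) => [->|x1]; first by rewrite /=; lia.
by rewrite !ifN ?Y //; lia.
Qed.

Lemma outputC_correct st : 64 + ml * (rate.+1 * n) <= S ->
  let s' := ev outputC st in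
  [/\ ar s' OUT 0 = ml * rate, forall q, 0 < q -> ar s' OUT q = ar st OUT q
    & forall q, q < ml * (rate.+1 * n) -> lo s' (64 + q) = ar st OUT (64 + q)].
Proof.
move=> HS; rewrite /outputC; move: rate HS => N HS.
set c1 := CFor vx _ _; set b3 := CSeq (CLo _ _) _; set c3 := CFor vx (BP 2) b3.
set c2 := CFor vc _ c3; set c4 := CFor vt _ c2.
have [s1 [E1 E2]] : exists s1, [/\ s1 = ev c1 (ev (CPut OUT (EC 0) (EC 0)) st) &
   forall q, ar s1 OUT q = if q == 0 then ml * N else ar st OUT q].
  eexists; split; first by [].
  rewrite /c1; set body := CPut _ _ _.
  have [||s0 Q ->] := @for_frame S par (fun i s => forall q, ar s OUT q = if q == 0 then i * N else ar st OUT q)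
     vx (BP 0) body (ev (CPut OUT (EC 0) (EC 0)) st).
  - by move=> q; rewrite /= /upd.
  - move=> i s Hi _ _ HQ q; rewrite /body /= /upd /= !HQ /=; case: eqP => // _; rewrite mulSnr //.
  - exact: Q.
pose J c s := [/\ vr s vv = c, ar s OUT = ar s1 OUT & forall q, q < c -> lo s (64 + q) = ar st OUT (64 + q)].
have Jset y v c s : y != vv -> J c s -> J c (setv y v s).
  by move=> Hy [J1 J2 J3]; split=> //=; rewrite /upd eq_sym (negbTE Hy).
have Jb c s : 64 + c < S -> J c s -> J c.+1 (ev b3 s).
  move=> Hc [J1 J2 J3]; rewrite /b3 /= /setlo /RB J1 Hc; split=> //=.
    by rewrite /upd /= J1 addn1.
  move=> q Hq; rewrite /upd; case: eqP => [Eq|Nq].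
    by rewrite J2 E2 /= -Eq.
  by apply: J3; lia.
have J3 c s : 64 + (c + n) <= S -> J c s -> J (c + n) (ev c3 s).
  move=> Hc HJ.
  have [||s0 Q ->] := @for_ind S par (fun i => J (c + i)) vx (BP 2) b3 s; first by rewrite addn0.
    move=> i s0 Hi HJ0; rewrite -[bval _ _]/n in Hi; rewrite addnS; apply: Jb; first lia.
    exact: Jset.
  exact: Jset.
have J2 c s : 64 + (c + N.+1 * n) <= S -> J c s -> J (c + N.+1 * n) (ev c2 s).
  move=> Hc HJ.
  have [||s0 Q ->] := @for_ind S par (fun i => J (c + i * n)) vc (BC N.+1) c3 s; first by rewrite addn0.
    move=> i s0 Hi HJ0; rewrite -[bval _ _]/(N.+1) in Hi; rewrite mulSnr addnA; apply: J3; last exact: Jset.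
    have : i.+1 * n <= N.+1 * n by rewrite leq_mul2r Hi orbT.
    by rewrite mulSnr; lia.
  exact: Jset.
have J4 : J (ml * (N.+1 * n)) (ev c4 (setv vv 0 s1)).
  have [||s0 Q ->] := @for_ind S par (fun i => J (i * (N.+1 * n))) vt (BP 0) c2 (setv vv 0 s1).
    by split.
    move=> i s0 Hi HJ0; rewrite -[bval _ _]/ml in Hi; rewrite mulSnr; apply: J2; last exact: Jset.
    have : i.+1 * (N.+1 * n) <= ml * (N.+1 * n) by rewrite leq_mul2r Hi orbT.
    by rewrite mulSnr; lia.
  exact: Jset.
have -> : ev (CSeq (CPut OUT (EC 0) (EC 0)) (CSeq c1 (CSeq (CSet vv (EC 0)) c4))) st
  = ev c4 (setv vv 0 s1) by rewrite E1.
case: J4 => _ K2 K3; split=> //.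
- by rewrite K2 E2.
- by move=> [|q] // _; rewrite K2 E2.
Qed.

Lemma mainC_correct st (m : nat -> nat) : 64 + ml * (rate.+1 * n) <= S ->
  bit = (XI 1 < XI 0).+1 ->
  (forall j, 4 <= j < 64 -> ar st IN j = m j) ->
  (forall k j, k < 16 -> k != IN -> ar st k j = 0) ->
  (forall a, 64 <= a < S -> lo st a = m a) ->
  (forall x, x < n -> m (2 + x) = XI x /\ m (2 + n + x) = XG x) ->
  let s' := ev mainC st in let T := ml * rate in
  ar s' OUT 0 = T /\ exists tr : nat -> nat -> nat,
   [/\ forall x, x < n -> tr 0 x = XI x, forall x, x < n -> tr T x = XG x,
       forall k, k < T -> exists2 f, legal ml ms f & forall x, x < n -> tr k.+1 x = f (tr k x)
     & forall k x a, k <= T -> x < n -> a = 1 + k * n + x ->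
       ar s' OUT a = tr k x /\ (64 <= a -> lo s' a = tr k x)].
Proof.
move=> HS Hbit H1 H2 H3 Hm s' T; have Hn := n_gt Hml Hms.
have HS2 : 64 + 2 * n <= S.
  apply: leq_trans HS; rewrite leq_add2l (mulnA ml) leq_mul2r mulnS; lia.
have [s1 D1] : exists s1, s1 = ev inputC st by eexists.
have [s2 D2] : exists s2, s2 = ev recoverC s1 by eexists.
have [s3 D3] : exists s3, s3 = ev tablesC s2 by eexists.
have [s4 D4] : exists s4, s4 = ev colourC s3 by eexists.
have [s5 D5] : exists s5, s5 = ev routeC s4 by eexists.
have Es' : s' = ev outputC s5.
  rewrite D5 D4 D3 D2 D1 /s' /mainC; move: inputC recoverC tablesC colourC routeC outputC.
  by [].
have Z1 k : k < 16 -> k != IN -> forall j, ar s1 k j = 0.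
  by move=> Hk Hk1 j; rewrite D1 frame_a ?H2 //= negb_or Hk1.
have I2 : input_at s2.
  rewrite D2; apply: recoverC_correct => //.
  - by move=> x Hx; rewrite D1 (inputC_correct HS2 H1 H3); [case: (Hm x) => //; lia | lia].
  - by move=> x Hx; rewrite D1 (inputC_correct HS2 H1 H3); [rewrite addnA; case: (Hm x) | lia].
  - by move=> v; apply: Z1.
have Z2 k : k < 16 -> k != IN -> k != MARK -> forall j, ar s2 k j = 0.
  move=> Hk Hk1 Hk2 j; rewrite D2 frame_a ?Z1 //=.
  by rewrite (negbTE Hk1) (negbTE Hk2).
have Ht3 : tables s3.
  rewrite D3; apply: tablesC_correct => // k; rewrite !inE.
  by do !case/orP => [/eqP ->|]; [..| move/eqP ->]; apply: Z2.
have I3 : input_at s3 by apply: input_ext I2; rewrite D3 frame_a.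
have [c1 c2] : (forall x, x < n -> ar s4 CLR x < ml) /\
  (forall x y, x < n -> y < n -> ar s4 CLR x = ar s4 CLR y ->
     XI x %% ms = XI y %% ms \/ XG x %% ms = XG y %% ms -> x = y).
  rewrite D4; apply: colourC_correct => // k j; rewrite !inE => /orP[] /eqP ->; rewrite D3 frame_a // Z2 //.
have Ht4 : tables s4 by rewrite D4; apply: tables_frame.
have I4 : input_at s4 by apply: input_ext I3; rewrite D4 frame_a.
have := routeC_correct S bit Hml Hms Hlm PI PG Ht4 I4 c1 c2; rewrite -D5 -/T.
move=> [[tr [t1 t2 t3 t4]] _ _].
have [o1 o2 o3] := outputC_correct s5 HS; rewrite -Es' in o1 o2 o3.
split=> //; exists tr; split=> // k x a Hk Hx Ea.
have a0 : 0 < a by rewrite Ea.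
split; first by rewrite o2 // Ea t4.
move=> Ha; rewrite -(subnKC Ha) o3 ?subnKC // ?Ea ?t4 //.
have : k.+1 * n <= T.+1 * n by rewrite leq_mul2r; lia.
have : T.+1 * n <= ml * (rate.+1 * n) by rewrite (mulnA ml) leq_mul2r /T mulnS; lia.
rewrite mulSn; lia.
Qed.

End Program.

(** * Configurations *)

Lemma reaches_halted P k K s s' : reaches P k s s' -> k <= K -> step P s' = None -> run P K s = s'.
Proof.
move=> [t Ht R] HK H; rewrite -(subnKC (leq_trans Ht HK)) run_add R.
by case: (K - t) => //= d; rewrite H.
Qed.

(** The interface between routing and the machine: timing and memory layout below rely only on this
    specification of the program [mc] and its rate [rt]. *)
Definition routes mc rt := forall ml ms S bit (XI XG : nat -> nat) st (m : nat -> nat),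
  3 <= ml -> 2 <= ms -> ms <= ml -> placed ml ms XI -> placed ml ms XG ->
  64 + ml * (rt.+1 * (ml * ms)) <= S -> bit = (XI 1 < XI 0).+1 ->
  (forall j, 4 <= j < 64 -> ar st IN j = m j) ->
  (forall k j, k < 16 -> k != IN -> ar st k j = 0) ->
  (forall a, 64 <= a < S -> lo st a = m a) ->
  (forall x, x < ml * ms -> m (2 + x) = XI x /\ m (2 + ml * ms + x) = XG x) ->
  let s' := ev S (params ml ms bit) mc st in let T := ml * rt in
  ar s' OUT 0 = T /\ exists tr : nat -> nat -> nat,
   [/\ forall x, x < ml * ms -> tr 0 x = XI x, forall x, x < ml * ms -> tr T x = XG x,
       forall k, k < T -> exists2 f, legal ml ms f & forall x, x < ml * ms -> tr k.+1 x = f (tr k x)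
     & forall k x a, k <= T -> x < ml * ms -> a = 1 + k * (ml * ms) + x ->
       ar s' OUT a = tr k x /\ (64 <= a -> lo s' a = tr k x)].

Lemma mainC_routes : routes mainC rate.
Proof.
move=> ml ms S bit XI XG st m h1 h2 h3 h4 h5 h6 h7 h8 h9 h10 h11.
exact: (mainC_correct h1 h2 h3 h4 h5 h6 h7 h8 h9 h10 h11).
Qed.

(** Start-up takes at most [17 * m + 210] steps and shut-down 190; 417 is 17 + 210 + 190. *)
Lemma steps_bound n d k m cost : 6 <= n -> m <= n -> d <= 3 -> cost <= k * n ^ d ->
  m * 17 + 210 + (cost + 190) <= (k + 417) * n ^ 3.
Proof.
move=> Hn Hm Hd Hc.
have H3 : n ^ d <= n ^ 3 by rewrite leq_pexp2l //; lia.
have H1 : n <= n ^ 3 by rewrite -{1}(expn1 n) leq_pexp2l //; lia.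
have : k * n ^ d <= k * n ^ 3 by rewrite leq_mul2l H3 orbT.
by rewrite mulnDl; lia.
Qed.

Section Config.
Variables ml ms : nat.
Hypotheses (Hml : 3 <= ml) (Hms : 2 <= ms) (Hlm : ms <= ml).
Local Notation n := (ml * ms).

Lemma enc_lt (v : vtx ml ms) : enc_vtx v < n.
Proof. by case: v => [[i Hi] [j Hj]]; apply: vtx_lt. Qed.

Lemma enc_div (v : vtx ml ms) : enc_vtx v %/ ms = v.1.
Proof. by rewrite /enc_vtx (divE Hml Hms). Qed.

Lemma enc_mod (v : vtx ml ms) : enc_vtx v %% ms = v.2.
Proof. by rewrite /enc_vtx modE. Qed.

Lemma enc_inj : injective (@enc_vtx ml ms).
Proof.
move=> u v E; rewrite [u]surjective_pairing [v]surjective_pairing.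
by congr pair; apply: ord_inj; rewrite -?enc_div -?enc_mod E.
Qed.

Definition natpos (X : config ml ms) x :=
  if (insub x : option 'I_n) is Some r then enc_vtx (X r) else 0.

Lemma natposE (X : config ml ms) (r : 'I_n) : natpos X r = enc_vtx (X r).
Proof. by rewrite /natpos valK. Qed.

Lemma natpos_placed (X : config ml ms) : is_config X -> placed ml ms (natpos X).
Proof.
move=> /injectiveP HX; split.
  move=> x y Hx Hy; rewrite -[x]/(val (Ordinal Hx)) -[y]/(val (Ordinal Hy)) !natposE.
  by move=> /enc_inj /HX /(congr1 val).
by move=> x Hx; rewrite -[x]/(val (Ordinal Hx)) natposE enc_lt.
Qed.

Definition decode (v0 : vtx ml ms) v : vtx ml ms :=
  (insubd v0.1 (v %/ ms), insubd v0.2 (v %% ms)).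

Lemma decK v0 v : v < n -> enc_vtx (decode v0 v) = v.
Proof.
move=> Hv; rewrite /enc_vtx /decode /= !val_insubd (vtx_row Hml Hms Hv) (vtx_col Hml Hms v).
by rewrite -divn_eq.
Qed.

Lemma legal_valid_step (X Y : config ml ms) f : legal ml ms f -> injective X ->
  (forall r, enc_vtx (Y r) = f (enc_vtx (X r))) -> valid_step X Y.
Proof.
case=> f1 f2 f3 f4 HX E; apply/and3P; split.
- apply/injectiveP => r1 r2 /(congr1 (@enc_vtx ml ms)); rewrite !E => /f2 H.
  by apply/HX/enc_inj/H; apply: enc_lt.
- apply/forallP => r; case/orP: (f3 _ (enc_lt (X r))); rewrite -E.
    by move=> /eqP /enc_inj ->; rewrite eqxx.
  by rewrite /adjv /grid_adj !enc_div !enc_mod => ->; rewrite orbT.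
- apply/existsP => -[r1 /existsP[r2 /and3P[N /eqP E1 /eqP E2]]].
  have := f4 _ (enc_lt (X r1)); rewrite -E E1 -E E2 => /(_ erefl) /enc_inj /HX E12.
  by rewrite E12 eqxx in N.
Qed.

Lemma trace_solution (XI XG : config ml ms) (tr : nat -> nat -> nat) T :
  is_config XI ->
  (forall x, x < n -> tr 0 x = natpos XI x) -> (forall x, x < n -> tr T x = natpos XG x) ->
  (forall k, k < T -> exists2 f, legal ml ms f & forall x, x < n -> tr k.+1 x = f (tr k x)) ->
  exists s, [/\ is_solution XI XG s, size s = T &
    forall k (r : 'I_n), k <= T -> enc_vtx (nth XI (XI :: s) k r) = tr k r].
Proof.
move=> /injectiveP HI t0 tT tS.
pose c k : config ml ms := [ffun r => decode (XI r) (tr k r)].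
have lt k x : k <= T -> x < n -> tr k x < n.
  elim: k => [|k IH] Hk Hx.
    by rewrite t0 // -[x]/(val (Ordinal Hx)) natposE enc_lt.
  by have [f [f1 _ _ _] ->] := tS k Hk => //; apply: f1; apply: IH => //; lia.
have cE k (r : 'I_n) : k <= T -> enc_vtx (c k r) = tr k r.
  by move=> Hk; rewrite ffunE decK // lt.
have c0 : c 0 = XI.
  by apply/ffunP => r; apply: enc_inj; rewrite cE // t0 // natposE.
have cT : c T = XG.
  by apply/ffunP => r; apply: enc_inj; rewrite cE // tT // natposE.
have inj k : k <= T -> injective (c k).
  elim: k => [|k IH] Hk; first by rewrite c0.
  have [f [f1 f2 _ _] Ef] := tS k Hk.
  move=> r1 r2 /(congr1 (@enc_vtx ml ms)); rewrite !cE // !Ef // -!cE; try lia.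
  by move=> /f2 H; apply: (IH (ltnW Hk)); apply: enc_inj; apply: H; apply: enc_lt.
pose s := mkseq (fun k => c k.+1) T.
have ns k : k <= T -> nth XI (XI :: s) k = c k.
  by case: k => [|k] Hk; rewrite ?c0 //= nth_mkseq.
exists s; split; last by move=> k r Hk; rewrite ns // cE.
  split; last by rewrite (last_nth XI) size_mkseq ns.
  apply/(pathP XI) => k; rewrite size_mkseq => Hk.
  rewrite ns ?(ltnW Hk) // /s nth_mkseq //.
  have [f Hf Ef] := tS k Hk.
  apply: (legal_valid_step Hf); first by apply: inj; apply: ltnW.
  by move=> r; rewrite !cE ?Ef //; lia.
by rewrite size_mkseq.
Qed.

(** From [ms <= ml < 2 ^ ml] the product [ml * ml * ms] is at most [8 ^ ml], and 64 + 901 <= 1024;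
    this is where the base address [1024 * 8 ^ ml] comes from. *)
Lemma memory_bound rate : rate <= 900 -> 64 + ml * (rate.+1 * n) <= 1024 * 8 ^ ml.
Proof.
move=> Hrate.
have H : ml ^ 3 <= 8 ^ ml.
  by rewrite -[8]/(2 ^ 3) -expnM mulnC expnM leq_exp2r // ltnW // ltn_expl.
have H1 : ml * n <= ml ^ 3 by rewrite !expnS expn0 muln1 leq_mul2l leq_mul2l Hlm !orbT.
have : 0 < 8 ^ ml by rewrite expn_gt0.
rewrite [ml * (_ * _)]mulnCA; move: (8 ^ ml) (ml ^ 3) H H1 => u w H H1 H2.
have : rate.+1 * (ml * n) <= 900.+1 * (ml * n) by rewrite leq_mul2r ltnS Hrate orbT.
move: (rate.+1 * (ml * n)) => z'; move: (ml * n) H1 => z H1; lia.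
Qed.

Lemma init_memI (XI XG : config ml ms) x : x < n -> init_mem XI XG (2 + x) = natpos XI x.
Proof. by move=> Hx; rewrite /init_mem addKn /natpos insubT. Qed.

Lemma init_memG (XI XG : config ml ms) x : x < n -> init_mem XI XG (2 + n + x) = natpos XG x.
Proof.
move=> Hx; rewrite /init_mem -addnA addKn addKn insubN; last by rewrite -leqNgt leq_addr.
by rewrite /natpos.
Qed.

Lemma init_mem0 (XI XG : config ml ms) a : 2 + n + n <= a -> init_mem XI XG a = 0.
Proof.
move=> Ha; rewrite /init_mem insubN ?insubN; try by rewrite -leqNgt; lia.
by case: eqP; [lia|]; case: eqP; [lia|].
Qed.

Lemma program_correct mc rate (XI XG : config ml ms) (c := coef mc + 417) :
  [&& wf_cmd mc, degree mc <= 3 & loops_over (fun p => p < 3) mc] -> routes mc rate -> rate <= 900 ->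
  is_config XI -> is_config XG ->
  halted (assemble mc) (final_state (assemble mc) c XI XG) /\
  exists s, [/\ encodes_solution (final_state (assemble mc) c XI XG).2 XI s,
                is_solution XI XG s & size s = ml * rate].
Proof.
move=> Hmc Hrt Hrate HI HG; have Hn := n_gt Hml Hms.
have PI := natpos_placed HI; have PG := natpos_placed HG.
pose m := init_mem XI XG; pose S := 1024 * 8 ^ ml; have HS := memory_bound Hrate; rewrite -/S in HS.
have HS2 : 64 + 2 * n <= S.
  apply: leq_trans HS; rewrite leq_add2l (mulnA ml) leq_mul2r mulnS; lia.
have Hm x : x < n -> m (2 + x) = natpos XI x /\ m (2 + n + x) = natpos XG x.
  by move=> Hx; split; [exact: init_memI | exact: init_memG].
have m2 : m 2 = natpos XI 0 by rewrite -(init_memI XI XG) //; lia.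
have m3 : m 3 = natpos XI 1 by rewrite -(init_memI XI XG) //; lia.
have m23 : m 2 != m 3.
  by apply/eqP; rewrite m2 m3 => /PI.1 E; have : 0 = 1 by apply: E; lia.
have /and3P[Wc Hd Hl] := Hmc.
have m0 a : S <= a -> m a = 0 by move=> Ha; apply: init_mem0; lia.
have [st [m' [S1 S2 S3] [T F1 F2]]] := @assemble_correct mc ml ms m Wc erefl erefl m23 m0.
set par := params ml ms _ in T F1 F2.
have Hc : cmd_cost par mc <= coef mc * n ^ degree mc.
  apply: cmd_cost_le Hl; first lia.
  have := ml_le_n Hml Hms; have := ms_le_n Hml Hms.
  by move=> h1 h2 [|[|[|k]]] //= _; rewrite /par /params /=.
(* The program halts by running past its last instruction, where the default [IHALT] is read. *)
have Hst : step (assemble mc) (size (assemble mc), m') = None.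
  by rewrite /step nth_default.
have Efin : final_state (assemble mc) c XI XG = (size (assemble mc), m').
  exact: (reaches_halted T (steps_bound Hn (ml_le_n Hml Hms) Hd Hc) Hst).
rewrite Efin /halted Hst; split; first by [].
have Hbit : (m 3 < m 2).+1 = (natpos XI 1 < natpos XI 0).+1 by rewrite m2 m3.
have [o0 [tr [t0 tT tS tO]]] := Hrt _ _ _ _ _ _ _ _ Hml Hms Hlm PI PG HS Hbit S1 S2 S3 Hm.
have [s [s1 s2 s3]] := trace_solution HI t0 tT tS.
exists s; split; [|exact: s1|exact: s2].
split; first by rewrite -[LHS]/(m' 0) (F1 0 isT) o0 s2.
move=> k r; rewrite s2 -[(_, m').2]/m' => Hk; rewrite (s3 k r Hk).
have [o1 o2] := tO k r _ Hk (ltn_ord r) erefl.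
case: (ltnP (1 + k * n + r) 64) => Ha; first by rewrite (F1 _ Ha) o1.
have Hlt : 1 + k * n + r < S.
  apply: leq_trans HS.
  have : k.+1 * n <= (ml * rate).+1 * n by rewrite leq_mul2r; apply/orP; right.
  have : (ml * rate).+1 * n <= ml * (rate.+1 * n).
    by rewrite (mulnA ml) leq_mul2r mulnS; apply/orP; right; move: (ml * _) => z; lia.
  rewrite mulSn => h1 h2; have h3 := ltn_ord r; have h4 := leq_trans h2 h1.
  by apply: leq_trans (leq_add (leqnn 64) h4); lia.
have Hin : 64 <= 1 + k * n + r < S by rewrite Ha Hlt.
by rewrite (F2 _ Hin) (o2 Ha).
Qed.

End Config.

(** * The average ratio *)

Import Order.TTheory GRing.Theory Num.Theory.

Definition natdist a b := (a - b) + (b - a).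

Section Average.
Variables ml ms : nat.
Local Notation n := (ml * ms).
Local Notation V := (vtx ml ms).

Lemma solution_dist (XI XG : config ml ms) s r : is_solution XI XG s ->
  natdist (XI r).1 (XG r).1 <= size s.
Proof.
case; elim: s XI => [|Y s IH] XI /=; first by move=> _ ->; rewrite /natdist subnn.
move=> /andP[/and3P[_ /forallP /(_ r) H _] Hp] Hl.
have := IH _ Hp Hl; rewrite /natdist.
case/orP: H => [/eqP ->|]; first by lia.
by rewrite /grid_adj; lia.
Qed.

(** * Equidistribution of the goals of two robots *)

Definition confs : {set config ml ms} := [set X | is_config X].

Definition confs2 (r0 r1 : 'I_n) (v : V * V) := [set X in confs | (X r0 == v.1) && (X r1 == v.2)].

(** Composing configurations with a vertex permutation that carries the pair [v] to the pair [u] is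
    injective. *)
Lemma confs2_le r0 r1 v u : v.1 != v.2 -> u.1 != u.2 -> #|confs2 r0 r1 v| <= #|confs2 r0 r1 u|.
Proof.
case: v u => [v0 v1] [u0 u1] /= Nv Nu.
(* The first transposition takes [v0] to [u0] and [v1] to [w]; the second takes [w] to [u1] and
   fixes [u0]. *)
pose w := tperm v0 u0 v1.
pose g := (tperm v0 u0 * tperm w u1)%g.
have Nw : w != u0.
  by rewrite /w -[X in _ != X](tpermL v0 u0) (inj_eq perm_inj) eq_sym.
have g0 : g v0 = u0 by rewrite /g permM tpermL tpermD // eq_sym.
have g1 : g v1 = u1 by rewrite /g permM -/w tpermL.
pose f (X : config ml ms) : config ml ms := [ffun r => g (X r)].
have fI : injective f.
  move=> X Y /ffunP E; apply/ffunP => r; have := E r; rewrite !ffunE; exact: perm_inj.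
rewrite -(card_imset _ fI); apply/subset_leq_card/subsetP => _ /imsetP[X HX ->].
move: HX; rewrite !inE => /andP[/injectiveP HX /andP[/eqP E0 /eqP E1]] /=.
rewrite !ffunE E0 E1 /= g0 g1 !eqxx !andbT.
by apply/injectiveP => r r'; rewrite !ffunE => /perm_inj /HX.
Qed.

(** By symmetry all [n * n.-1] ordered pairs of distinct vertices are taken by equally many
    configurations, and pairs of equal vertices by none. *)
Lemma confs2_card r0 r1 v : r0 != r1 -> v.1 != v.2 ->
  #|confs| = #|confs2 r0 r1 v| * (n * n.-1).
Proof.
move=> Nr Nv.
have -> : #|confs| = \sum_(u : V * V) #|confs2 r0 r1 u|.
  rewrite -sum1_card (partition_big (fun X : config ml ms => (X r0, X r1)) xpredT) //=.
  apply: eq_bigr => u _; rewrite -sum1_card; apply: eq_bigl => X.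
  by rewrite !inE.
rewrite (bigID (fun u : V * V => u.1 != u.2)) /= [X in _ + X]big1 ?addn0; last first.
  move=> u; rewrite negbK => /eqP E; apply: eq_card0 => X; rewrite !inE.
  apply/negP => /andP[/injectiveP HX /andP[/eqP E0 /eqP E1]].
  by move/eqP: Nr; apply; apply: HX; rewrite E0 E1.
rewrite (eq_bigr (fun _ => #|confs2 r0 r1 v|)) => [|u Nu]; last first.
  by apply/eqP; rewrite eqn_leq !confs2_le.
rewrite sum_nat_const mulnC; congr (_ * _).
rewrite -sum1_card -(pair_big_dep xpredT (fun i j : V => i != j) (fun _ _ => 1)) /=.
rewrite (eq_bigr (fun _ => n.-1)) => [|u _].
  by rewrite sum_nat_const card_prod !card_ord.
rewrite sum1_card (eq_card (B := predC1 u)) => [|x]; last by rewrite !inE eq_sym.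
by rewrite cardC1 card_prod !card_ord.
Qed.

Lemma near_count i x : \sum_(a < ml) (natdist i a <= x : nat) <= 2 * x + 1.
Proof.
rewrite -(big_mkord xpredT (fun a => (natdist i a <= x : nat))) -big_mkcond /= sum1_count.
rewrite -size_filter -(size_iota (i - x) (2 * x + 1)); apply: uniq_leq_size.
  by rewrite filter_uniq // iota_uniq.
by move=> a; rewrite mem_filter mem_iota /natdist; lia.
Qed.

Lemma near_vtx_count i x : \sum_(v : V) (natdist i v.1 <= x : nat) <= ms * (2 * x + 1).
Proof.
rewrite -(pair_bigA _ (fun (a : 'I_ml) (_ : 'I_ms) => (natdist i a <= x : nat))) /= exchange_big /=.
apply: (@leq_trans (\sum_(j < ms) (2 * x + 1))).
  by apply: leq_sum => j _; apply: near_count.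
by rewrite sum_nat_const card_ord.
Qed.

Local Open Scope ring_scope.

Definition weight i0 i1 (v0 v1 : V) : rat :=
  ((maxn (natdist i0 v0.1) (natdist i1 v1.1)).+1%:R)^-1.

Lemma weight_ge0 i0 i1 v0 v1 : 0 <= weight i0 i1 v0 v1.
Proof. by rewrite /weight invr_ge0 ler0n. Qed.

(** If [v0] is at distance [x], at most [ms * (2 * x + 1)] vertices [v1] are as close, each with
    weight [1 / (x + 1)]. Every [v0] thus contributes at most [2 * ms], and no logarithm arises. *)
Lemma half_sum i0 i1 :
  \sum_(v0 : V) \sum_(v1 : V) (natdist i1 v1.1 <= natdist i0 v0.1)%:R / (natdist i0 v0.1).+1%:R
    <= (2 * ms * n)%:R :> rat.
Proof.
apply: (@le_trans _ _ (\sum_(v0 : V) (2 * ms)%:R)); last first.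
  by rewrite sumr_const card_prod !card_ord -mulrnA.
apply: ler_sum => v0 _; rewrite -mulr_suml -natr_sum.
rewrite ler_pdivrMr ?ltr0n // -natrM ler_nat.
apply: leq_trans (near_vtx_count _ _) _; move: (natdist _ _) => x; nia.
Qed.

(* Splitting according to which distance is larger makes the sum over the other
   vertex a count of at most [2 x + 1] rows. *)
Lemma weight_sum i0 i1 : \sum_(v0 : V) \sum_(v1 : V) weight i0 i1 v0 v1 <= (4 * ms * n)%:R.
Proof.
have H := lerD (half_sum i0 i1) (half_sum i1 i0).
rewrite [X in _ + X]exchange_big /= in H.
have -> : (4 * ms * n)%:R = (2 * ms * n)%:R + (2 * ms * n)%:R :> rat by rewrite -natrD; congr _%:R; lia.
apply: le_trans H; rewrite -big_split /=; apply: ler_sum => v0 _.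
rewrite -big_split /=; apply: ler_sum => v1 _; rewrite /weight.
move: (natdist i0 _) (natdist i1 _) => x y.
have P z : 0 <= (z.+1%:R)^-1 :> rat by rewrite invr_ge0 ler0n.
case: (leqP y x) => Hxy.
  by rewrite mul1r lerDl mulr_ge0 ?ler0n.
by rewrite (ltnW Hxy) mul0r add0r mul1r.
Qed.

Lemma conf_sum (X : config ml ms) (r0 r1 : 'I_n) : r0 != r1 -> (2 <= n)%N ->
  \sum_(Y in confs) weight (X r0).1 (X r1).1 (Y r0) (Y r1) * (n * n.-1)%:R
    <= (4 * ms * n * #|confs|)%:R.
Proof.
move=> Nr Hn; rewrite -mulr_suml.
set i0 := (X r0).1; set i1 := (X r1).1.
have -> : \sum_(Y in confs) weight i0 i1 (Y r0) (Y r1) =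
   \sum_(u : V * V) (#|confs2 r0 r1 u|)%:R * weight i0 i1 u.1 u.2.
  rewrite (partition_big (fun X : config ml ms => (X r0, X r1)) xpredT) //=.
  apply: eq_bigr => u _; rewrite (eq_bigr (fun _ => weight i0 i1 u.1 u.2)); last first.
    by move=> Y /andP[_ /eqP <-].
  rewrite sumr_const mulr_natl; congr (_ *+ _); apply: eq_card => Y.
  by rewrite unfold_in !inE.
rewrite mulr_suml.
(* Pairs of equal vertices have no configuration on the left; admitting them on the right only
   enlarges the sum. *)
apply: (@le_trans _ _ (\sum_(u : V * V) #|confs|%:R * weight i0 i1 u.1 u.2)).
  apply: ler_sum => u _; rewrite mulrAC; apply: ler_wpM2r; first exact: weight_ge0.
  rewrite -natrM ler_nat; case: (eqVneq u.1 u.2) => [E|N]; last by rewrite -confs2_card.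
  rewrite (_ : #|_| = 0%N) ?mul0n //; apply: eq_card0 => Y; rewrite !inE.
  apply/negP => /andP[/injectiveP HY /andP[/eqP E0 /eqP E1]].
  by move/eqP: Nr; apply; apply: HY; rewrite E0 E1.
rewrite -mulr_sumr natrM mulrC; apply: ler_wpM2r; first exact: ler0n.
by rewrite -(pair_bigA _ (weight i0 i1)); apply: weight_sum.
Qed.

(** The constant is 32 = 2 * 8 * 2. Passing from [M.+1] to the optimum costs 2; the average of the
    weights, [4 * ms * n / (n * n.-1)], is at most 8 after multiplication by [ml]; leaving out the
    pairs with equal start and goal costs 2. *)
Lemma average_bound K (out opt : config ml ms -> config ml ms -> nat) :
  (3 <= ml)%N -> (2 <= ms)%N ->
  (forall XI XG, is_config XI -> is_config XG -> is_min_makespan XI XG (opt XI XG)) ->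
  (forall XI XG, is_config XI -> is_config XG -> out XI XG = (ml * K)%N) ->
  (\sum_(p in instances ml ms) ((out p.1 p.2)%:R / (opt p.1 p.2)%:R : rat))
    / (#|instances ml ms|)%:R <= (32 * K)%:R.
Proof.
move=> Hml Hms Hopt Hout.
have Hn : (6 <= n)%N by nia.
have n0 : (0 < n)%N by lia. have n1 : (1 < n)%N by lia.
pose r0 : 'I_n := Ordinal n0; pose r1 : 'I_n := Ordinal n1.
have Nr : r0 != r1 by [].
pose w (p : config ml ms * config ml ms) := weight (p.1 r0).1 (p.1 r1).1 (p.2 r0) (p.2 r1).
have term p : p \in instances ml ms ->
    (out p.1 p.2)%:R / (opt p.1 p.2)%:R <= (2 * (ml * K))%:R * w p :> rat.
  rewrite inE => /and3P[H1 H2 N]; rewrite Hout //.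
  have [[s [Hs Es]] _] := Hopt _ _ H1 H2.
  have d0 := solution_dist r0 Hs; have d1 := solution_dist r1 Hs; rewrite Es in d0 d1.
  (* Start and goal differ, so an optimal solution is not empty; this gives [M.+1 <= 2 * opt]
     below. *)
  have o0 : (0 < opt p.1 p.2)%N.
    rewrite lt0n; apply: contraNneq N => E; case: s Hs Es => [|Y s] [_ /= Hl] //; last by rewrite E.
    by rewrite Hl.
  have -> : (2 * (ml * K))%:R = (ml * K)%:R * 2%:R :> rat by rewrite mulnC natrM.
  rewrite -mulrA; apply: ler_wpM2l; first exact: ler0n.
  rewrite /w /weight; set M := maxn _ _.
  have M1 : (M <= opt p.1 p.2)%N by rewrite geq_max d0 d1.
  have HM : (M.+1 <= 2 * opt p.1 p.2)%N by lia.
  rewrite ler_pdivlMr ?ltr0n // mulrC ler_pdivrMr ?ltr0n //.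
  by rewrite -natrM ler_nat.
set N := #|confs|.
pose A := finset.setX confs confs; pose D := [set p : config ml ms * config ml ms | p.1 == p.2].
have Einst : instances ml ms = A :\: D.
  by apply/setP => p; rewrite !inE; case: (is_config _); case: (is_config _); rewrite ?andbF ?andbT.
have Hcard : (N * N <= N + #|instances ml ms|)%N.
  rewrite Einst -cardsX -(cardsID D) leq_add2r.
  apply: leq_trans (leq_imset_card (fun X => (X, X)) confs).
  apply/subset_leq_card/subsetP => -[X Y]; rewrite !inE /= => /andP[/andP[HX _] /eqP <-].
  by apply: imset_f; rewrite inE.
have Hc2 : (N * N <= 2 * #|instances ml ms|)%N.
  (* [N] is a multiple of [n * n.-1], hence never 1, and the diagonal is at most half of all
     pairs. *)
  have : (N == 0%N) || (2 <= N)%N.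
    pose v0 : V := (Ordinal (ltnW (ltnW Hml)), Ordinal (ltnW Hms)).
    pose v1 : V := (Ordinal (ltnW Hml), Ordinal (ltnW Hms)).
    have := @confs2_card r0 r1 (v0, v1) Nr isT; rewrite -/N => ->.
    have H2 : (2 <= n * n.-1)%N.
      by apply: (@leq_trans (n * 1)); [lia | rewrite leq_mul2l; apply/orP; right; lia].
    case: #|_| => [|k] //; apply/orP; right.
    by apply: leq_trans H2 _; rewrite leq_pmull.
  by nia.
pose W := \sum_(p in A) w p.
have HW : W * (n * n.-1)%:R <= (4 * ms * n * N * N)%:R.
  have -> : W = \sum_(X in confs) \sum_(Y in confs) weight (X r0).1 (X r1).1 (Y r0) (Y r1).
    by rewrite pair_big; apply: eq_bigl => p; rewrite !inE.
  rewrite mulr_suml; apply: (@le_trans _ _ (\sum_(X in confs) (4 * ms * n * N)%:R)).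
    by apply: ler_sum => X _; rewrite mulr_suml; apply: conf_sum.
  by rewrite sumr_const -mulrnA.
have HmW : ml%:R * W <= (8 * N * N)%:R.
  have P : 0 < (n * n.-1)%:R :> rat by rewrite ltr0n muln_gt0; apply/andP; split; lia.
  rewrite -(ler_pM2r P) -mulrA; apply: le_trans (ler_wpM2l (ler0n _ ml) HW) _.
  rewrite -!natrM ler_nat.
  have -> : (ml * (4 * ms * n * N * N) = (4 * n * (N * N)) * n)%N by lia.
  have -> : (8 * N * N * (n * n.-1) = (4 * n * (N * N)) * (2 * n.-1))%N by lia.
  by rewrite leq_mul2l; apply/orP; right; lia.
have [E0|I0] := posnP #|instances ml ms|; first by rewrite E0 invr0 mulr0 ler0n.
rewrite ler_pdivrMr ?ltr0n //.
apply: (@le_trans _ _ (\sum_(p in instances ml ms) (2 * (ml * K))%:R * w p)); first exact: ler_sum.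
rewrite -mulr_sumr.
apply: (@le_trans _ _ ((2 * (ml * K))%:R * W)).
  apply: ler_wpM2l; first exact: ler0n.
  rewrite /W [X in _ <= X](big_setID D) /= -Einst lerDr; apply: sumr_ge0 => p _; exact: weight_ge0.
have -> : (2 * (ml * K))%:R = (2 * K)%:R * ml%:R :> rat by rewrite -natrM; congr _%:R; lia.
rewrite -mulrA; apply: le_trans (ler_wpM2l (ler0n _ _) HmW) _.
rewrite -!natrM ler_nat.
have -> : (2 * K * (8 * N * N) = 16 * K * (N * N))%N by lia.
have -> : (32 * K * #|instances ml ms| = 16 * K * (2 * #|instances ml ms|))%N by lia.
by rewrite leq_mul2l Hc2 orbT.
Qed.

End Average.

Local Open Scope ring_scope.

Theorem theorem3 :
  exists (C : rat) (P : program) (c N0 : nat),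
    (* P halts within c * |V|^3 steps on every instance and outputs a valid solution *)
    (forall (ml ms : nat) (XI XG : config ml ms),
        (3 <= ml)%N -> (2 <= ms)%N -> (ms <= ml)%N ->
        is_config XI -> is_config XG ->
        halted P (final_state P c XI XG) /\
        exists s, encodes_solution (final_state P c XI XG).2 XI s /\
                  is_solution XI XG s) /\
    (* average approximation ratio over instances with XI <> XG is at most C *)
    (forall (ml ms : nat), (N0 <= ml)%N -> (3 <= ml)%N -> (2 <= ms)%N -> (ms <= ml)%N ->
      forall opt : config ml ms -> config ml ms -> nat,
        (forall XI XG : config ml ms, is_config XI -> is_config XG ->
           is_min_makespan XI XG (opt XI XG)) ->
        (\sum_(p in instances ml ms)
            ((out_makespan P c p.1 p.2)%:R / (opt p.1 p.2)%:R : rat))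
          / (#|instances ml ms|)%:R <= C).
Proof.
have [mc [rt [Hwf [Hrt Hle]]]] : exists mc rt,
    [&& wf_cmd mc, (degree mc <= 3)%N & loops_over (fun p => (p < 3)%N) mc] /\
    routes mc rt /\ (rt <= 900)%N.
  exists mainC, rate; split; first exact: mainC_wf.
  by split; [exact: mainC_routes | rewrite rateE].
(* For the rate 222 the constant is 32 * 222 = 7104; 417 pays for start-up and shut-down. *)
exists (32 * rt)%:R, (assemble mc), (coef mc + 417)%N, 0%N; split.
  move=> ml ms XI XG Hml Hms Hlm HI HG.
  have [H [s [H1 H2 _]]] := program_correct Hml Hms Hlm Hwf Hrt Hle HI HG.
  by split; [exact: H | exists s].
move=> ml ms _ Hml Hms Hlm opt Hopt.
apply: (average_bound Hml Hms Hopt) => XI XG HI HG.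
have [_ [s [[H1 _] _ Hs]]] := program_correct Hml Hms Hlm Hwf Hrt Hle HI HG.
by rewrite /out_makespan H1.
Qed.
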